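(* For each sentence $A$ in the language of second order arithmetic, if $\Sigma^{1-}_{2}\mbox{-CA}+\Pi^{1}_{1}\mbox{-CA}_{0}\vdash A$, then $\mathsf{KP}\ell^{r}+(M\prec_{\Sigma_{1}}V)\vdash A^{set}$.
   Context: $\Pi^1_1\mbox{-CA}_0$ is the usual subsystem of second order arithmetic with $\Pi^1_1$-Comprehension and restricted induction. $\Sigma^{1-}_{2}\mbox{-CA}+\Pi^{1}_{1}\mbox{-CA}_{0}$ is obtained from it by adding $\exists Y\forall x[x\in Y\leftrightarrow A(x)]$ for each $\Sigma^1_2$-formula $A(x)$ in which no second order free variable occurs (first order parameters may occur). $\mathsf{KP}\ell^r$ is obtained from Kripke–Platek set theory $\mathsf{KP}\omega$ with the axiom of Infinity by deleting $\Delta_0$-Collection on the universe, restricting the Foundation schema to $\Delta_0$-formulas, and adding the axiom $(Lim)$: $\forall x\exists y(x\in y\land Ad(y))$, stating that the universe is a limit of admissible sets, where $Ad$ is a unary predicate such that $Ad(y)$ expresses that $y$ is a (transitive and) admissible set. $\mathsf{KP}\ell^{r}+(M\prec_{\Sigma_{1}}V)$ extends $\mathsf{KP}\ell^r$ by an individual constant $M$ and the axioms: $M\ne\emptyset$; $\forall x\in M\forall y\in x(y\in M)$; and $\varphi(u_1,\ldots,u_n)\land\{u_1,\ldots,u_n\}\subset M\to\varphi^M(u_1,\ldots,u_n)$ for each $\Sigma_1$-formula $\varphi$ in the set-theoretic language. For a formula $A$ of second order arithmetic, $A^{set}$ is the formula of set theory obtained by interpreting first order variables $x$ as ranging over $x\in\omega$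 and second order variables $X$ as ranging over $X\subset\omega$. *)

(* Defs.v *)
(* Classical first order logic is set up twice, with de Bruijn indices: two-sorted for
   second order arithmetic (module [SOA]) and one-sorted for set theory (module [ST]).
   The primitive connectives are falsum, implication and universal quantification; the
   other ones are their classical abbreviations.  Derivability is a Hilbert calculus with
   modus ponens and generalization, so an axiom with free variables amounts to its
   universal closure. *)

Declare Scope soa_scope.
Delimit Scope soa_scope with soa.
Declare Scope st_scope.
Delimit Scope st_scope with st.

Reserved Notation "# n" (at level 2, n at level 1, format "# n").
Reserved Notation "t == u" (at level 70, no associativity).
Reserved Notation "t << u" (at level 70, no associativity).
Reserved Notation "t \in u" (at level 70, no associativity).
Reserved Notation "~~ A" (at level 75, right associativity).
Reserved Notation "A &&& B" (at level 80, right associativity).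
Reserved Notation "A ||| B" (at level 85, right associativity).
Reserved Notation "A --> B" (at level 90, right associativity).
Reserved Notation "A <--> B" (at level 95, no associativity).

Definition scons {X : Type} (x : X) (s : nat -> X) (n : nat) : X :=
  match n with 0 => x | S m => s m end.

Module SOA.

(* Two separate index spaces: number variables and set variables. *)
Inductive term : Type :=
| nvar (n : nat)
| zero
| one
| add (t u : term)
| mul (t u : term).

Inductive form : Type :=
| Eq (t u : term)
| Lt (t u : term)
| In (t : term) (X : nat)
| Bot
| Imp (A B : form)
| All1 (A : form)
| All2 (A : form).

Definition Neg (A : form) : form := Imp A Bot.
Definition And (A B : form) : form := Neg (Imp A (Neg B)).
Definition Or (A B : form) : form := Imp (Neg A) B.
Definition Iff (A B : form) : form := And (Imp A B) (Imp B A).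
Definition Ex1 (A : form) : form := Neg (All1 (Neg A)).
Definition Ex2 (A : form) : form := Neg (All2 (Neg A)).

Notation "# n" := (nvar n) : soa_scope.
Notation "t == u" := (Eq t u) : soa_scope.
Notation "t << u" := (Lt t u) : soa_scope.
Notation "t \in X" := (In t X) : soa_scope.
Notation "~~ A" := (Neg A) : soa_scope.
Notation "A &&& B" := (And A B) : soa_scope.
Notation "A ||| B" := (Or A B) : soa_scope.
Notation "A --> B" := (Imp A B) : soa_scope.
Notation "A <--> B" := (Iff A B) : soa_scope.
Notation "t + u" := (add t u) : soa_scope.
Notation "t * u" := (mul t u) : soa_scope.
Bind Scope soa_scope with term.
Bind Scope soa_scope with form.
Local Open Scope soa_scope.

Fixpoint tsubst (s : nat -> term) (t : term) : term :=
  match t with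
  | nvar n => s n
  | zero => zero
  | one => one
  | add t u => add (tsubst s t) (tsubst s u)
  | mul t u => mul (tsubst s t) (tsubst s u)
  end.

Definition tshift : term -> term := tsubst (fun n => nvar (S n)).
Definition tup (s : nat -> term) : nat -> term := scons (nvar 0) (fun n => tshift (s n)).
Definition sup (r : nat -> nat) : nat -> nat := scons 0 (fun n => S (r n)).

(* Set variables are the only set terms, hence are substituted by set variables. *)
Fixpoint subst (s : nat -> term) (r : nat -> nat) (A : form) : form :=
  match A with
  | Eq t u => Eq (tsubst s t) (tsubst s u)
  | Lt t u => Lt (tsubst s t) (tsubst s u)
  | In t X => In (tsubst s t) (r X)
  | Bot => Bot
  | Imp A B => Imp (subst s r A) (subst s r B)
  | All1 A => All1 (subst (tup s) r A)
  | All2 A => All2 (subst s (sup r) A)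
  end.

Definition subst1 (s : nat -> term) (A : form) : form := subst s (fun X => X) A.
Definition subst2 (r : nat -> nat) (A : form) : form := subst nvar r A.
Definition inst1 (A : form) (t : term) : form := subst1 (scons t nvar) A.
Definition inst2 (A : form) (X : nat) : form := subst2 (scons X (fun Y => Y)) A.
Definition shift1 (A : form) : form := subst1 (fun n => nvar (S n)) A.
Definition shift2 (A : form) : form := subst2 S A.

Inductive prv (T : form -> Prop) : form -> Prop :=
| p_ax A : T A -> prv T A
| p_K A B : prv T (A --> B --> A)
| p_S A B C : prv T ((A --> B --> C) --> (A --> B) --> A --> C)
| p_DN A : prv T (~~ ~~ A --> A)
| p_inst1 A t : prv T (All1 A --> inst1 A t)
| p_inst2 A X : prv T (All2 A --> inst2 A X)
| p_dist1 A B : prv T (All1 (A --> B) --> All1 A --> All1 B)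
| p_dist2 A B : prv T (All2 (A --> B) --> All2 A --> All2 B)
| p_vac1 A : prv T (A --> All1 (shift1 A))
| p_vac2 A : prv T (A --> All2 (shift2 A))
| p_refl t : prv T (t == t)
| p_leibniz A t u : prv T (t == u --> inst1 A t --> inst1 A u)
| p_mp A B : prv T (A --> B) -> prv T A -> prv T B
| p_gen1 A : prv T A -> prv T (All1 A)
| p_gen2 A : prv T A -> prv T (All2 A).

Fixpoint tbounded (k : nat) (t : term) : Prop :=
  match t with
  | nvar n => n < k
  | zero | one => True
  | add t u | mul t u => tbounded k t /\ tbounded k u
  end.

(* The free number variables of [A] are among the first [k]. *)
Fixpoint bounded1 (k : nat) (A : form) : Prop :=
  match A with
  | Eq t u | Lt t u => tbounded k t /\ tbounded k u
  | In t _ => tbounded k t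
  | Bot => True
  | Imp A B => bounded1 k A /\ bounded1 k B
  | All1 A => bounded1 (S k) A
  | All2 A => bounded1 k A
  end.

(* The free set variables of [A] are among the first [k]. *)
Fixpoint bounded2 (k : nat) (A : form) : Prop :=
  match A with
  | Eq _ _ | Lt _ _ | Bot => True
  | In _ X => X < k
  | Imp A B => bounded2 k A /\ bounded2 k B
  | All1 A => bounded2 k A
  | All2 A => bounded2 (S k) A
  end.

Definition sentence (A : form) : Prop := bounded1 0 A /\ bounded2 0 A.

Fixpoint arithmetical (A : form) : Prop :=
  match A with
  | Eq _ _ | Lt _ _ | In _ _ | Bot => True
  | Imp A B => arithmetical A /\ arithmetical B
  | All1 A => arithmetical A
  | All2 _ => False
  end.

Inductive Pi11 : form -> Prop :=
| Pi11_intro A : arithmetical A -> Pi11 (All2 A).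

Inductive Sigma12 : form -> Prop :=
| Sigma12_intro A : arithmetical A -> Sigma12 (Ex2 (All2 A)).

Inductive basic : form -> Prop :=
| b_succ_ne : basic (~~ (#0 + one == zero))
| b_succ_inj : basic (#0 + one == #1 + one --> #0 == #1)
| b_add0 : basic (#0 + zero == #0)
| b_addS : basic (#0 + (#1 + one) == (#0 + #1) + one)
| b_mul0 : basic (#0 * zero == zero)
| b_mulS : basic (#0 * (#1 + one) == #0 * #1 + #0)
| b_lt0 : basic (~~ (#0 << zero))
| b_ltS : basic (#0 << #1 + one <--> #0 << #1 ||| #0 == #1).

Definition induction_axiom : form :=
  All2 (zero \in 0 &&& All1 (#0 \in 0 --> #0 + one \in 0) --> All1 (#0 \in 0)).

(* [exists Y forall x (x \in Y <-> A(x))]: in [A], number variable 0 is [x] and all other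
   variables are parameters; [shift2] keeps [Y] out of [A]. *)
Definition comprehension (A : form) : form :=
  Ex2 (All1 (#0 \in 0 <--> shift2 A)).

Inductive Pi11_CA0 : form -> Prop :=
| CA_basic A : basic A -> Pi11_CA0 A
| CA_ind : Pi11_CA0 induction_axiom
| CA_Pi11 A : Pi11 A -> Pi11_CA0 (comprehension A).

Inductive Sigma12m_CA_Pi11_CA0 : form -> Prop :=
| CAm_base A : Pi11_CA0 A -> Sigma12m_CA_Pi11_CA0 A
| CAm_Sigma12 A : Sigma12 A -> bounded2 0 A -> Sigma12m_CA_Pi11_CA0 (comprehension A).

End SOA.

Module ST.

Inductive term : Type :=
| var (n : nat)
| M.

Inductive form : Type :=
| Eq (t u : term)
| Mem (t u : term)
| Ad (t : term)
| Bot
| Imp (A B : form)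
| All (A : form).

Definition Neg (A : form) : form := Imp A Bot.
Definition And (A B : form) : form := Neg (Imp A (Neg B)).
Definition Or (A B : form) : form := Imp (Neg A) B.
Definition Iff (A B : form) : form := And (Imp A B) (Imp B A).
Definition Ex (A : form) : form := Neg (All (Neg A)).

Notation "# n" := (var n) : st_scope.
Notation "t == u" := (Eq t u) : st_scope.
Notation "t \in u" := (Mem t u) : st_scope.
Notation "~~ A" := (Neg A) : st_scope.
Notation "A &&& B" := (And A B) : st_scope.
Notation "A ||| B" := (Or A B) : st_scope.
Notation "A --> B" := (Imp A B) : st_scope.
Notation "A <--> B" := (Iff A B) : st_scope.
Bind Scope st_scope with term.
Bind Scope st_scope with form.
Local Open Scope st_scope.

Definition tsubst (s : nat -> term) (t : term) : term :=
  match t with var n => s n | M => M end.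

Definition lift (k : nat) : term -> term := tsubst (fun n => var (k + n)).
Definition up (s : nat -> term) : nat -> term := scons (var 0) (fun n => lift 1 (s n)).

Fixpoint subst (s : nat -> term) (A : form) : form :=
  match A with
  | Eq t u => Eq (tsubst s t) (tsubst s u)
  | Mem t u => Mem (tsubst s t) (tsubst s u)
  | Ad t => Ad (tsubst s t)
  | Bot => Bot
  | Imp A B => Imp (subst s A) (subst s B)
  | All A => All (subst (up s) A)
  end.

Definition rename (r : nat -> nat) (A : form) : form := subst (fun n => var (r n)) A.
Definition inst (A : form) (t : term) : form := subst (scons t var) A.

Inductive prv (T : form -> Prop) : form -> Prop :=
| p_ax A : T A -> prv T A
| p_K A B : prv T (A --> B --> A)
| p_S A B C : prv T ((A --> B --> C) --> (A --> B) --> A --> C)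
| p_DN A : prv T (~~ ~~ A --> A)
| p_inst A t : prv T (All A --> inst A t)
| p_dist A B : prv T (All (A --> B) --> All A --> All B)
| p_vac A : prv T (A --> All (rename S A))
| p_refl t : prv T (t == t)
| p_leibniz A t u : prv T (t == u --> inst A t --> inst A u)
| p_mp A B : prv T (A --> B) -> prv T A -> prv T B
| p_gen A : prv T A -> prv T (All A).

Definition tbounded (k : nat) (t : term) : Prop :=
  match t with var n => n < k | M => True end.

(* The free variables of [A] are among the first [k]. *)
Fixpoint bounded (k : nat) (A : form) : Prop :=
  match A with
  | Eq t u | Mem t u => tbounded k t /\ tbounded k u
  | Ad t => tbounded k t
  | Bot => True
  | Imp A B => bounded k A /\ bounded k B
  | All A => bounded (S k) A
  end.

(* [A] belongs to the language {\in, Ad} without the constant [M]. *)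
Fixpoint Mfree (A : form) : Prop :=
  match A with
  | Eq t u | Mem t u => t <> M /\ u <> M
  | Ad t => t <> M
  | Bot => True
  | Imp A B => Mfree A /\ Mfree B
  | All A => Mfree A
  end.

(* Bounded quantifiers: the bounding term lives outside the binder. *)
Definition AllIn (t : term) (A : form) : form := All (#0 \in lift 1 t --> A).
Definition ExIn (t : term) (A : form) : form := Ex (#0 \in lift 1 t &&& A).

Inductive Delta0 : form -> Prop :=
| D0_Eq t u : Delta0 (t == u)
| D0_Mem t u : Delta0 (t \in u)
| D0_Ad t : Delta0 (Ad t)
| D0_Bot : Delta0 Bot
| D0_Imp A B : Delta0 A -> Delta0 B -> Delta0 (A --> B)
| D0_AllIn t A : Delta0 A -> Delta0 (AllIn t A).

Inductive Sigma1 : form -> Prop :=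
| Sigma1_intro A : Delta0 A -> Sigma1 (Ex A).

(* The relativization [A^t]. *)
Fixpoint rel (t : term) (A : form) : form :=
  match A with
  | Imp A B => Imp (rel t A) (rel t B)
  | All A => AllIn t (rel (lift 1 t) A)
  | _ => A
  end.

(* The variables [#0, ..., #(n-1)] are elements of [t]. *)
Fixpoint params_in (n : nat) (t : term) : form :=
  match n with
  | 0 => Bot --> Bot
  | S m => params_in m t &&& #m \in t
  end.

Definition Sub (t u : term) : form := AllIn t (#0 \in lift 1 u).
Definition Empty (t : term) : form := AllIn t Bot.
Definition Tran (t : term) : form := AllIn t (Sub #0 (lift 1 t)).

(* [s] is the ordinal successor of [t]: [s = t \cup {t}]. *)
Definition IsSucc (s t : term) : form :=
  Sub t s &&& (t \in s &&& AllIn s (#0 \in lift 1 t ||| #0 == lift 1 t)).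

Definition ZeroOrSucc (t : term) : form := Empty t ||| ExIn t (IsSucc (lift 1 t) #0).

(* [t \in omega]: [t] is an ordinal which is, together with each of its elements, zero or
   a successor.  [Tran t &&& AllIn t (Tran #0)] says "ordinal" thanks to Foundation. *)
Definition InOmega (t : term) : form :=
  (Tran t &&& AllIn t (Tran #0)) &&& (ZeroOrSucc t &&& AllIn t (ZeroOrSucc #0)).

Definition SubOmega (t : term) : form := AllIn t (InOmega #0).

(* Foundation for [A(x, params)], with [x = #0]:
   [exists x A(x) -> exists x (A(x) /\ forall y \in x ~ A(y))].
   The renaming passes from the context [x, params] to [y, x, params]. *)
Definition foundation (A : form) : form :=
  Ex A --> Ex (A &&& AllIn #0 (~~ rename (scons 0 (fun n => S (S n))) A)).

(* [forall a exists b forall x (x \in b <-> x \in a /\ A(x, a, params))], with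
   [x = #0] and [a = #1] in [A]; the renaming keeps [b] out of [A]. *)
Definition separation (A : form) : form :=
  All (Ex (All (#0 \in #1 <--> #0 \in #2 &&& rename (scons 0 (fun n => S (S n))) A))).

(* [forall a (forall x \in a exists y A -> exists b forall x \in a exists y \in b A)] for
   [A(y, x, a, params)], with [y = #0], [x = #1] and [a = #2] in [A]; the renaming keeps
   [b] out of [A]. *)
Definition collection (A : form) : form :=
  All (AllIn #0 (Ex A) -->
       Ex (AllIn #1 (ExIn #1
             (rename (scons 0 (scons 1 (fun n => S (S (S n))))) A)))).

Definition extensionality : form := All (#0 \in #1 <--> #0 \in #2) --> #0 == #1.
Definition pairing : form := Ex (#1 \in #0 &&& #2 \in #0).
Definition union : form := Ex (AllIn #1 (AllIn #0 (#0 \in #2))).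
Definition infinity : form :=
  Ex (ExIn #0 (Empty #0) &&& AllIn #0 (ExIn #1 (IsSucc #0 #1))).

(* The schemata are those of the language {\in, Ad}: Jaeger's theories are formulated
   in it. *)
Inductive KPomega : form -> Prop :=
| KP_ext : KPomega extensionality
| KP_pair : KPomega pairing
| KP_union : KPomega union
| KP_inf : KPomega infinity
| KP_found A : Mfree A -> KPomega (foundation A)
| KP_sep A : Mfree A -> Delta0 A -> KPomega (separation A)
| KP_coll A : Mfree A -> Delta0 A -> KPomega (collection A).

(* [Ad(d)] says that [d] is transitive and a model of KPomega.  In [KPl_Ad] the free
   variables of [A] are [#0, ..., #(n-1)], and [d] is the fresh variable [#n]. *)
Inductive KPlr : form -> Prop :=
| KPl_ext : KPlr extensionality
| KPl_pair : KPlr pairing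
| KPl_union : KPlr union
| KPl_inf : KPlr infinity
| KPl_found A : Mfree A -> Delta0 A -> KPlr (foundation A)
| KPl_sep A : Mfree A -> Delta0 A -> KPlr (separation A)
| KPl_Ad_tran : KPlr (Ad #0 --> Tran #0)
| KPl_Ad A n : KPomega A -> bounded n A ->
    KPlr (Ad #n &&& params_in n #n --> rel #n A)
| KPl_Lim : KPlr (All (Ex (#1 \in #0 &&& Ad #0))).

(* In the stability schema [A] must not mention the constant [M]: with [M] allowed the
   theory would be inconsistent, because of [Ex (#0 == M)]. *)
Inductive KPlr_M : form -> Prop :=
| KPM_base A : KPlr A -> KPlr_M A
| KPM_nonempty : KPlr_M (~~ Empty M)
| KPM_tran : KPlr_M (AllIn M (AllIn #0 (#0 \in M)))
| KPM_stable A n : Mfree A -> Sigma1 A -> bounded n A ->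
    KPlr_M (A &&& params_in n M --> rel M A).

(* [p] is the Kuratowski pair [{{a}, {a, b}}]. *)
Definition IsUPair (p a b : term) : form :=
  a \in p &&& (b \in p &&& AllIn p (#0 == lift 1 a ||| #0 == lift 1 b)).
Definition IsPair (p a b : term) : form :=
  ExIn p (IsUPair #0 (lift 1 a) (lift 1 a)) &&&
  (ExIn p (IsUPair #0 (lift 1 a) (lift 1 b)) &&&
   AllIn p (IsUPair #0 (lift 1 a) (lift 1 a) ||| IsUPair #0 (lift 1 a) (lift 1 b))).

(* The pair [(x, y)] belongs to [f]. *)
Definition App (f x y : term) : form := ExIn f (IsPair #0 (lift 1 x) (lift 1 y)).

Definition Functional (f : term) : form :=
  All (All (All (App (lift 3 f) #2 #1 &&& App (lift 3 f) #2 #0 --> #1 == #0))).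

(* Graphs of addition and multiplication on omega by recursion on the second argument:
   [c = a + b] iff some function [f] satisfies [f(0) = a], [f(i+1) = f(i) + 1] for all
   [i < b], and [f(b) = c]; similarly for [a * b] with [f(0) = 0] and
   [f(i+1) = f(i) + a].  Inside the inner quantifiers: [#0] and [#1] are the values of
   [f(i+1)] and [i+1], [#2 = f(i)], [#3 = i] and [#4 = f]. *)
Definition IsAdd (a b c : term) : form :=
  Ex (Functional #0 &&&
      (Ex (Empty #0 &&& App #1 #0 (lift 2 a)) &&&
       (AllIn (lift 1 b)
          (All (App #2 #1 #0 -->
                Ex (Ex (IsSucc #1 #3 &&& (IsSucc #0 #2 &&& App #4 #1 #0))))) &&&
        App #0 (lift 1 b) (lift 1 c)))).

Definition IsMul (a b c : term) : form :=
  Ex (Functional #0 &&&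
      (Ex (Empty #0 &&& App #1 #0 #0) &&&
       (AllIn (lift 1 b)
          (All (App #2 #1 #0 -->
                Ex (Ex (IsSucc #1 #3 &&& (IsAdd #2 (lift 5 a) #0 &&& App #4 #1 #0))))) &&&
        App #0 (lift 1 b) (lift 1 c)))).

Definition AllOmega (A : form) : form := All (InOmega #0 --> A).
Definition ExOmega (A : form) : form := Ex (InOmega #0 &&& A).

(* The value of the arithmetical term [t] is [z]; [e] maps the number variables to
   variables of set theory. *)
Fixpoint value (e : nat -> nat) (t : SOA.term) (z : term) : form :=
  match t with
  | SOA.nvar n => z == var (e n)
  | SOA.zero => Empty z
  | SOA.one => Ex (Empty #0 &&& IsSucc (lift 1 z) #0)
  | SOA.add t u =>
      ExOmega (ExOmega (value (fun n => 2 + e n) t #1 &&&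
                        (value (fun n => 2 + e n) u #0 &&& IsAdd #1 #0 (lift 2 z))))
  | SOA.mul t u =>
      ExOmega (ExOmega (value (fun n => 2 + e n) t #1 &&&
                        (value (fun n => 2 + e n) u #0 &&& IsMul #1 #0 (lift 2 z))))
  end.

(* [e] and [g] map the number and the set variables to variables of set theory. *)
Fixpoint interp (e g : nat -> nat) (A : SOA.form) : form :=
  match A with
  | SOA.Eq t u =>
      ExOmega (value (fun n => S (e n)) t #0 &&& value (fun n => S (e n)) u #0)
  | SOA.Lt t u =>
      ExOmega (ExOmega (value (fun n => 2 + e n) t #1 &&&
                        (value (fun n => 2 + e n) u #0 &&& #1 \in #0)))
  | SOA.In t X =>
      ExOmega (value (fun n => S (e n)) t #0 &&& #0 \in var (S (g X)))
  | SOA.Bot => Bot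
  | SOA.Imp A B => interp e g A --> interp e g B
  | SOA.All1 A => AllOmega (interp (scons 0 (fun n => S (e n))) (fun X => S (g X)) A)
  | SOA.All2 A =>
      All (SubOmega #0 --> interp (fun n => S (e n)) (scons 0 (fun X => S (g X))) A)
  end.

(* [A^set], with free number and set variables sent to distinct variables of set theory;
   for a sentence [A] this choice is immaterial. *)
Definition to_set (A : SOA.form) : form := interp (fun n => 2 * n) (fun X => 2 * X + 1) A.

End ST.

(* Main.v *)
(** By completeness of the Hilbert calculus it is enough to show that [A^set] holds in every
    model of the set theory, i.e. that omega and its subsets in that model satisfy the
    second order axioms.

    A formula [exists X A(x, X)] with arithmetical [A] says that a certain tree of finite
    sequences of natural numbers has an infinite path: such a path lists the truth values
    of all instances of the subformulas of [A], with a counterexample for each false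
    universal instance.  If [d] is admissible and contains the parameters, this tree has no
    path iff some ranking of it belongs to [d]: by Delta_0 collection in [d], a node whose
    children are all ranked in [d] is itself ranked in [d], so that an unranked root starts
    a leftmost path through unranked nodes.  Hence [{x | forall X A(x, X)}] is given by
    Delta_0 separation with parameter [d].

    It follows that [exists Y forall X A(x, Y, X)] is equivalent to the Sigma_1 statement
    that some admissible set contains a [Y] together with a ranking.  Without set
    parameters all parameters of this statement lie in [M], so by stability the admissible
    set may be sought in [M], and Delta_0 separation with parameter [M] applies. *)

(* Weak points of the theory shape the proof. Foundation is restricted to Delta_0 formulas, so every
   induction, even on omega, has to show that its property is Delta_0 in set parameters; [D0] and
   the tactic [d0] do this bookkeeping on Rocq predicates instead of formulas. The constant [M] may
   not occur in the schemata and enters as the value of a variable, like any other parameter. The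
   universe has no collection, so recursion on omega is carried out with bounds from an admissible
   set supplied by [KPl_Lim]. The model has no choice either: uniqueness, least numbers and
   multivalued rankings take its place.

   Omega of the model may be nonstandard, while formulas are standard. Hence subformulas are indexed
   by standard numbers, with finitely many cases at each step, but assignments are coded by numbers
   of the model.

   Stability only reaches parameters in [M]. Therefore omega and the graphs of addition,
   multiplication and pairing are first placed in [M], by stability itself; and a set parameter
   outside [M] would stop the argument for Sigma^1_2 formulas. *)
From Stdlib Require Import Arith Lia List Cantor Classical ClassicalEpsilon
  FunctionalExtensionality PropExtensionality ProofIrrelevance.
Require Import Defs.

(** * Completeness of the Hilbert calculus for set theory *)

Notation "x .: s" := (scons x s) (at level 55, right associativity).

Lemma scons_comp {X Y : Type} (f : X -> Y) (x : X) (s : nat -> X) :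
  (fun n => f ((x .: s) n)) = f x .: (fun n => f (s n)).
Proof. apply functional_extensionality; intros [|n]; reflexivity. Qed.

Lemma scons_eta {X : Type} (s : nat -> X) : s 0 .: (fun n => s (S n)) = s.
Proof. apply functional_extensionality; intros [|n]; reflexivity. Qed.

Section SetSyntax.
Import ST.
Local Open Scope st_scope.

Lemma tsubst_comp (s s' : nat -> term) (t : term) :
  tsubst s' (tsubst s t) = tsubst (fun n => tsubst s' (s n)) t.
Proof. destruct t; reflexivity. Qed.

Lemma up_comp (s s' : nat -> term) :
  (fun n => tsubst (up s') (up s n)) = up (fun n => tsubst s' (s n)).
Proof.
  apply functional_extensionality; intros [|n]; simpl; [reflexivity|].
  unfold lift; destruct (s n); reflexivity.
Qed.

Lemma subst_comp (A : form) : forall s s',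
  subst s' (subst s A) = subst (fun n => tsubst s' (s n)) A.
Proof.
  induction A; intros s s'; simpl; rewrite ?tsubst_comp; try reflexivity.
  - rewrite IHA1, IHA2; reflexivity.
  - rewrite IHA, up_comp; reflexivity.
Qed.

Lemma up_var : up var = var.
Proof. apply functional_extensionality; intros [|n]; reflexivity. Qed.

Lemma tsubst_var (t : term) : tsubst var t = t.
Proof. destruct t; reflexivity. Qed.

Lemma subst_var (A : form) : subst var A = A.
Proof.
  induction A; simpl; rewrite ?tsubst_var, ?up_var; congruence.
Qed.

Lemma tsubst_ext_bounded (k : nat) (t : term) (s s' : nat -> term) :
  tbounded k t -> (forall n, n < k -> s n = s' n) -> tsubst s t = tsubst s' t.
Proof. destruct t; simpl; auto. Qed.

Lemma subst_ext_bounded (A : form) : forall k s s',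
  bounded k A -> (forall n, n < k -> s n = s' n) -> subst s A = subst s' A.
Proof.
  induction A; intros k s s' Hb Hs; simpl in *;
    try (f_equal; intuition eauto using tsubst_ext_bounded; fail).
  f_equal. apply (IHA (S k)); auto.
  intros [|n] Hn; simpl; [reflexivity|]. rewrite Hs by lia; reflexivity.
Qed.

Lemma tbounded_mono (k l : nat) (t : term) : k <= l -> tbounded k t -> tbounded l t.
Proof. destruct t; simpl; lia. Qed.

Lemma bounded_mono (A : form) : forall k l, k <= l -> bounded k A -> bounded l A.
Proof.
  induction A; simpl; intros k l Hkl Hb; intuition eauto using tbounded_mono.
  apply (IHA (S k)); [lia|assumption].
Qed.

Lemma tbounded_ex (t : term) : exists k, tbounded k t.
Proof. destruct t as [n|]; [exists (S n); simpl; lia | exists 0; exact I]. Qed.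

Lemma bounded_ex (A : form) : exists k, bounded k A.
Proof.
  induction A as [t u|t u|t| |A IHA B IHB|A IHA]; simpl.
  1,2: destruct (tbounded_ex t) as [k Hk], (tbounded_ex u) as [l Hl];
    exists (k + l); split; eapply tbounded_mono; try eassumption; lia.
  - apply tbounded_ex.
  - exists 0; exact I.
  - destruct IHA as [k Hk], IHB as [l Hl]; exists (k + l);
      split; eapply bounded_mono; try eassumption; lia.
  - destruct IHA as [k Hk]; exists k; eapply bounded_mono; try eassumption; lia.
Qed.

Lemma inst_up (s : nat -> term) (B : form) (t : term) :
  inst (subst (up s) B) t = subst (t .: s) B.
Proof.
  unfold inst; rewrite subst_comp; f_equal; apply functional_extensionality.
  intros [|n]; simpl; [reflexivity|]. destruct (s n); reflexivity.
Qed.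

Lemma tsubst_scons_lift (t u : term) (s : nat -> term) :
  tsubst (t .: s) (lift 1 u) = tsubst s u.
Proof. destruct u; reflexivity. Qed.

(** The calculus only generalizes and instantiates variable 0. A substitution that sends variable
    [k + n] to [n] is a composition of [k] such steps. *)
Lemma prv_subst_cofinite (T : form -> Prop) (k : nat) : forall A s,
  (forall n, s (k + n) = var n) -> prv T A -> prv T (subst s A).
Proof.
  induction k as [|k IH]; intros A s Hs HA.
  - replace s with var by (symmetry; apply functional_extensionality; exact Hs).
    rewrite subst_var; exact HA.
  (* [lift k] moves the variables of [s 0] out of reach of the remaining [k] instantiations, which
     bring them back down. *)
  - replace (subst s A)
      with (subst (fun n => s (S n)) (inst A (lift k (s 0)))).
    + apply IH; [intros n; apply (Hs n)|].
      apply (p_mp _ (All A)); [apply p_inst | apply p_gen; exact HA].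
    + unfold inst; rewrite subst_comp; f_equal; apply functional_extensionality.
      intros [|n]; simpl; [|reflexivity].
      destruct (s 0) as [m|]; simpl; [apply (Hs m)|reflexivity].
Qed.

(** Only the finitely many free variables matter, so on [A] any substitution agrees with one of the
    shape treated above. *)
Lemma prv_subst (T : form -> Prop) (A : form) (s : nat -> term) :
  prv T A -> prv T (subst s A).
Proof.
  intros HA. destruct (bounded_ex A) as [k Hk].
  set (s' := fun n => if n <? k then s n else var (n - k)).
  replace (subst s A) with (subst s' A).
  - apply (prv_subst_cofinite T k); [|exact HA]. intros n; unfold s'.
    replace (k + n <? k) with false by (symmetry; apply Nat.ltb_ge; lia).
    f_equal; lia.
  - apply (subst_ext_bounded A k); [exact Hk|]. intros n Hn; unfold s'.
    replace (n <? k) with true by (symmetry; apply Nat.ltb_lt; lia). reflexivity.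
Qed.

Definition term_code (t : term) : nat := match t with var n => S n | M => 0 end.

Fixpoint form_code (A : form) : nat :=
  match A with
  | Eq t u => to_nat (0, to_nat (term_code t, term_code u))
  | Mem t u => to_nat (1, to_nat (term_code t, term_code u))
  | Ad t => to_nat (2, term_code t)
  | Bot => to_nat (3, 0)
  | Imp A B => to_nat (4, to_nat (form_code A, form_code B))
  | All A => to_nat (5, form_code A)
  end.

Lemma term_code_inj (t u : term) : term_code t = term_code u -> t = u.
Proof. destruct t, u; simpl; congruence. Qed.

Lemma to_nat_pair_inj (a b c d : nat) :
  to_nat (a, b) = to_nat (c, d) -> a = c /\ b = d.
Proof. intros H; apply Cantor.to_nat_inj in H; injection H; auto. Qed.

Lemma form_code_inj (A : form) : forall B, form_code A = form_code B -> A = B.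
Proof.
  induction A; intros [] H; cbn [form_code] in H;
    apply to_nat_pair_inj in H; destruct H as [Htag H]; try discriminate Htag;
    try (apply to_nat_pair_inj in H; destruct H as [H H']);
    f_equal; auto using term_code_inj.
Qed.

(** Countability of the language, for a Henkin construction in stages. Numbers that code no formula
    are sent anywhere. *)
Lemma form_enum : exists f : nat -> form, forall A, exists n, f n = A.
Proof.
  exists (fun n => epsilon (inhabits Bot) (fun A => form_code A = n)).
  intros A; exists (form_code A). apply form_code_inj.
  apply (epsilon_spec (inhabits Bot) (fun B => form_code B = form_code A)).
  exists A; reflexivity.
Qed.

End SetSyntax.

(** There is no relation for [==]: it is read as equality of Rocq, so the term model has to be a
    quotient. *)
Record structure : Type := Structure {
  dom : Type;
  mem : dom -> dom -> Prop;
  adm : dom -> Prop;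
  stable : dom }.

Section Semantics.
Import ST.

Definition teval (S : structure) (rho : nat -> dom S) (t : term) : dom S :=
  match t with var n => rho n | M => stable S end.

Fixpoint sat (S : structure) (rho : nat -> dom S) (A : form) : Prop :=
  match A with
  | Eq t u => teval S rho t = teval S rho u
  | Mem t u => mem S (teval S rho t) (teval S rho u)
  | Ad t => adm S (teval S rho t)
  | Bot => False
  | Imp A B => sat S rho A -> sat S rho B
  | All A => forall x, sat S (x .: rho) A
  end.

Definition model (S : structure) (T : form -> Prop) : Prop :=
  forall A, T A -> forall rho, sat S rho A.

End Semantics.

(** * Henkin construction *)

Section Completeness.
Import ST.
Local Open Scope st_scope.
Context (T : form -> Prop).

(** Generalization applies to theorems of [T] only, never to the hypotheses [G], so the deduction
    theorem carries no condition on variables. *)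
Inductive ent (G : form -> Prop) : form -> Prop :=
| ent_thm A : prv T A -> ent G A
| ent_hyp A : G A -> ent G A
| ent_mp A B : ent G (A --> B) -> ent G A -> ent G B.

Lemma ent_mono (G G' : form -> Prop) (A : form) :
  (forall B, G B -> G' B) -> ent G A -> ent G' A.
Proof.
  intros HG; induction 1.
  - apply ent_thm; assumption.
  - apply ent_hyp; auto.
  - eapply ent_mp; eassumption.
Qed.

Lemma ent_deduction (G G' : form -> Prop) (A C : form) :
  (forall B, G' B -> G B \/ B = A) -> ent G' C -> ent G (A --> C).
Proof.
  intros HG; induction 1 as [C HC|C HC|B C _ IH1 _ IH2].
  - eapply ent_mp; apply ent_thm; [apply p_K | exact HC].
  - destruct (HG _ HC) as [H| ->].
    + eapply ent_mp; [apply ent_thm, p_K | apply ent_hyp; exact H].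
    + apply ent_thm. eapply p_mp; [eapply p_mp; [apply p_S | apply p_K]|].
      apply (p_K _ A A).
  - eapply ent_mp; [eapply ent_mp; [apply ent_thm, p_S | exact IH1] | exact IH2].
Qed.

Lemma ent_contra (G G' : form -> Prop) (A : form) :
  (forall B, G' B -> G B \/ B = ~~ A) -> ent G' Bot -> ent G A.
Proof.
  intros HG H. eapply ent_mp; [apply ent_thm, p_DN|].
  eapply ent_deduction; eassumption.
Qed.

Lemma ent_exfalso (G : form -> Prop) (A : form) : ent G Bot -> ent G A.
Proof. intros H; apply (ent_contra G G); auto. Qed.

Fixpoint imps (L : list form) (A : form) : form :=
  match L with nil => A | B :: L => imps L (B --> A) end.

Lemma ent_imps (L : list form) : forall A,
  ent (fun B => In B L) A -> prv T (imps L A).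
Proof.
  induction L as [|C L IH]; intros A HA; simpl.
  - clear -HA; induction HA; [assumption|contradiction|eapply p_mp; eassumption].
  - apply IH. eapply ent_deduction; [|exact HA]. simpl; intuition.
Qed.

Lemma subst_imps (s : nat -> term) (L : list form) : forall A,
  subst s (imps L A) = imps (map (subst s) L) (subst s A).
Proof. induction L as [|C L IH]; intros A; simpl; [|rewrite IH]; reflexivity. Qed.

Lemma ent_all_imps (G : form -> Prop) (L : list form) : forall B,
  (forall C, In C L -> ent G C) -> ent G (All (imps (map (rename S) L) B)) ->
  ent G (All B).
Proof.
  induction L as [|C L IH]; intros B HL HB; simpl in *; [exact HB|].
  apply IH in HB; [|auto].
  eapply ent_mp; [eapply ent_mp; [apply ent_thm, p_dist | exact HB]|].
  eapply ent_mp; [apply ent_thm, p_vac | auto].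
Qed.

(* Variables serve as Henkin witnesses: finitely many formulas leave some variable unused. *)
Lemma ent_fresh (L : list form) (B : form) (k : nat) :
  (forall C, In C L -> bounded k C) -> bounded (S k) B ->
  ent (fun C => In C L) (inst B (var k)) -> ent (fun C => In C L) (All B).
Proof.
  intros HL HB H.
  (* [s] shifts all variables except the witness [k], which goes to 0: [inst B (var k)] turns into
     [B], and the hypotheses into their shifts. *)
  set (s := fun n => if n =? k then var 0 else var (S n)).
  assert (Hs : forall n, n < k -> s n = var (S n)).
  { intros n Hn; unfold s; replace (n =? k) with false; [reflexivity|].
    symmetry; apply Nat.eqb_neq; lia. }
  apply ent_imps, (prv_subst T _ s) in H. rewrite subst_imps in H.
  apply (ent_all_imps _ L); [intros C HC; apply ent_hyp; exact HC|].
  apply ent_thm, p_gen.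
  replace (map (rename S) L) with (map (subst s) L).
  2:{ apply map_ext_in; intros C HC. apply (subst_ext_bounded C k); auto. }
  replace (subst s (inst B (var k))) with B in H; [exact H|].
  unfold inst; rewrite subst_comp. rewrite <- (subst_var B) at 1.
  apply (subst_ext_bounded B (S k)); [exact HB|].
  intros [|n] Hn; simpl.
  - unfold s; rewrite Nat.eqb_refl; reflexivity.
  - rewrite Hs by lia; reflexivity.
Qed.

Definition cons_list (L : list form) : Prop := ~ ent (fun B => In B L) Bot.

Lemma bounded_list (L : list form) : exists k, forall C, In C L -> bounded k C.
Proof.
  induction L as [|A L [k Hk]]; [exists 0; intros _ []|].
  destruct (bounded_ex A) as [l Hl]; exists (k + l).
  intros C [<-|HC]; eapply bounded_mono; try apply Hl; try apply Hk; auto; lia.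
Qed.

(** The second clause is the Henkin condition: a universal formula is rejected together with a
    variable as counterexample. *)
Definition decides (A : form) (L : list form) : Prop :=
  (In A L \/ In (~~ A) L) /\
  forall B, A = All B -> In A L \/ exists n, In (~~ inst B (var n)) L.

Lemma henkin_step (L : list form) (A : form) :
  cons_list L -> exists L', cons_list L' /\ incl L L' /\ decides A L'.
Proof.
  intros HL. destruct (classic (cons_list (A :: L))) as [HA|HA].
  - exists (A :: L); unfold decides; simpl; repeat split; auto using incl_tl, incl_refl.
  - assert (HA' : ent (fun B => In B L) (~~ A)).
    { eapply ent_deduction; [|exact (NNPP _ HA)]. simpl; intuition. }
    assert (HN : cons_list ((~~ A) :: L)).
    { intros H; apply HL. eapply ent_mp; [|exact HA'].
      eapply ent_deduction; [|exact H]. simpl; intuition. }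
    destruct (classic (exists B, A = All B)) as [[B ->]|HnB].
    + destruct (classic (exists n, cons_list ((~~ inst B (var n)) :: (~~ All B) :: L)))
        as [[n Hn]|Hno].
      * exists ((~~ inst B (var n)) :: (~~ All B) :: L); unfold decides; simpl.
        repeat split; auto using incl_tl, incl_refl.
        intros B' [= <-]; eauto.
      (* If no variable could serve as counterexample, then [inst B (var k)] would follow for a
         fresh [k], and with it [All B]. *)
      * exfalso. destruct (bounded_list (B :: (~~ All B) :: L)) as [k Hk].
        apply HN. eapply ent_mp; [apply ent_hyp; left; reflexivity|].
        apply (ent_fresh _ B k).
        -- intros C HC; apply Hk; right; exact HC.
        -- eapply bounded_mono; [|apply Hk; left; reflexivity]. lia.
        -- apply NNPP; intros Hn; apply Hno; exists k; intros H; apply Hn.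
           eapply ent_contra; [|exact H]. simpl; intuition.
    + exists ((~~ A) :: L); unfold decides; simpl.
      repeat split; auto using incl_tl, incl_refl.
      intros B ->; exfalso; eauto.
Qed.

Record henkin (H : form -> Prop) : Prop := {
  hk_ent : forall A, ent H A -> H A;
  hk_bot : ~ H Bot;
  hk_neg : forall A, H A \/ H (~~ A);
  hk_all : forall B, (forall t, H (inst B t)) -> H (All B) }.

Lemma henkin_extension (A : form) :
  ~ prv T A -> exists H, henkin H /\ H (~~ A).
Proof.
  intros HA.
  assert (H0 : cons_list ((~~ A) :: nil)).
  { intros H; apply HA, (ent_imps nil). eapply ent_contra; [|exact H].
    simpl; intuition. }
  destruct form_enum as [f Hf].
  set (next (n : nat) (L : {L | cons_list L}) :=
    let (L', HL') := constructive_indefinite_description _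
      (henkin_step (proj1_sig L) (f n) (proj2_sig L)) in
    exist cons_list L' (proj1 HL')).
  set (Ls := nat_rect (fun _ => {L | cons_list L}) (exist _ _ H0) next).
  assert (Hnext : forall n, incl (proj1_sig (Ls n)) (proj1_sig (Ls (S n))) /\
                            decides (f n) (proj1_sig (Ls (S n)))).
  { intros n; change (Ls (S n)) with (next n (Ls n)); unfold next.
    destruct constructive_indefinite_description as [L' [HL' HL'']]; exact HL''. }
  assert (Hmono : forall m n, m <= n -> incl (proj1_sig (Ls m)) (proj1_sig (Ls n))).
  { induction 1; [apply incl_refl|]. eapply incl_tran; [eassumption|apply Hnext]. }
  set (H B := exists n, In B (proj1_sig (Ls n))).
  assert (Hcompact : forall B, ent H B -> exists n, ent (fun C => In C (proj1_sig (Ls n))) B).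
  { induction 1 as [B HB|B [n HB]|B C _ [m IH1] _ [n IH2]].
    - exists 0; apply ent_thm; exact HB.
    - exists n; apply ent_hyp; exact HB.
    - exists (m + n); apply (ent_mp _ B); eapply ent_mono; try eassumption;
        intros D; apply Hmono; lia. }
  assert (Hcons : ~ ent H Bot).
  { intros HB; destruct (Hcompact _ HB) as [n Hn]. exact (proj2_sig (Ls n) Hn). }
  assert (Hdec : forall B, H B \/ H (~~ B)).
  { intros B; destruct (Hf B) as [n <-].
    destruct (proj2 (Hnext n)) as [[HB|HB] _]; [left|right]; exists (S n); exact HB. }
  assert (Hent : forall B, ent H B -> H B).
  { intros B HB; destruct (Hdec B) as [HB'|HB']; [exact HB'|].
    exfalso; apply Hcons; eapply ent_mp; [apply ent_hyp; exact HB'|exact HB]. }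
  exists H; split; [split; auto|].
  - intros HB; apply Hcons, ent_hyp, HB.
  - intros B HB; destruct (Hf (All B)) as [n Hn].
    destruct (proj2 (Hnext n)) as [_ Hd].
    destruct (Hd B Hn) as [Hi|[m Hm]]; [exists (S n); rewrite <- Hn; exact Hi|].
    exfalso; apply Hcons; eapply ent_mp; apply ent_hyp; [exists (S n); exact Hm|].
    apply HB.
  - exists 0; left; reflexivity.
Qed.

Section TermModel.
Context (H : form -> Prop) (HH : henkin H).

Lemma hk_prv (A : form) : prv T A -> H A.
Proof. intros HA; apply (hk_ent _ HH), ent_thm, HA. Qed.

Lemma hk_mp (A B : form) : H (A --> B) -> H A -> H B.
Proof. intros H1 H2; apply (hk_ent _ HH). eapply ent_mp; apply ent_hyp; eassumption. Qed.

Lemma hk_leibniz (A : form) (t u : term) : H (t == u) -> H (inst A t) -> H (inst A u).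
Proof. intros Htu; apply hk_mp; eapply hk_mp; [apply hk_prv, p_leibniz|exact Htu]. Qed.

Lemma hk_sym (t u : term) : H (t == u) -> H (u == t).
Proof.
  intros Htu. pose proof (hk_leibniz (#0 == lift 1 t) t u Htu) as L.
  unfold inst in L; cbn [subst] in L; rewrite !tsubst_scons_lift, tsubst_var in L.
  apply L, hk_prv, p_refl.
Qed.

Lemma hk_trans (t u v : term) : H (t == u) -> H (u == v) -> H (t == v).
Proof.
  intros Htu Huv. pose proof (hk_leibniz (lift 1 t == #0) u v Huv) as L.
  unfold inst in L; cbn [subst] in L; rewrite !tsubst_scons_lift, tsubst_var in L.
  apply L, Htu.
Qed.

Lemma hk_mem (t t' u u' : term) : H (t == t') -> H (u == u') -> H (t \in u) -> H (t' \in u').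
Proof.
  intros Ht Hu Htu. pose proof (hk_leibniz (#0 \in lift 1 u) t t' Ht) as L.
  pose proof (hk_leibniz (lift 1 t' \in #0) u u' Hu) as L'.
  unfold inst in L, L'; cbn [subst] in L, L'.
  rewrite !tsubst_scons_lift, tsubst_var in L, L'.
  apply L', L, Htu.
Qed.

Lemma hk_ad (t u : term) : H (t == u) -> H (Ad t) -> H (Ad u).
Proof. exact (hk_leibniz (Ad #0) t u). Qed.

(** Classes are predicates, so that extensionality turns provable equality into equality of Rocq. *)
Definition term_class (t : term) : term -> Prop := fun u => H (t == u).

Definition term_dom : Type := {c : term -> Prop | exists t, c = term_class t}.

Definition cls (t : term) : term_dom := exist _ (term_class t) (ex_intro _ t eq_refl).

Definition rep (c : term_dom) : term :=
  proj1_sig (constructive_indefinite_description _ (proj2_sig c)).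

Lemma cls_eq (t u : term) : cls t = cls u <-> H (t == u).
Proof.
  split; intros Htu.
  - apply (f_equal (fun c => proj1_sig c u)) in Htu; simpl in Htu.
    unfold term_class in Htu; rewrite Htu; apply hk_prv, p_refl.
  - apply subset_eq_compat, functional_extensionality; intros v.
    apply propositional_extensionality; unfold term_class; split; intros Hv.
    + eapply hk_trans; [apply hk_sym; exact Htu|exact Hv].
    + eapply hk_trans; eassumption.
Qed.

Lemma cls_rep (c : term_dom) : cls (rep c) = c.
Proof.
  unfold rep; destruct constructive_indefinite_description as [t Ht]; simpl.
  destruct c as [c Hc]; simpl in *; apply subset_eq_compat; auto.
Qed.

Lemma rep_cls (t : term) : H (rep (cls t) == t).
Proof. apply cls_eq, cls_rep. Qed.

Definition term_structure : structure :=
  Structure term_dom (fun c d => H (rep c \in rep d)) (fun c => H (Ad (rep c))) (cls M).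

Lemma teval_cls (s : nat -> term) (t : term) :
  teval term_structure (fun n => cls (s n)) t = cls (tsubst s t).
Proof. destruct t; reflexivity. Qed.

(** The truth lemma. Restricting to environments composed with [cls] loses nothing, since [cls_rep]
    puts every environment into this form. *)
Lemma sat_term_structure (A : form) : forall s,
  sat term_structure (fun n => cls (s n)) A <-> H (subst s A).
Proof.
  induction A as [t u|t u|t| |A IHA B IHB|A IHA]; intros s; cbn [sat subst];
    rewrite ?teval_cls.
  - apply cls_eq.
  - split; apply hk_mem; auto using rep_cls, hk_sym.
  - split; apply hk_ad; auto using rep_cls, hk_sym.
  - split; [intros []|apply (hk_bot _ HH)].
  - rewrite IHA, IHB; split; [|apply hk_mp]. intros Himp.
    destruct (hk_neg _ HH (subst s A)) as [HA|HA].
    + eapply hk_mp; [apply hk_prv, p_K|auto].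
    + apply (hk_ent _ HH).
      eapply (ent_deduction _ (fun B => H B \/ B = subst s A)); [auto|].
      apply ent_exfalso; eapply ent_mp; apply ent_hyp; [left; exact HA|auto].
  - split.
    + intros HA; apply (hk_all _ HH); intros t. rewrite inst_up.
      apply IHA; rewrite scons_comp; apply HA.
    + intros HA c. rewrite <- (cls_rep c), <- (scons_comp cls).
      apply IHA; rewrite <- inst_up. eapply hk_mp; [apply hk_prv, p_inst|exact HA].
Qed.

(** Axioms may have free variables; they hold in all environments because theorems are closed under
    substitution. *)
Lemma term_structure_model : model term_structure T.
Proof.
  intros A HA rho.
  replace rho with (fun n => cls (rep (rho n)))
    by (apply functional_extensionality; intros n; apply cls_rep).
  apply sat_term_structure, hk_prv, prv_subst, p_ax, HA.
Qed.

End TermModel.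

Theorem completeness (A : form) :
  (forall S, model S T -> forall rho, sat S rho A) -> prv T A.
Proof.
  intros HA; apply NNPP; intros Hn.
  destruct (henkin_extension A Hn) as [H [HH Hneg]].
  apply (hk_bot _ HH). eapply (hk_mp _ HH); [exact Hneg|].
  rewrite <- (subst_var A). apply (sat_term_structure _ HH).
  apply HA, term_structure_model, HH.
Qed.

End Completeness.

(** * Relativization *)

Notation "x ∈ y" := (mem _ x y) (at level 70, no associativity).
Notation "'elt' d" := (fun x => x ∈ d) (at level 10).

Lemma forall_iff {X : Type} (P Q : X -> Prop) :
  (forall x, P x <-> Q x) -> (forall x, P x) <-> (forall x, Q x).
Proof. intros H; split; intros H' x; apply H, H'. Qed.

Section Relativization.
Import ST.
Local Open Scope st_scope.
Context (V : structure).

(* Satisfaction with the quantifiers relativized to [C]; the environment is not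
   required to take its values in [C]. *)
Fixpoint satr (C : dom V -> Prop) (rho : nat -> dom V) (A : form) : Prop :=
  match A with
  | Eq t u => teval V rho t = teval V rho u
  | Mem t u => teval V rho t ∈ teval V rho u
  | Ad t => adm V (teval V rho t)
  | Bot => False
  | Imp A B => satr C rho A -> satr C rho B
  | All A => forall x, C x -> satr C (x .: rho) A
  end.

Lemma satr_and C rho A B : satr C rho (A &&& B) <-> satr C rho A /\ satr C rho B.
Proof. simpl; tauto. Qed.

Lemma satr_or C rho A B : satr C rho (A ||| B) <-> satr C rho A \/ satr C rho B.
Proof. simpl; tauto. Qed.

Lemma satr_neg C rho A : satr C rho (~~ A) <-> ~ satr C rho A.
Proof. simpl; tauto. Qed.

Lemma satr_iff C rho A B : satr C rho (A <--> B) <-> (satr C rho A <-> satr C rho B).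
Proof. simpl; tauto. Qed.

Lemma satr_imp C rho A B : satr C rho (A --> B) <-> (satr C rho A -> satr C rho B).
Proof. reflexivity. Qed.

Lemma satr_all C rho A : satr C rho (All A) <-> forall x, C x -> satr C (x .: rho) A.
Proof. reflexivity. Qed.

Lemma satr_ex C rho A : satr C rho (Ex A) <-> exists x, C x /\ satr C (x .: rho) A.
Proof.
  simpl; split.
  - intros H; apply NNPP; intros Hn; apply H; intros x Hx HA; apply Hn; eauto.
  - intros [x [Hx HA]] H; exact (H x Hx HA).
Qed.

Lemma teval_lift (x : dom V) rho t : teval V (x .: rho) (lift 1 t) = teval V rho t.
Proof. destruct t; reflexivity. Qed.

Lemma satr_allin C rho t A : satr C rho (AllIn t A) <->
  forall x, C x -> x ∈ teval V rho t -> satr C (x .: rho) A.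
Proof. unfold AllIn; simpl; setoid_rewrite teval_lift; reflexivity. Qed.

Lemma satr_exin C rho t A : satr C rho (ExIn t A) <->
  exists x, C x /\ x ∈ teval V rho t /\ satr C (x .: rho) A.
Proof.
  unfold ExIn; rewrite satr_ex; setoid_rewrite satr_and; simpl.
  setoid_rewrite teval_lift; reflexivity.
Qed.

Lemma sat_satr A : forall rho, sat V rho A <-> satr (fun _ => True) rho A.
Proof.
  induction A as [t u|t u|t| |A IHA B IHB|A IHA]; intros rho; simpl;
    rewrite ?IHA, ?IHB; try tauto.
  setoid_rewrite IHA; split; auto.
Qed.

Lemma sat_rel A : forall rho t,
  sat V rho (rel t A) <-> satr (fun x => x ∈ teval V rho t) rho A.
Proof.
  induction A as [t u|t u|t| |A IHA B IHB|A IHA]; intros rho v; simpl;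
    rewrite ?IHA, ?IHB; try tauto.
  apply forall_iff; intros x; rewrite IHA, teval_lift; reflexivity.
Qed.

Lemma teval_tsubst rho s t :
  teval V rho (tsubst s t) = teval V (fun n => teval V rho (s n)) t.
Proof. destruct t; reflexivity. Qed.

Lemma teval_up (x : dom V) rho s :
  (fun n => teval V (x .: rho) (up s n)) = x .: (fun n => teval V rho (s n)).
Proof.
  apply functional_extensionality; intros [|n]; simpl; [reflexivity|apply teval_lift].
Qed.

Lemma satr_subst C A : forall rho s,
  satr C rho (subst s A) <-> satr C (fun n => teval V rho (s n)) A.
Proof.
  induction A as [t u|t u|t| |A IHA B IHB|A IHA]; intros rho s; simpl;
    rewrite ?teval_tsubst, ?IHA, ?IHB; try tauto.
  apply forall_iff; intros x; rewrite IHA, teval_up; reflexivity.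
Qed.

Lemma satr_rename C A rho r :
  satr C rho (rename r A) <-> satr C (fun n => rho (r n)) A.
Proof. apply satr_subst. Qed.

Lemma teval_ext_bounded k rho rho' t :
  tbounded k t -> (forall n, n < k -> rho n = rho' n) -> teval V rho t = teval V rho' t.
Proof. destruct t; simpl; auto. Qed.

Lemma satr_ext_bounded C A : forall k rho rho',
  bounded k A -> (forall n, n < k -> rho n = rho' n) ->
  satr C rho A <-> satr C rho' A.
Proof.
  induction A as [t u|t u|t| |A IHA B IHB|A IHA]; intros k rho rho' Hb Hr; simpl in *.
  1,2: rewrite (teval_ext_bounded k rho rho' t), (teval_ext_bounded k rho rho' u);
    tauto.
  - rewrite (teval_ext_bounded k rho rho' t); tauto.
  - tauto.
  - rewrite (IHA k rho rho'), (IHB k rho rho'); tauto.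
  - assert (Hx : forall x, satr C (x .: rho) A <-> satr C (x .: rho') A).
    { intros x; apply (IHA (S k)); [exact Hb|].
      intros [|n] Hn; simpl; [reflexivity|apply Hr; lia]. }
    setoid_rewrite Hx; reflexivity.
Qed.

Lemma teval_in (C : dom V -> Prop) rho t :
  (forall n, C (rho n)) -> t <> M -> C (teval V rho t).
Proof. destruct t; simpl; [auto|congruence]. Qed.

(** Absoluteness: by transitivity, bounded quantifiers with bounds in [C] range over elements of [C]
    anyway. [Mfree] matters because the value of [M] need not lie in [C]. *)
Lemma satr_Delta0 C A rho :
  (forall x y, C y -> x ∈ y -> C x) -> Delta0 A -> Mfree A ->
  (forall n, C (rho n)) -> satr C rho A <-> sat V rho A.
Proof.
  intros HC HA; revert rho.
  induction HA as [t u|t u|t| |A B _ IHA _ IHB|t A _ IHA]; intros rho Hf Hr;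
    try (simpl in *; tauto).
  - simpl in *; rewrite IHA, IHB; tauto.
  - assert (Ht : C (teval V rho t)).
    { apply teval_in; [exact Hr|]. destruct Hf as [[_ Hf] _].
      destruct t; simpl in *; congruence. }
    destruct Hf as [_ Hf].
    rewrite sat_satr, !satr_allin. split.
    + intros H x _ Hx; rewrite <- sat_satr.
      apply IHA; [exact Hf| |]; [intros [|n]; simpl; eauto|]. apply H; eauto.
    + intros H x Hx Hxt. apply IHA; [exact Hf| |]; [intros [|n]; simpl; eauto|].
      rewrite sat_satr; apply H; auto.
Qed.

End Relativization.

Section Renaming.
Import ST.
Local Open Scope st_scope.

Lemma Delta0_subst A s : Delta0 A -> Delta0 (subst s A).
Proof.
  intros HA; revert s; induction HA; intros s; simpl; try constructor; auto.
  replace (All _) with (AllIn (tsubst s t) (subst (up s) A)); [constructor; auto|].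
  unfold AllIn; do 3 f_equal. destruct t; [apply eq_sym|]; reflexivity.
Qed.

Lemma Mfree_rename A : forall r, Mfree A -> Mfree (rename r A).
Proof.
  assert (Hup : forall r, up (fun n => var (r n)) = fun n => var (SOA.sup r n)).
  { intros r; apply functional_extensionality; intros [|n]; reflexivity. }
  assert (Ht : forall r t, t <> M -> tsubst (fun n => var (r n)) t <> M).
  { intros r [n|]; simpl; congruence. }
  unfold rename; induction A; intros r HA; simpl in *; try tauto;
    try (split; apply Ht; tauto).
  - apply Ht; exact HA.
  - split; [apply IHA1|apply IHA2]; tauto.
  - rewrite Hup; auto.
Qed.

End Renaming.

(** * Bounded definability with parameters *)

Section Definability.
Import ST.
Local Open Scope st_scope.
Context {V : structure}.

Definition mix (rho pi : nat -> dom V) (n : nat) : dom V :=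
  if Nat.even n then rho (Nat.div2 n) else pi (Nat.div2 n).

Definition mixr (r q : nat -> nat) (n : nat) : nat :=
  if Nat.even n then r (Nat.div2 n) else q (Nat.div2 n).

Lemma even_or_odd n : (exists m, n = 2 * m) \/ (exists m, n = S (2 * m)).
Proof.
  destruct (Nat.Even_or_Odd n) as [[m H]|[m H]]; [left|right]; exists m; lia.
Qed.

Lemma mix_even rho pi n : mix rho pi (2 * n) = rho n.
Proof.
  unfold mix; rewrite Nat.even_even, Nat.div2_double; reflexivity.
Qed.

Lemma mix_odd rho pi n : mix rho pi (S (2 * n)) = pi n.
Proof.
  unfold mix. rewrite Nat.div2_succ_double, Nat.even_succ, Nat.odd_even; reflexivity.
Qed.

Lemma mixr_even r q n : mixr r q (2 * n) = r n.
Proof.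
  unfold mixr; rewrite Nat.even_even, Nat.div2_double; reflexivity.
Qed.

Lemma mixr_odd r q n : mixr r q (S (2 * n)) = q n.
Proof.
  unfold mixr. rewrite Nat.div2_succ_double, Nat.even_succ, Nat.odd_even; reflexivity.
Qed.

(* [P] is Delta_0 with parameters in [C]: the even positions of the environment hold the
   arguments of [P], the odd ones hold the parameters.
   Nothing is claimed when [C] is empty. *)
Definition D0 (C : dom V -> Prop) (P : (nat -> dom V) -> Prop) : Prop :=
  (exists c, C c) -> exists A pi, Delta0 A /\ Mfree A /\ (forall n, C (pi n)) /\
    forall rho, P rho <-> sat V (mix rho pi) A.

Context (C : dom V -> Prop).

Lemma sat_rename A rho r :
  sat V rho (rename r A) <-> sat V (fun n => rho (r n)) A.
Proof. rewrite !sat_satr; apply satr_rename. Qed.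

Lemma D0_ext P Q : (forall rho, P rho <-> Q rho) -> D0 C Q -> D0 C P.
Proof.
  intros H HQ Hc; destruct (HQ Hc) as (A & pi & HA & Hf & Hpi & HQ').
  exists A, pi; repeat split; auto; rewrite H; apply HQ'.
Qed.

(** [r] and [q] locate the arguments and the parameters of the formula for [P] within the
    environment for [Q]; the formula renamed accordingly defines [Q]. *)
Lemma D0_transfer P Q (r q : nat -> nat) :
  D0 C P ->
  (forall pi, (forall n, C (pi n)) -> exists pi', (forall n, C (pi' n)) /\
     forall rho, exists rho', (Q rho <-> P rho') /\
       (forall n, mix rho pi' (r n) = rho' n) /\ (forall n, mix rho pi' (q n) = pi n)) ->
  D0 C Q.
Proof.
  intros HP H Hc; destruct (HP Hc) as (A & pi & HA & Hf & Hpi & HP').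
  destruct (H pi Hpi) as (pi' & Hpi' & H').
  exists (rename (mixr r q) A), pi'. repeat split; auto using Mfree_rename.
  1: apply Delta0_subst; exact HA.
  all: destruct (H' rho) as (rho' & HQ & Hr & Hq); rewrite HQ, HP', sat_rename;
    replace (fun n => mix rho pi' (mixr r q n)) with (mix rho' pi); auto;
    apply functional_extensionality; intros n;
    destruct (even_or_odd n) as [[m ->]|[m ->]];
    rewrite ?mix_even, ?mix_odd, ?mixr_even, ?mixr_odd; auto.
Qed.

Lemma D0_reindex P r : D0 C P -> D0 C (fun rho => P (fun n => rho (r n))).
Proof.
  intros HP. apply (D0_transfer P _ (fun n => 2 * r n) (fun n => S (2 * n)) HP).
  intros pi Hpi; exists pi; split; [exact Hpi|]; intros rho.
  exists (fun n => rho (r n)). split; [reflexivity|].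
  split; intros n; [apply mix_even|apply mix_odd].
Qed.

(** The argument that becomes constant moves to the first parameter place, which is position 1 of
    the environment; the old parameters move up by one place. *)
Lemma D0_const_inst P c : C c -> D0 C P -> D0 C (fun rho => P (c .: rho)).
Proof.
  intros Hc HP.
  apply (D0_transfer P _ (1 .: fun n => 2 * n) (fun n => S (2 * S n)) HP).
  intros pi Hpi; exists (c .: pi); split; [intros [|n]; simpl; auto|]; intros rho.
  exists (c .: rho). split; [reflexivity|].
  split; intros n; [|exact (mix_odd rho (c .: pi) (S n))]. destruct n as [|n].
  - exact (mix_odd rho (c .: pi) 0).
  - exact (mix_even rho (c .: pi) n).
Qed.

(** However complex, a proposition of the metatheory that does not mention the arguments is true or
    false once and for all. *)
Lemma D0_const (phi : Prop) : D0 C (fun _ => phi).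
Proof.
  intros [c Hc]. destruct (classic phi).
  - exists (Bot --> Bot), (fun _ => c). simpl; repeat split; auto.
    all: repeat constructor.
  - exists Bot, (fun _ => c). simpl; repeat split; auto; try tauto. constructor.
Qed.

Lemma D0_atom (P : (nat -> dom V) -> Prop) (A : form) :
  Delta0 A -> Mfree A ->
  (forall rho pi, P rho <-> sat V (mix rho pi) A) -> D0 C P.
Proof.
  intros HA Hf HP [c Hc]; exists A, (fun _ => c). repeat split; auto; apply HP.
Qed.

(** The two parameter sequences are interleaved, and each formula is renamed so as to read its own
    half. *)
Lemma D0_imp P Q : D0 C P -> D0 C Q -> D0 C (fun rho => P rho -> Q rho).
Proof.
  intros HP HQ Hc.
  assert (H : forall R, D0 C R -> forall q : nat -> nat,
    exists A pi, Delta0 A /\ Mfree A /\ (forall n, C (pi n)) /\ forall rho pi',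
      (forall n, pi' (q n) = pi n) -> R rho <-> sat V (mix rho pi') A).
  { intros R HR q; destruct (HR Hc) as (A & pi & HA & Hf & Hpi & HR').
    exists (rename (mixr (fun n => 2 * n) (fun n => S (2 * q n))) A), pi.
    repeat split; auto using Mfree_rename.
    1: apply Delta0_subst; exact HA.
    all: rewrite HR', sat_rename;
      replace (fun n => mix rho pi' _) with (mix rho pi); auto;
      apply functional_extensionality; intros n;
      destruct (even_or_odd n) as [[m ->]|[m ->]];
      rewrite ?mixr_even, ?mixr_odd, ?mix_even, ?mix_odd; auto. }
  destruct (H P HP (fun n => 2 * n)) as (A & pA & HA & HfA & HpA & HP').
  destruct (H Q HQ (fun n => S (2 * n))) as (B & pB & HB & HfB & HpB & HQ').
  exists (A --> B), (mix pA pB). repeat split; auto.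
  - constructor; auto.
  - intros n; destruct (even_or_odd n) as [[m ->]|[m ->]];
      rewrite ?mix_even, ?mix_odd; auto.
  - rewrite (HP' rho (mix pA pB)), (HQ' rho (mix pA pB)); auto using mix_even, mix_odd.
  - rewrite (HP' rho (mix pA pB)), (HQ' rho (mix pA pB)); auto using mix_even, mix_odd.
Qed.

Lemma D0_all0 Q : D0 C Q -> D0 C (fun rho => forall x, x ∈ rho 0 -> Q (x .: rho)).
Proof.
  intros HQ Hc; destruct (HQ Hc) as (A & pi & HA & Hf & Hpi & HQ').
  (* The quantifier pushes everything up by one: in [x .: mix rho pi], argument [n] of [rho] sits at
     [S (2 * n)] and parameter [n] at [S (S (2 * n))]. *)
  set (r := mixr (0 .: fun n => S (2 * n)) (fun n => S (S (2 * n)))).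
  exists (AllIn #0 (rename r A)), pi.
  assert (Hr : forall rho x, (fun n => (x .: mix rho pi) (r n)) = mix (x .: rho) pi).
  { intros rho x; apply functional_extensionality; intros n; unfold r.
    destruct (even_or_odd n) as [[m ->]|[m ->]];
      rewrite ?mixr_even, ?mixr_odd, ?mix_even, ?mix_odd.
    - destruct m as [|m]; [reflexivity|]. exact (mix_even rho pi m).
    - exact (mix_odd rho pi m). }
  assert (Hiff : forall rho, (forall x, x ∈ rho 0 -> Q (x .: rho)) <->
                             sat V (mix rho pi) (AllIn #0 (rename r A))).
  { intros rho; rewrite sat_satr, satr_allin. apply forall_iff; intros x.
    rewrite <- sat_satr, sat_rename, Hr, HQ'.
    change (teval V (mix rho pi) #0) with (mix rho pi (2 * 0)).
    rewrite mix_even; tauto. }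
  split; [constructor; apply Delta0_subst; exact HA|].
  split; [split; [split; discriminate|apply Mfree_rename; exact Hf]|].
  split; [exact Hpi|exact Hiff].
Qed.

(* The renaming [r] makes the notion stable under weakening of the environment. *)
Definition dfun (t : (nat -> dom V) -> dom V) : Prop :=
  forall r P, D0 C P -> D0 C (fun rho => P (t (fun n => rho (r n)) .: rho)).

Lemma dfun_var k : dfun (fun rho => rho k).
Proof.
  intros r P HP. apply (D0_ext _ (fun rho => P (fun n => rho ((r k .: fun n => n) n)))).
  - intros rho. replace (fun n => rho ((r k .: fun n => n) n)) with (rho (r k) .: rho);
      [reflexivity|]. apply functional_extensionality; intros [|n]; reflexivity.
  - apply D0_reindex, HP.
Qed.

Lemma dfun_const c : C c -> dfun (fun _ => c).
Proof. intros Hc r P HP; apply D0_const_inst; assumption. Qed.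

Lemma dfun_reindex t r : dfun t -> dfun (fun rho => t (fun n => rho (r n))).
Proof. intros Ht q P HP; exact (Ht (fun n => q (r n)) P HP). Qed.

Lemma D0_subst P t : dfun t -> D0 C P -> D0 C (fun rho => P (t rho .: rho)).
Proof. intros Ht; exact (Ht (fun n => n) P). Qed.

Lemma D0_subst2 P t u : dfun t -> dfun u -> D0 C P ->
  D0 C (fun rho => P (t rho .: u rho .: rho)).
Proof.
  intros Ht Hu HP. exact (D0_subst _ u Hu (Ht S P HP)).
Qed.

Lemma D0_mem t u : dfun t -> dfun u -> D0 C (fun rho => t rho ∈ u rho).
Proof.
  intros Ht Hu. apply (D0_subst2 (fun rho => rho 0 ∈ rho 1) t u Ht Hu).
  apply (D0_atom _ (#0 \in #2)); [constructor|split; discriminate|].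
  intros rho pi; reflexivity.
Qed.

Lemma D0_eq t u : dfun t -> dfun u -> D0 C (fun rho => t rho = u rho).
Proof.
  intros Ht Hu. apply (D0_subst2 (fun rho => rho 0 = rho 1) t u Ht Hu).
  apply (D0_atom _ (#0 == #2)); [constructor|split; discriminate|].
  intros rho pi; reflexivity.
Qed.

Lemma D0_adm t : dfun t -> D0 C (fun rho => adm V (t rho)).
Proof.
  intros Ht. apply (D0_subst (fun rho => adm V (rho 0)) t Ht).
  apply (D0_atom _ (Ad #0)); [constructor|discriminate|].
  intros rho pi; reflexivity.
Qed.

Lemma D0_not P : D0 C P -> D0 C (fun rho => ~ P rho).
Proof. intros HP; apply D0_imp; [exact HP|apply D0_const]. Qed.

Lemma D0_and P Q : D0 C P -> D0 C Q -> D0 C (fun rho => P rho /\ Q rho).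
Proof.
  intros HP HQ. apply (D0_ext _ (fun rho => ~ (P rho -> ~ Q rho))).
  - intros rho; split; [tauto|]. intros H; split; apply NNPP; tauto.
  - apply D0_not, D0_imp, D0_not; assumption.
Qed.

Lemma D0_or P Q : D0 C P -> D0 C Q -> D0 C (fun rho => P rho \/ Q rho).
Proof.
  intros HP HQ. apply (D0_ext _ (fun rho => ~ P rho -> Q rho)).
  - intros rho; destruct (classic (P rho)); tauto.
  - apply D0_imp; [apply D0_not|]; assumption.
Qed.

Lemma D0_iff P Q : D0 C P -> D0 C Q -> D0 C (fun rho => P rho <-> Q rho).
Proof. intros HP HQ; apply D0_and; apply D0_imp; assumption. Qed.

Lemma D0_all (Q : dom V -> (nat -> dom V) -> Prop) t : dfun t ->
  D0 C (fun rho => Q (rho 0) (fun n => rho (S n))) ->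
  D0 C (fun rho => forall x, x ∈ t rho -> Q x rho).
Proof.
  intros Ht HQ.
  apply (D0_subst (fun rho => forall x, x ∈ rho 0 -> Q x (fun n => rho (S n))) t Ht).
  apply (D0_all0 (fun rho => Q (rho 0) (fun n => rho (S (S n))))).
  apply (D0_reindex (fun rho => Q (rho 0) (fun n => rho (S n))) (0 .: fun n => S (S n))).
  exact HQ.
Qed.

Lemma D0_ex (Q : dom V -> (nat -> dom V) -> Prop) t : dfun t ->
  D0 C (fun rho => Q (rho 0) (fun n => rho (S n))) ->
  D0 C (fun rho => exists x, x ∈ t rho /\ Q x rho).
Proof.
  intros Ht HQ. apply (D0_ext _ (fun rho => ~ forall x, x ∈ t rho -> ~ Q x rho)).
  - intros rho; split; [intros [x [Hx H]] H'; exact (H' x Hx H)|].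
    intros H; apply NNPP; intros Hn; apply H; intros x Hx HQx; apply Hn; eauto.
  - apply D0_not, D0_all; [exact Ht|]. apply D0_not, HQ.
Qed.

Lemma D0_app1 (P : dom V -> Prop) t :
  D0 C (fun rho => P (rho 0)) -> dfun t -> D0 C (fun rho => P (t rho)).
Proof. intros HP Ht; exact (D0_subst (fun rho => P (rho 0)) t Ht HP). Qed.

Lemma D0_app2 (P : dom V -> dom V -> Prop) t u :
  D0 C (fun rho => P (rho 0) (rho 1)) -> dfun t -> dfun u ->
  D0 C (fun rho => P (t rho) (u rho)).
Proof.
  intros HP Ht Hu; exact (D0_subst2 (fun rho => P (rho 0) (rho 1)) t u Ht Hu HP).
Qed.

Lemma D0_app3 (P : dom V -> dom V -> dom V -> Prop) t u v :
  D0 C (fun rho => P (rho 0) (rho 1) (rho 2)) -> dfun t -> dfun u -> dfun v ->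
  D0 C (fun rho => P (t rho) (u rho) (v rho)).
Proof.
  intros HP Ht Hu Hv. refine (D0_subst (fun rho => P (t (fun n => rho (S n)))
    (u (fun n => rho (S n))) (rho 0)) v Hv _).
  exact (D0_subst2 (fun rho => P (rho 0) (rho 1) (rho 2)) _ _
    (dfun_reindex t S Ht) (dfun_reindex u S Hu) HP).
Qed.

Lemma D0_app4 (P : dom V -> dom V -> dom V -> dom V -> Prop) t u v w :
  D0 C (fun rho => P (rho 0) (rho 1) (rho 2) (rho 3)) ->
  dfun t -> dfun u -> dfun v -> dfun w ->
  D0 C (fun rho => P (t rho) (u rho) (v rho) (w rho)).
Proof.
  intros HP Ht Hu Hv Hw. refine (D0_subst2 (fun rho => P (t (fun n => rho (S (S n))))
    (u (fun n => rho (S (S n)))) (rho 0) (rho 1)) v w Hv Hw _).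
  exact (D0_subst2 (fun rho => P (rho 0) (rho 1) (rho 2) (rho 3)) _ _
    (dfun_reindex t (fun n => S (S n)) Ht) (dfun_reindex u (fun n => S (S n)) Hu) HP).
Qed.

Lemma D0_forall_nat (Q : nat -> (nat -> dom V) -> Prop) k :
  (forall i, i < k -> D0 C (Q i)) -> D0 C (fun rho => forall i, i < k -> Q i rho).
Proof.
  induction k as [|k IH]; intros HQ.
  - apply (D0_ext _ (fun _ => True)); [|apply D0_const].
    intros rho; split; [auto|]. intros _ i Hi; lia.
  - apply (D0_ext _ (fun rho => (forall i, i < k -> Q i rho) /\ Q k rho)).
    + intros rho; split; [auto|]. intros [H1 H2] i Hi.
      destruct (Nat.eq_dec i k) as [->|Hn]; [exact H2|apply H1; lia].
    + apply D0_and; [apply IH; auto|apply HQ; auto].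
Qed.

(** A bound [b] on the values lets [t] be eliminated by a bounded existential quantifier over its
    graph, so the result stays Delta_0. *)
Lemma dfun_graph t b : dfun b -> (forall rho, t rho ∈ b rho) ->
  D0 C (fun rho => rho 0 = t (fun n => rho (S n))) -> dfun t.
Proof.
  intros Hb Htb Ht r P HP.
  apply (D0_ext _ (fun rho => exists x, x ∈ b (fun n => rho (r n)) /\
                                x = t (fun n => rho (r n)) /\ P (x .: rho))).
  - intros rho; split; [|intros (x & _ & -> & H); exact H].
    intros H; exists (t (fun n => rho (r n))); auto.
  - apply D0_ex; [apply dfun_reindex, Hb|]. apply D0_and.
    + exact (D0_reindex _ (0 .: fun n => S (r n)) Ht).
    + apply (D0_ext _ P); [|exact HP]. intros rho; rewrite scons_eta; reflexivity.
Qed.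

End Definability.

Ltac inC := solve [exact I | assumption | auto].

(** Hooks, redefined below whenever further operations have been shown definable. *)
Ltac d0_user := fail.
Ltac dfun_user := fail.

Ltac dfun_tac := first
  [ assumption
  | simple apply dfun_var
  | simple apply dfun_const; inC
  | dfun_user ].

Ltac d0 := first
  [ assumption
  | simple apply D0_const
  | simple apply D0_mem; dfun_tac
  | simple apply D0_eq; dfun_tac
  | simple apply D0_adm; dfun_tac
  | simple apply D0_not; d0
  | simple apply D0_and; d0
  | simple apply D0_or; d0
  | simple apply D0_iff; d0
  | simple apply D0_all; [dfun_tac | cbv beta; d0]
  | simple apply D0_ex; [dfun_tac | cbv beta; d0]
  | simple apply D0_imp; d0
  | match goal with
    | H : D0 _ (fun r => ?P (r 0)) |- _ =>
        simple apply (D0_app1 _ P); [exact H | dfun_tac ..]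
    | H : D0 _ (fun r => ?P (r 0) (r 1)) |- _ =>
        simple apply (D0_app2 _ P); [exact H | dfun_tac ..]
    | H : D0 _ (fun r => ?P (r 0) (r 1) (r 2)) |- _ =>
        simple apply (D0_app3 _ P); [exact H | dfun_tac ..]
    | H : D0 _ (fun r => ?P (r 0) (r 1) (r 2) (r 3)) |- _ =>
        simple apply (D0_app4 _ P); [exact H | dfun_tac ..]
    end
  | d0_user ].

(** * Universe and admissible sets *)

Section DefinableArguments.
Import ST.
Context {V : structure} (C : dom V -> Prop).

(** The shape that the schemata expect: the arguments come first, followed by parameters only.
    Argument places that do not matter are filled with some [c]. *)
Lemma D0_two (R : dom V -> dom V -> Prop) :
  (exists c, C c) -> D0 C (fun r => R (r 0) (r 1)) ->
  exists A tail, Delta0 A /\ Mfree A /\ (forall n, C (tail n)) /\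
    forall x y, R x y <-> sat V (x .: y .: tail) A.
Proof.
  intros [c Hc] HR. destruct (HR (ex_intro _ c Hc)) as (A & pi & HA & Hf & Hpi & HR').
  set (r := mixr (0 .: 1 .: fun n => S (S (2 * n))) (fun n => S (S (S (2 * n))))).
  exists (rename r A), (mix (fun _ => c) pi).
  split; [apply Delta0_subst; exact HA|]. split; [apply Mfree_rename; exact Hf|].
  split.
  - intros n; destruct (even_or_odd n) as [[m ->]|[m ->]]; rewrite ?mix_even, ?mix_odd; auto.
  - intros x y; rewrite sat_rename.
    replace (fun n => _) with (mix (x .: y .: fun _ => c) pi); [exact (HR' (x .: y .: fun _ => c))|].
    apply functional_extensionality; intros n; unfold r.
    destruct (even_or_odd n) as [[m ->]|[m ->]];
      rewrite ?mixr_even, ?mixr_odd, ?mix_even, ?mix_odd.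
    + destruct m as [|[|m]]; try reflexivity. symmetry; exact (mix_even _ pi m).
    + symmetry; exact (mix_odd _ pi m).
Qed.

Lemma D0_one (P : dom V -> Prop) :
  (exists c, C c) -> D0 C (fun r => P (r 0)) ->
  exists A tail, Delta0 A /\ Mfree A /\ (forall n, C (tail n)) /\
    forall x, P x <-> sat V (x .: tail) A.
Proof.
  intros [c Hc] HP.
  destruct (D0_two (fun x _ => P x) (ex_intro _ c Hc) HP) as (A & tail & H1 & H2 & H3 & H4).
  exists A, (c .: tail). repeat split; auto; try apply H4. intros [|n]; simpl; auto.
Qed.

End DefinableArguments.

Section Universe.
Import ST.
Context {V : structure} (HV : model V KPlr_M).
Notation all_sets := (fun _ : dom V => True).

Lemma kpl_axiom A rho : KPlr A -> satr V all_sets rho A.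
Proof. intros HA; apply sat_satr, HV, KPM_base, HA. Qed.

Lemma sat_params_in n rho t :
  (forall i, i < n -> rho i ∈ teval V rho t) -> sat V rho (params_in n t).
Proof.
  rewrite sat_satr; induction n as [|n IH]; intros H; cbn [params_in].
  - simpl; auto.
  - rewrite satr_and; split; [apply IH; auto|apply H; lia].
Qed.

Lemma adm_axiom d A rho :
  adm V d -> KPomega A -> (forall n, rho n ∈ d) -> satr V (elt d) rho A.
Proof.
  intros Hd HA Hr. destruct (bounded_ex A) as [n Hn].
  (* [KPl_Ad] wants [d] itself at position [n], the first one that is certainly not free in [A]. *)
  set (e := fun i => if i <? n then rho i else d).
  assert (He : forall i, i < n -> e i = rho i).
  { intros i Hi; unfold e; apply Nat.ltb_lt in Hi; rewrite Hi; reflexivity. }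
  assert (Hen : e n = d) by (unfold e; rewrite Nat.ltb_irrefl; reflexivity).
  apply (satr_ext_bounded V _ A n e rho); auto.
  rewrite <- Hen. apply (sat_rel V A e (var n)).
  apply (HV _ (KPM_base _ (KPl_Ad A n HA Hn)) e).
  rewrite sat_satr, satr_and; split; [simpl; rewrite Hen; exact Hd|].
  apply sat_satr, sat_params_in; intros i Hi; simpl. rewrite Hen, He; auto.
Qed.

Lemma stab_axiom A rho :
  Mfree A -> Sigma1 A -> (forall n, rho n ∈ stable V) -> sat V rho A ->
  satr V (elt (stable V)) rho A.
Proof.
  intros Hf HA Hr H. destruct (bounded_ex A) as [n Hn].
  apply (sat_rel V A rho M), (HV _ (KPM_stable A n Hf HA Hn) rho).
  rewrite sat_satr, satr_and; split; [apply sat_satr, H|].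
  apply sat_satr, sat_params_in; intros i _; apply Hr.
Qed.

Lemma ext (a b : dom V) : (forall x, x ∈ a <-> x ∈ b) -> a = b.
Proof.
  intros H. apply (kpl_axiom _ (a .: b .: fun _ => a) KPl_ext).
  intros x _; apply (satr_iff V _ (x .: a .: b .: fun _ => a)); apply H.
Qed.

Lemma foundation (P : dom V -> Prop) : D0 all_sets (fun r => P (r 0)) ->
  (exists x, P x) -> exists x, P x /\ forall y, y ∈ x -> ~ P y.
Proof.
  intros HP [x0 Hx0].
  destruct (D0_one all_sets P (ex_intro _ x0 I) HP) as (A & tail & HA & Hf & _ & HP').
  pose proof (kpl_axiom _ tail (KPl_found A Hf HA)) as H.
  unfold ST.foundation in H; cbn [satr] in H; rewrite !satr_ex in H.
  destruct H as [x [_ Hx]].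
  - exists x0; split; [exact I|]. apply sat_satr, HP', Hx0.
  - rewrite satr_and, satr_allin in Hx. destruct Hx as [Hx Hmin].
    exists x; split; [apply HP', sat_satr, Hx|].
    intros y Hy Hpy. pose proof (Hmin y I Hy) as Hm.
    rewrite satr_neg, satr_rename in Hm; apply Hm.
    replace (fun n => _) with (y .: tail)
      by (apply functional_extensionality; intros [|n]; reflexivity).
    apply sat_satr, HP', Hpy.
Qed.

(** Closure conditions shared by the universe and all admissible sets, so that set operations are
    treated once. Collection is left out because it is an axiom for admissible sets only. *)
Record kp (C : dom V -> Prop) : Prop := {
  kp_tran : forall x y, C y -> x ∈ y -> C x;
  kp_inh : exists x, C x;
  kp_pair : forall a b, C a -> C b -> exists c, C c /\ a ∈ c /\ b ∈ c;
  kp_union : forall a, C a -> exists c, C c /\ forall x y, x ∈ a -> y ∈ x -> y ∈ c;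
  kp_sep : forall P : dom V -> Prop, D0 C (fun r => P (r 0)) ->
    forall a, C a -> exists b, C b /\ forall x, x ∈ b <-> x ∈ a /\ P x }.

Lemma kp_intro (C : dom V -> Prop) :
  (forall x y, C y -> x ∈ y -> C x) -> (exists x, C x) ->
  (forall rho, (forall n, C (rho n)) -> satr V C rho pairing /\ satr V C rho union) ->
  (forall A rho, Mfree A -> Delta0 A -> (forall n, C (rho n)) -> satr V C rho (separation A)) ->
  kp C.
Proof.
  intros Htr Hin Hax Hsep; split; [exact Htr|exact Hin| | |].
  - intros a b Ha Hb.
    destruct (Hax (a .: b .: fun _ => a)) as [H _]; [intros [|[|n]]; assumption|].
    unfold pairing in H; rewrite satr_ex in H; destruct H as [c [Hc H]].
    rewrite satr_and in H; exists c; split; [exact Hc|exact H].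
  - intros a Ha. destruct (Hax (fun _ => a)) as [_ H]; [auto|].
    unfold union in H; rewrite satr_ex in H; destruct H as [c [Hc H]].
    exists c; split; [exact Hc|]. rewrite satr_allin in H. intros x y Hx Hy.
    specialize (H x (Htr _ _ Ha Hx) Hx). rewrite satr_allin in H.
    exact (H y (Htr _ _ (Htr _ _ Ha Hx) Hy) Hy).
  - intros P HP a Ha.
    destruct (D0_one C P Hin HP) as (A & tail & HA & Hf & Ht & HP').
    (* The schema allows its formula to mention [a] as [#1]; the renaming skips that place. *)
    pose proof (Hsep (rename (0 .: fun n => S (S n)) A) tail (Mfree_rename _ _ Hf)
      (Delta0_subst _ _ HA) Ht) as H.
    unfold separation in H; cbn [satr] in H.
    specialize (H a Ha). rewrite satr_ex in H. destruct H as [b [Hb H]].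
    rewrite satr_all in H. exists b; split; [exact Hb|].
    assert (H' : forall x, C x -> (x ∈ b <-> x ∈ a /\ P x)).
    { intros x Hx; specialize (H x Hx). rewrite satr_iff, satr_and, !satr_rename in H.
      replace (fun n => (x .: b .: a .: tail) ((0 .: fun n => S (S n))
        ((0 .: fun n => S (S n)) n))) with (x .: tail) in H
        by (apply functional_extensionality; intros [|n]; reflexivity).
      rewrite (satr_Delta0 V C A) in H;
        [rewrite HP'; exact H|exact Htr|exact HA|exact Hf|].
      intros [|n]; simpl; auto. }
    intros x; split; intros Hx; apply H'; eauto.
    apply (Htr x a); tauto.
Qed.

Lemma kp_universe : kp all_sets.
Proof.
  apply kp_intro; auto.
  - exists (stable V); exact I.
  - intros rho _; split; apply kpl_axiom; constructor.
  - intros A rho Hf HA _; apply kpl_axiom; constructor; assumption.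
Qed.

Lemma adm_tran d x y : adm V d -> y ∈ d -> x ∈ y -> x ∈ d.
Proof.
  intros Hd Hy Hx. pose proof (kpl_axiom _ (fun _ => d) KPl_Ad_tran) as H.
  rewrite satr_imp in H; specialize (H Hd); unfold Tran, Sub in H; rewrite satr_allin in H.
  specialize (H y I Hy); rewrite satr_allin in H. exact (H x I Hx).
Qed.

(** Most axioms relativized to [d] presuppose parameters in [d]. Infinity is closed and existential,
    hence provides a first element. *)
Lemma adm_inh d : adm V d -> exists x, x ∈ d.
Proof.
  intros Hd.
  assert (H : sat V (fun _ => d) (rel #0%st infinity)).
  { apply (HV _ (KPM_base _ (KPl_Ad infinity 0 KP_inf ltac:(cbn; intuition lia)))).
    rewrite sat_satr, satr_and; split; [exact Hd|]. simpl; auto. }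
  rewrite sat_rel in H; unfold infinity in H; rewrite satr_ex in H.
  destruct H as [x [Hx _]]; exists x; exact Hx.
Qed.

Lemma kp_adm d : adm V d -> kp (elt d).
Proof.
  intros Hd; apply kp_intro.
  - intros x y; apply adm_tran; exact Hd.
  - apply adm_inh; exact Hd.
  - intros rho Hr; split; apply adm_axiom; auto; constructor.
  - intros A rho Hf HA Hr; apply adm_axiom; auto; constructor; assumption.
Qed.

Lemma adm_collection d (R : dom V -> dom V -> Prop) a :
  adm V d -> D0 (elt d) (fun r => R (r 0) (r 1)) -> a ∈ d ->
  (forall x, x ∈ a -> exists y, y ∈ d /\ R x y) ->
  exists b, b ∈ d /\ forall x, x ∈ a -> exists y, y ∈ b /\ R x y.
Proof.
  intros Hd HR Ha Htot. pose proof (fun x y => adm_tran d x y Hd) as Htr.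
  assert (HR' : D0 (elt d) (fun r => R (r 1) (r 0)))
    by exact (D0_reindex _ _ (1 .: 0 .: fun n => n) HR).
  destruct (D0_two (elt d) (fun y x => R x y) (adm_inh d Hd) HR')
    as (A & tail & HA & Hf & Ht & HRA).
  pose proof (adm_axiom d _ tail Hd (KP_coll (rename (0 .: 1 .: fun n => S (S (S n))) A)
    (Mfree_rename _ _ Hf) (Delta0_subst _ _ HA)) Ht) as H.
  unfold collection in H; cbn [satr] in H. specialize (H a Ha).
  assert (HA' : forall x y, x ∈ d -> y ∈ d ->
    satr V (elt d) (y .: x .: tail) A <-> R x y).
  { intros x y Hx Hy. rewrite (satr_Delta0 V _ A); auto; [rewrite HRA; reflexivity|].
    intros [|[|n]]; simpl; auto. }
  rewrite satr_allin, satr_ex in H. destruct H as [b [Hb H]].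
  - intros x Hx Hxa. rewrite satr_ex. destruct (Htot x Hxa) as [y [Hy HRxy]].
    exists y; split; [exact Hy|]. rewrite satr_rename.
    replace (fun n => _) with (y .: x .: tail)
      by (apply functional_extensionality; intros [|[|n]]; reflexivity).
    apply HA'; assumption.
  - exists b; split; [exact Hb|]. intros x Hx. rewrite satr_allin in H.
    specialize (H x (Htr _ _ Ha Hx) Hx). rewrite satr_exin in H.
    destruct H as [y [Hy [Hyb H]]]. exists y; split; [exact Hyb|].
    rewrite !satr_rename in H.
    replace (fun n => _) with (y .: x .: tail) in H
      by (apply functional_extensionality; intros [|[|n]]; reflexivity).
    apply HA' in H; eauto.
Qed.

Lemma limit x : exists d, adm V d /\ x ∈ d.
Proof.
  pose proof (kpl_axiom _ (fun _ => x) KPl_Lim) as H.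
  rewrite satr_all in H; specialize (H x I); rewrite satr_ex in H.
  destruct H as [d [_ H]]; rewrite satr_and in H. exists d; simpl in H; tauto.
Qed.

Lemma stable_tran x y : y ∈ stable V -> x ∈ y -> x ∈ stable V.
Proof.
  intros Hy Hx. assert (H := HV _ KPM_tran (fun _ => x)).
  rewrite sat_satr, satr_allin in H. specialize (H y I Hy).
  rewrite satr_allin in H; exact (H x I Hx).
Qed.

Lemma stable_inh : exists x, x ∈ stable V.
Proof.
  assert (H := HV _ KPM_nonempty (fun _ => stable V)).
  rewrite sat_satr, satr_neg in H; unfold Empty in H; rewrite satr_allin in H.
  apply NNPP; intros Hn; apply H; intros x _ Hx; apply Hn; exists x; exact Hx.
Qed.

(** [KPM_stable] for [Ex A] gives a witness in [M] for the relativized matrix; absoluteness for the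
    transitive set [M] removes the relativization. *)
Lemma stability (P : dom V -> Prop) : D0 (elt (stable V)) (fun r => P (r 0)) ->
  (exists x, P x) -> exists x, x ∈ stable V /\ P x.
Proof.
  intros HP [x Hx].
  destruct (D0_one _ P stable_inh HP) as (A & tail & HA & Hf & Ht & HP').
  assert (H : satr V (elt (stable V)) tail (Ex A)).
  { apply stab_axiom; [simpl; auto|constructor; exact HA|exact Ht|].
    rewrite sat_satr, satr_ex; exists x; split; [exact I|].
    apply sat_satr, HP', Hx. }
  rewrite satr_ex in H; destruct H as [y [Hy H]]. exists y; split; [exact Hy|].
  apply HP'. apply satr_Delta0 in H; auto; [exact stable_tran|].
  intros [|n]; simpl; auto.
Qed.

End Universe.

(** * Set operations and the Delta_0 definability of their graphs *)

Section Sets.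
Context {V : structure} (HV : model V ST.KPlr_M).
Notation all_sets := (fun _ : dom V => True).

(** Descriptions in the metatheory make the set operations total functions. No choice in the model
    is involved, since extensionality leaves at most one set with given elements. *)
Definition iota (P : dom V -> Prop) : dom V := epsilon (inhabits (stable V)) P.

Lemma iota_eq (R : dom V -> Prop) b :
  (forall x, x ∈ b <-> R x) -> iota (fun c => forall x, x ∈ c <-> R x) = b.
Proof.
  intros Hb. assert (H : forall x, x ∈ iota (fun c => forall x, x ∈ c <-> R x) <-> R x).
  { unfold iota; apply epsilon_spec; exists b; exact Hb. }
  apply (ext HV); intros x; rewrite H, Hb; reflexivity.
Qed.

Definition comp (a : dom V) (P : dom V -> Prop) : dom V :=
  iota (fun b => forall x, x ∈ b <-> x ∈ a /\ P x).
Definition emp : dom V := iota (fun a => forall x, x ∈ a <-> False).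
Definition upair (a b : dom V) : dom V := iota (fun c => forall x, x ∈ c <-> x = a \/ x = b).
Definition bigcup (a : dom V) : dom V :=
  iota (fun c => forall x, x ∈ c <-> exists y, y ∈ a /\ x ∈ y).
Definition sing (a : dom V) : dom V := upair a a.
Definition cup (a b : dom V) : dom V := bigcup (upair a b).
Definition succ (a : dom V) : dom V := cup a (sing a).
Definition pr (a b : dom V) : dom V := upair (sing a) (upair a b).
Definition tri (a b c : dom V) : dom V := pr a (pr b c).

Section Closure.
Context (C : dom V -> Prop) (HC : kp C).

Lemma kp_comp_ex a P : D0 C (fun r => P (r 0)) -> C a ->
  C (comp a P) /\ forall x, x ∈ comp a P <-> x ∈ a /\ P x.
Proof.
  intros HP Ha; destruct (kp_sep _ HC P HP a Ha) as [b [Hb H]].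
  unfold comp; rewrite (iota_eq _ b H); auto.
Qed.

Lemma kp_emp_ex : C emp /\ forall x, x ∈ emp <-> False.
Proof.
  destruct (kp_inh _ HC) as [a Ha].
  destruct (kp_sep _ HC (fun _ => False)) with (a := a) as [b [Hb H]];
    [apply D0_const|exact Ha|].
  assert (Hb' : forall x, x ∈ b <-> False) by (intros x; rewrite H; tauto).
  unfold emp; rewrite (iota_eq _ b Hb'); auto.
Qed.

Lemma kp_upair_ex a b : C a -> C b ->
  C (upair a b) /\ forall x, x ∈ upair a b <-> x = a \/ x = b.
Proof.
  intros Ha Hb; destruct (kp_pair _ HC a b Ha Hb) as [c [Hc [Hac Hbc]]].
  destruct (kp_sep _ HC (fun x => x = a \/ x = b)) with (a := c) as [e [He H]];
    [d0|exact Hc|].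
  assert (He' : forall x, x ∈ e <-> x = a \/ x = b).
  { intros x; rewrite H; split; [tauto|]. intros [->| ->]; auto. }
  unfold upair; rewrite (iota_eq _ e He'); auto.
Qed.

Lemma kp_bigcup_ex a : C a ->
  C (bigcup a) /\ forall x, x ∈ bigcup a <-> exists y, y ∈ a /\ x ∈ y.
Proof.
  intros Ha; destruct (kp_union _ HC a Ha) as [c [Hc Hac]].
  destruct (kp_sep _ HC (fun x => exists y, y ∈ a /\ x ∈ y)) with (a := c) as [e [He H]];
    [d0|exact Hc|].
  assert (He' : forall x, x ∈ e <-> exists y, y ∈ a /\ x ∈ y).
  { intros x; rewrite H; split; [tauto|]. intros [y [Hy Hx]]; eauto. }
  unfold bigcup; rewrite (iota_eq _ e He'); auto.
Qed.

Lemma kp_comp a P : D0 C (fun r => P (r 0)) -> C a -> C (comp a P).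
Proof. apply kp_comp_ex. Qed.
Lemma kp_emp : C emp.
Proof. apply kp_emp_ex. Qed.
Lemma kp_upair a b : C a -> C b -> C (upair a b).
Proof. apply kp_upair_ex. Qed.
Lemma kp_bigcup a : C a -> C (bigcup a).
Proof. apply kp_bigcup_ex. Qed.
Lemma kp_sing a : C a -> C (sing a).
Proof. intros Ha; apply kp_upair; exact Ha. Qed.
Lemma kp_cup a b : C a -> C b -> C (cup a b).
Proof. intros Ha Hb; apply kp_bigcup, kp_upair; assumption. Qed.
Lemma kp_succ a : C a -> C (succ a).
Proof. intros Ha; apply kp_cup, kp_sing; exact Ha. Qed.
Lemma kp_pr a b : C a -> C b -> C (pr a b).
Proof. intros Ha Hb; apply kp_upair; [apply kp_sing|apply kp_upair]; assumption. Qed.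
Lemma kp_tri a b c : C a -> C b -> C c -> C (tri a b c).
Proof. intros Ha Hb Hc; apply kp_pr, kp_pr; assumption. Qed.

End Closure.

Lemma in_comp a P x : D0 all_sets (fun r => P (r 0)) -> x ∈ comp a P <-> x ∈ a /\ P x.
Proof. intros HP; apply (kp_comp_ex _ (kp_universe HV) a P HP I). Qed.

Lemma in_emp x : ~ x ∈ emp.
Proof. rewrite (proj2 (kp_emp_ex _ (kp_universe HV))); tauto. Qed.

Lemma in_upair a b x : x ∈ upair a b <-> x = a \/ x = b.
Proof. apply (kp_upair_ex _ (kp_universe HV) a b I I). Qed.

Lemma in_bigcup a x : x ∈ bigcup a <-> exists y, y ∈ a /\ x ∈ y.
Proof. apply (kp_bigcup_ex _ (kp_universe HV) a I). Qed.

Lemma in_sing a x : x ∈ sing a <-> x = a.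
Proof. unfold sing; rewrite in_upair; tauto. Qed.

Lemma in_cup a b x : x ∈ cup a b <-> x ∈ a \/ x ∈ b.
Proof.
  unfold cup; rewrite in_bigcup; setoid_rewrite in_upair; split.
  - intros [y [[->| ->] H]]; auto.
  - intros [H|H]; eauto.
Qed.

Lemma in_succ a x : x ∈ succ a <-> x ∈ a \/ x = a.
Proof. unfold succ; rewrite in_cup, in_sing; reflexivity. Qed.

(** The right side is Delta_0 in [t], [a] and [b]; conditions of this kind, also for [succ] and
    [emp], make the graphs of the operations definable. *)
Lemma upair_eq t a b : t = upair a b <-> (a ∈ t /\ b ∈ t) /\ forall x, x ∈ t -> x = a \/ x = b.
Proof.
  split.
  - intros ->; rewrite !in_upair; repeat split; auto. intros x; apply in_upair.
  - intros [[Ha Hb] H]; apply (ext HV); intros x; rewrite in_upair.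
    split; [auto|]. intros [->| ->]; assumption.
Qed.

Lemma succ_eq t a : t = succ a <-> (a ∈ t /\ forall x, x ∈ a -> x ∈ t) /\
  forall x, x ∈ t -> x ∈ a \/ x = a.
Proof.
  split.
  - intros ->; repeat split; intros; apply in_succ; auto.
  - intros [[Ha Hb] H]; apply (ext HV); intros x; rewrite in_succ.
    split; [auto|]. intros [Hx| ->]; auto.
Qed.

Lemma emp_eq t : t = emp <-> forall x, x ∈ t -> False.
Proof.
  split; [intros -> x; apply in_emp|]. intros H; apply (ext HV); intros x; split.
  - intros Hx; destruct (H x Hx).
  - intros Hx; destruct (in_emp x Hx).
Qed.

Lemma upair_inj a b c d : upair a b = upair c d -> (a = c /\ b = d) \/ (a = d /\ b = c).
Proof.
  intros H. assert (H' : forall x, x = a \/ x = b <-> x = c \/ x = d)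
    by (intros x; rewrite <- !in_upair, H; reflexivity).
  destruct (proj1 (H' a) (or_introl eq_refl)), (proj1 (H' b) (or_intror eq_refl)),
    (proj2 (H' c) (or_introl eq_refl)), (proj2 (H' d) (or_intror eq_refl));
    solve [left; split; congruence | right; split; congruence].
Qed.

Lemma sing_upair_inj a b c : sing a = upair b c -> a = b /\ a = c.
Proof. intros H; apply upair_inj in H; intuition congruence. Qed.

Lemma pr_inj a b c d : pr a b = pr c d -> a = c /\ b = d.
Proof.
  intros H; apply upair_inj in H; destruct H as [[H1 H2]|[H1 H2]].
  - apply sing_upair_inj in H1; destruct H1 as [-> _].
    apply upair_inj in H2; intuition congruence.
  - apply sing_upair_inj in H1; destruct H1 as [-> Hd].
    symmetry in H2; apply sing_upair_inj in H2; intuition congruence.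
Qed.

Lemma tri_inj a b c a' b' c' : tri a b c = tri a' b' c' -> a = a' /\ b = b' /\ c = c'.
Proof.
  intros H; apply pr_inj in H; destruct H as [H1 H]; apply pr_inj in H; tauto.
Qed.

Section Definable.
Context (C : dom V -> Prop).

Lemma D0_is_emp t : dfun C t -> D0 C (fun r => t r = emp).
Proof.
  intros Ht; apply (D0_ext _ _ (fun r => forall x, x ∈ t r -> False));
    [intros r; apply emp_eq|d0].
Qed.

Lemma D0_is_upair t u v : dfun C t -> dfun C u -> dfun C v ->
  D0 C (fun r => t r = upair (u r) (v r)).
Proof.
  intros Ht Hu Hv.
  apply (D0_app3 C (fun t a b => t = upair a b) t u v); auto.
  eapply D0_ext; [intros r; apply upair_eq|d0].
Qed.

Lemma D0_is_succ t u : dfun C t -> dfun C u -> D0 C (fun r => t r = succ (u r)).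
Proof.
  intros Ht Hu. apply (D0_app2 C (fun t a => t = succ a) t u); auto.
  eapply D0_ext; [intros r; apply succ_eq|d0].
Qed.

(** The quantifiers over [x] and [y] can be bounded, since both components of a Kuratowski pair are
    elements of its element [upair x y]. *)
Lemma D0_ex_pr (Q : dom V -> dom V -> (nat -> dom V) -> Prop) t : dfun C t ->
  D0 C (fun r => Q (r 1) (r 0) (fun n => r (S (S n)))) ->
  D0 C (fun r => exists x y, t r = pr x y /\ Q x y r).
Proof.
  intros Ht HQ.
  apply (D0_ext _ _ (fun r => exists s, s ∈ t r /\ exists x, x ∈ s /\ exists y, y ∈ s /\
    ((exists s', s' ∈ t r /\ (s' = upair x x /\ t r = upair s' s)) /\ s = upair x y)
    /\ Q x y r)).
  - intros r; split.
    + intros (x & y & Hp & H). exists (upair x y).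
      repeat split; [rewrite Hp; apply in_upair; auto|].
      exists x; split; [apply in_upair; auto|]. exists y; split; [apply in_upair; auto|].
      repeat split; auto. exists (sing x); repeat split; auto.
      rewrite Hp; apply in_upair; auto.
    + intros (s & _ & x & _ & y & _ & ((s' & _ & -> & Hp) & ->) & H).
      exists x, y; split; [exact Hp|exact H].
  - assert (Ht' : forall q, dfun C (fun r => t (fun n => r (q n))))
      by (intros q; apply dfun_reindex; exact Ht).
    assert (HQ' : D0 C (fun r => Q (r 1) (r 0) (fun n => r (S (S (S n)))))).
    { exact (D0_reindex C _ (0 .: 1 .: fun n => S (S (S n))) HQ). }
    apply D0_ex; [exact Ht|]. apply D0_ex; [dfun_tac|]. apply D0_ex; [dfun_tac|].
    apply D0_and; [apply D0_and|exact HQ'].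
    + apply D0_ex; [apply (Ht' (fun n => S (S (S n))))|].
      apply D0_and; apply D0_is_upair; try dfun_tac.
      apply (Ht' (fun n => S (S (S (S n))))).
    + apply D0_is_upair; dfun_tac.
Qed.

Lemma D0_all_pr (Q : dom V -> dom V -> (nat -> dom V) -> Prop) t : dfun C t ->
  D0 C (fun r => Q (r 1) (r 0) (fun n => r (S (S n)))) ->
  D0 C (fun r => forall x y, t r = pr x y -> Q x y r).
Proof.
  intros Ht HQ.
  apply (D0_ext _ _ (fun r => ~ exists x y, t r = pr x y /\ ~ Q x y r)).
  - intros r; split; [intros H (x & y & H1 & H2); apply H2; auto|].
    intros H x y Hp; apply NNPP; intros Hn; apply H; eauto.
  - apply D0_not, D0_ex_pr; [exact Ht|apply D0_not, HQ].
Qed.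

Lemma D0_is_pr t u v : dfun C t -> dfun C u -> dfun C v ->
  D0 C (fun r => t r = pr (u r) (v r)).
Proof.
  intros Ht Hu Hv. apply (D0_app3 C (fun t a b => t = pr a b) t u v); auto.
  apply (D0_ext _ _ (fun r => exists x y, r 0 = pr x y /\ (x = r 1 /\ y = r 2))).
  - intros r; split; [eauto|]. intros (x & y & H & -> & ->); exact H.
  - apply D0_ex_pr; [dfun_tac|d0].
Qed.

Lemma D0_in_pr t u v : dfun C t -> dfun C u -> dfun C v ->
  D0 C (fun r => pr (u r) (v r) ∈ t r).
Proof.
  intros Ht Hu Hv. apply (D0_app3 C (fun t a b => pr a b ∈ t) t u v); auto.
  apply (D0_ext _ _ (fun r => exists p, p ∈ r 0 /\ p = pr (r 1) (r 2))).
  - intros r; split; [eauto|]. intros (p & H & ->); exact H.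
  - apply D0_ex; [dfun_tac|]. apply D0_is_pr; dfun_tac.
Qed.

Lemma D0_ex_tri (Q : dom V -> dom V -> dom V -> (nat -> dom V) -> Prop) t : dfun C t ->
  D0 C (fun r => Q (r 2) (r 1) (r 0) (fun n => r (S (S (S n))))) ->
  D0 C (fun r => exists x y z, t r = tri x y z /\ Q x y z r).
Proof.
  intros Ht HQ.
  apply (D0_ext _ _ (fun r => exists x p, t r = pr x p /\
    exists y z, p = pr y z /\ Q x y z r)).
  - intros r; split.
    + intros (x & y & z & H & HQ'); exists x, (pr y z); eauto.
    + intros (x & p & H & y & z & -> & HQ'); exists x, y, z; auto.
  - apply D0_ex_pr; [exact Ht|]. apply D0_ex_pr; [dfun_tac|].
    exact (D0_reindex C _ (0 .: 1 .: 3 .: fun n => S (S (S (S n)))) HQ).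
Qed.

Lemma D0_all_tri (Q : dom V -> dom V -> dom V -> (nat -> dom V) -> Prop) t : dfun C t ->
  D0 C (fun r => Q (r 2) (r 1) (r 0) (fun n => r (S (S (S n))))) ->
  D0 C (fun r => forall x y z, t r = tri x y z -> Q x y z r).
Proof.
  intros Ht HQ.
  apply (D0_ext _ _ (fun r => ~ exists x y z, t r = tri x y z /\ ~ Q x y z r)).
  - intros r; split; [intros H (x & y & z & H1 & H2); apply H2; auto|].
    intros H x y z Hp; apply NNPP; intros Hn; apply H; eauto.
  - apply D0_not, D0_ex_tri; [exact Ht|apply D0_not, HQ].
Qed.

Lemma D0_is_tri t u v w : dfun C t -> dfun C u -> dfun C v -> dfun C w ->
  D0 C (fun r => t r = tri (u r) (v r) (w r)).
Proof.
  intros Ht Hu Hv Hw. apply (D0_app4 C (fun t a b c => t = tri a b c) t u v w); auto.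
  apply (D0_ext _ _ (fun r => exists x y z, r 0 = tri x y z /\
    (x = r 1 /\ (y = r 2 /\ z = r 3)))).
  - intros r; split; [intros H; exists (r 1), (r 2), (r 3); auto|].
    intros (x & y & z & H & -> & -> & ->); exact H.
  - apply D0_ex_tri; [dfun_tac|d0].
Qed.

Lemma D0_in_tri t u v w : dfun C t -> dfun C u -> dfun C v -> dfun C w ->
  D0 C (fun r => tri (u r) (v r) (w r) ∈ t r).
Proof.
  intros Ht Hu Hv Hw. apply (D0_app4 C (fun t a b c => tri a b c ∈ t) t u v w); auto.
  apply (D0_ext _ _ (fun r => exists p, p ∈ r 0 /\ p = tri (r 1) (r 2) (r 3))).
  - intros r; split; [eauto|]. intros (p & H & ->); exact H.
  - apply D0_ex; [dfun_tac|]. apply D0_is_tri; dfun_tac.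
Qed.

End Definable.

End Sets.

Ltac inC ::= cbv beta; solve [exact I | assumption | auto].

Ltac d0_user ::= first
  [ simple apply D0_is_emp; [eassumption | dfun_tac]
  | simple apply D0_is_succ; [eassumption | dfun_tac ..]
  | simple apply D0_is_tri; [eassumption | dfun_tac ..]
  | simple apply D0_in_tri; [eassumption | dfun_tac ..]
  | simple apply D0_is_upair; [eassumption | dfun_tac ..]
  | simple apply D0_is_pr; [eassumption | dfun_tac ..]
  | simple apply D0_in_pr; [eassumption | dfun_tac ..]
  | simple apply D0_ex_tri; [eassumption | dfun_tac | cbv beta; d0]
  | simple apply D0_all_tri; [eassumption | dfun_tac | cbv beta; d0]
  | simple apply D0_ex_pr; [eassumption | dfun_tac | cbv beta; d0]
  | simple apply D0_all_pr; [eassumption | dfun_tac | cbv beta; d0] ].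

(** * Natural numbers and recursion *)

Section Omega.
Context {V : structure} (HV : model V ST.KPlr_M).
Notation all_sets := (fun _ : dom V => True).

Definition trans (a : dom V) : Prop := forall x, x ∈ a -> forall y, y ∈ x -> y ∈ a.

Definition zero_or_succ (a : dom V) : Prop := a = emp \/ exists x, x ∈ a /\ a = succ x.

Definition in_omega (a : dom V) : Prop :=
  (trans a /\ forall x, x ∈ a -> trans x) /\
  (zero_or_succ a /\ forall x, x ∈ a -> zero_or_succ x).

Lemma D0_in_omega C t : dfun C t -> D0 C (fun r => in_omega (t r)).
Proof. intros Ht; apply (D0_app1 C in_omega t); [|exact Ht]. unfold in_omega, trans, zero_or_succ; d0. Qed.

Lemma mem_irrefl (a : dom V) : ~ a ∈ a.
Proof.
  intros Ha. destruct (foundation HV (fun x => x ∈ x)) as [x [Hx Hmin]];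
    [d0|exists a; exact Ha|]. exact (Hmin x Hx Hx).
Qed.

Lemma infinity_set : exists I : dom V, emp ∈ I /\ forall x, x ∈ I -> succ x ∈ I.
Proof.
  pose proof (kpl_axiom HV _ (fun _ => emp) ST.KPl_inf) as H. unfold ST.infinity in H.
  rewrite satr_ex in H. destruct H as [I [_ H]]. exists I.
  rewrite satr_and, satr_exin, satr_allin in H. destruct H as [[e [_ [HeI He]]] H].
  split.
  - unfold ST.Empty in He; rewrite satr_allin in He.
    replace emp with e; [exact HeI|]. apply (emp_eq HV); intros x Hx. apply (He x Logic.I Hx).
  - intros x Hx. specialize (H x Logic.I Hx). rewrite satr_exin in H.
    destruct H as [s [_ [Hs H]]]. unfold ST.IsSucc, ST.Sub in H.
    rewrite !satr_and, !satr_allin in H. destruct H as [H1 [H2 H3]].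
    replace (succ x) with s; [exact Hs|]. apply (succ_eq HV). repeat split.
    + exact H2.
    + intros y Hy; exact (H1 y Logic.I Hy).
    + intros y Hy; specialize (H3 y Logic.I Hy); rewrite satr_or in H3; exact H3.
Qed.

Definition om : dom V := iota (fun w => forall n, n ∈ w <-> in_omega n).

(** The set [w] given by Infinity may be too large, but it contains every [n] with [in_omega n]: by
    Foundation there would otherwise be a minimal missing [m] among [n] and its elements, and [m] is
    zero or the successor of something in [w]. *)
Lemma in_om n : n ∈ om <-> in_omega n.
Proof.
  revert n. destruct infinity_set as [w [H0 HS]].
  assert (Hw : forall n, n ∈ comp w in_omega <-> in_omega n).
  { intros n; rewrite (in_comp HV) by (apply D0_in_omega; dfun_tac).
    split; [tauto|]. intros Hn; split; [|exact Hn].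
    apply NNPP; intros Hnw.
    destruct (foundation HV (fun m => (m = n \/ m ∈ n) /\ ~ m ∈ w)) as [m [[Hm Hmw] Hmin]];
      [d0|exists n; auto|].
    destruct Hn as [[Ht Htt] [Hz Hzz]].
    assert (Hzm : zero_or_succ m) by (destruct Hm as [->|Hm]; auto).
    destruct Hzm as [->|[k [Hk ->]]]; [exact (Hmw H0)|].
    apply (Hmin k Hk). split.
    - right; destruct Hm as [<-|Hm]; [exact Hk|]. exact (Ht _ Hm _ Hk).
    - intros Hkw; exact (Hmw (HS k Hkw)). }
  unfold om; rewrite (iota_eq HV _ _ Hw); exact Hw.
Qed.

Lemma emp_om : emp ∈ om.
Proof.
  apply in_om; repeat split; try (left; reflexivity);
    intros x Hx; destruct (in_emp HV x Hx).
Qed.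

Lemma om_trans n m : n ∈ om -> m ∈ n -> m ∈ om.
Proof.
  intros Hn Hm; apply in_om in Hn; destruct Hn as [[Ht Htt] [_ Hz]]. apply in_om; repeat split.
  - apply Htt; exact Hm.
  - intros x Hx; apply Htt, (Ht m); assumption.
  - apply Hz; exact Hm.
  - intros x Hx; apply Hz, (Ht m); assumption.
Qed.

Lemma om_elem_trans n m k : n ∈ om -> m ∈ n -> k ∈ m -> k ∈ n.
Proof. intros Hn; apply in_om in Hn; destruct Hn as [[Ht _] _]. intros Hm; apply Ht, Hm. Qed.

Lemma succ_om n : n ∈ om -> succ n ∈ om.
Proof.
  intros Hn'; pose proof Hn' as Hn; apply in_om in Hn; destruct Hn as [[Ht Htt] [Hz Hzz]].
  apply in_om; repeat split.
  - intros x Hx y Hy; apply (in_succ HV) in Hx; apply (in_succ HV); left.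
    destruct Hx as [Hx| ->]; [exact (Ht x Hx y Hy)|exact Hy].
  - intros x Hx; apply (in_succ HV) in Hx; destruct Hx as [Hx| ->]; auto.
  - right; exists n; split; [apply (in_succ HV); auto|reflexivity].
  - intros x Hx; apply (in_succ HV) in Hx; destruct Hx as [Hx| ->]; auto.
Qed.

Lemma om_cases n : n ∈ om -> n = emp \/ exists m, m ∈ om /\ n = succ m.
Proof.
  intros Hn; pose proof Hn as Hn'; apply in_om in Hn'; destruct Hn' as [_ [Hz _]].
  destruct Hz as [->|[m [Hm ->]]]; [left; reflexivity|right].
  exists m; split; [exact (om_trans _ _ Hn Hm)|reflexivity].
Qed.

Lemma om_ind (P : dom V -> Prop) : D0 all_sets (fun r => P (r 0)) ->
  P emp -> (forall n, n ∈ om -> P n -> P (succ n)) -> forall n, n ∈ om -> P n.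
Proof.
  intros HP H0 HS n Hn; apply NNPP; intros HPn.
  destruct (foundation HV (fun n => n ∈ om /\ ~ P n)) as [m [[Hm HPm] Hmin]];
    [d0|exists n; auto|].
  destruct (om_cases m Hm) as [->|[k [Hk ->]]]; [exact (HPm H0)|].
  apply HPm, HS; [exact Hk|]. apply NNPP; intros HPk.
  apply (Hmin k); [apply (in_succ HV); auto|auto].
Qed.

Lemma succ_neq_emp (n : dom V) : succ n <> emp.
Proof.
  intros H; apply (in_emp HV n); rewrite <- H; apply (in_succ HV); auto.
Qed.

Lemma succ_inj (m n : dom V) : m ∈ om -> n ∈ om -> succ m = succ n -> m = n.
Proof.
  intros Hm Hn H.
  assert (H1 : m ∈ succ n) by (rewrite <- H; apply (in_succ HV); auto).
  assert (H2 : n ∈ succ m) by (rewrite H; apply (in_succ HV); auto).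
  apply (in_succ HV) in H1, H2.
  destruct H1 as [H1|H1]; [|exact H1]. destruct H2 as [H2|H2]; [|auto].
  destruct (mem_irrefl m). exact (om_elem_trans _ _ _ Hm H2 H1).
Qed.

Lemma om_least (P : dom V -> Prop) n : D0 all_sets (fun r => P (r 0)) ->
  n ∈ om -> P n -> exists m, m ∈ om /\ P m /\ forall k, k ∈ m -> ~ P k.
Proof.
  intros HP Hn HPn.
  destruct (foundation HV (fun n => n ∈ om /\ P n)) as [m [[Hm HPm] Hmin]];
    [d0|exists n; auto|].
  exists m; repeat split; auto. intros k Hk HPk; apply (Hmin k Hk); eauto using om_trans.
Qed.

Lemma succ_mem (m n : dom V) : n ∈ om -> m ∈ n -> succ m ∈ succ n.
Proof.
  intros Hn Hmn; apply (in_succ HV).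
  assert (H : (exists s, s ∈ n /\ s = succ m) \/ n = succ m).
  { revert Hmn; revert n Hn.
    apply (om_ind (fun n => m ∈ n -> (exists s, s ∈ n /\ s = succ m) \/ n = succ m)).
    - d0.
    - intros Hm; destruct (in_emp HV m Hm).
    - intros n Hn IH Hm. apply (in_succ HV) in Hm; destruct Hm as [Hm| ->]; [left|auto].
      exists (succ m); split; [|reflexivity]. apply (in_succ HV).
      destruct (IH Hm) as [[s [Hs ->]]|H]; auto. }
  destruct H as [[s [Hs ->]]|H]; auto.
Qed.

Lemma om_trichotomy m n : m ∈ om -> n ∈ om -> m ∈ n \/ m = n \/ n ∈ m.
Proof.
  intros Hm Hn; revert m Hm.
  apply (om_ind (fun n => forall m, m ∈ om -> m ∈ n \/ m = n \/ n ∈ m)); [d0| | |exact Hn].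
  - intros m Hm. right. revert m Hm.
    apply (om_ind (fun m => m = emp \/ emp ∈ m)).
    + d0.
    + left; reflexivity.
    + intros m Hm [->|H]; right; apply (in_succ HV); auto.
  - intros k Hk IH m Hm. rewrite (in_succ HV). destruct (IH m Hm) as [H|[->|H]]; auto.
    apply (succ_mem _ _ Hm) in H. apply (in_succ HV) in H; destruct H; auto.
Qed.

Lemma om_bound2 m n : m ∈ om -> n ∈ om -> exists k, k ∈ om /\ m ∈ k /\ n ∈ k.
Proof.
  intros Hm Hn. destruct (om_trichotomy m n Hm Hn) as [H|[->|H]].
  - exists (succ n); rewrite !(in_succ HV); auto using succ_om.
  - exists (succ n); rewrite !(in_succ HV); auto using succ_om.
  - exists (succ m); rewrite !(in_succ HV); auto using succ_om.
Qed.

End Omega.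

(** * Recursion on omega *)

Section Recursion.
Context {V : structure} (HV : model V ST.KPlr_M).
Notation all_sets := (fun _ : dom V => True).

(** A family of sequences in [Z], one for each parameter in [B], coded by triples. All quantifiers
    can be bounded by the sets involved, so the condition is Delta_0 and stability can be applied to
    it. *)
Definition is_fun (B Z f : dom V) : Prop :=
  (forall q, q ∈ f -> exists a n z, q = tri a n z /\ ((a ∈ B /\ n ∈ om) /\ z ∈ Z)) /\
  (forall a, a ∈ B -> forall n, n ∈ om -> exists z, z ∈ Z /\ tri a n z ∈ f) /\
  (forall a, a ∈ B -> forall n, n ∈ om -> forall z, z ∈ Z -> forall z', z' ∈ Z ->
     tri a n z ∈ f -> tri a n z' ∈ f -> z = z').

Definition satisfies_rec (I : dom V -> dom V -> Prop)
    (P : dom V -> dom V -> dom V -> dom V -> Prop) (B Z f : dom V) : Prop :=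
  (forall a, a ∈ B -> forall z, z ∈ Z -> tri a emp z ∈ f -> I a z) /\
  (forall a, a ∈ B -> forall n, n ∈ om -> forall m, m ∈ om ->
     forall z, z ∈ Z -> forall z', z' ∈ Z ->
     m = succ n -> tri a n z ∈ f -> tri a m z' ∈ f -> P a n z z').

Lemma adm_pr_inv d a b : adm V d -> pr a b ∈ d -> a ∈ d /\ b ∈ d.
Proof.
  intros Hd H.
  assert (H' : upair a b ∈ d).
  { apply (adm_tran HV d _ (pr a b)); auto. apply (in_upair HV); auto. }
  split; apply (adm_tran HV d _ (upair a b)); auto; apply (in_upair HV); auto.
Qed.

(** Justifications of single values are found in any admissible [d] that contains [B], [om] and [Z].
    Quantifying over them is therefore bounded by [d], and Delta_0 induction on [om] is enough; the
    graph is then cut out of [d] by separation. *)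
Theorem recursion (I : dom V -> dom V -> Prop)
    (P : dom V -> dom V -> dom V -> dom V -> Prop) (B Z : dom V) :
  D0 all_sets (fun r => I (r 0) (r 1)) ->
  D0 all_sets (fun r => P (r 0) (r 1) (r 2) (r 3)) ->
  (forall a, a ∈ B -> exists z, z ∈ Z /\ I a z) ->
  (forall a z z', a ∈ B -> z ∈ Z -> z' ∈ Z -> I a z -> I a z' -> z = z') ->
  (forall a n z, a ∈ B -> n ∈ om -> z ∈ Z -> exists z', z' ∈ Z /\ P a n z z') ->
  (forall a n z y y', a ∈ B -> n ∈ om -> z ∈ Z -> y ∈ Z -> y' ∈ Z ->
     P a n z y -> P a n z y' -> y = y') ->
  exists f, is_fun B Z f /\ satisfies_rec I P B Z f.
Proof.
  intros HI HP Iex Iun Pex Pun.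
  destruct (limit HV (tri B om Z)) as [d [Hd Hin]].
  apply adm_pr_inv in Hin; [|exact Hd]; destruct Hin as [HB Hin].
  apply adm_pr_inv in Hin; [|exact Hd]; destruct Hin as [Hom HZ].
  pose proof (kp_adm HV d Hd) as K.
  assert (Htr : forall x y, y ∈ d -> x ∈ y -> x ∈ d) by (intros x y; apply (kp_tran _ K)).
  (* [g] justifies values for the parameter [a]: each of its pairs is an initial value or follows by
     [P] from a pair in [g]. It need not be a function; uniqueness is proved afterwards from [Iun]
     and [Pun]. *)
  set (Just := fun a g => forall q, q ∈ g -> exists k z, q = pr k z /\ ((k ∈ om /\ z ∈ Z) /\
    ((k = emp /\ I a z) \/ exists k', k' ∈ om /\ (k = succ k' /\
      exists z', z' ∈ Z /\ (pr k' z' ∈ g /\ P a k' z' z))))).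
  set (R := fun a n z => exists g, g ∈ d /\ (Just a g /\ pr n z ∈ g)).
  assert (HR : D0 all_sets (fun r => R (r 0) (r 1) (r 2))) by (unfold R, Just; d0).
  assert (Rex : forall a, a ∈ B -> forall n, n ∈ om -> exists z, z ∈ Z /\ R a n z).
  { intros a Ha; apply (om_ind HV (fun n => exists z, z ∈ Z /\ R a n z)); [d0| |].
    - destruct (Iex a Ha) as [z [Hz Hi]]. exists z; split; [exact Hz|].
      exists (sing (pr emp z)). split.
      { apply (kp_sing HV _ K), (kp_pr HV _ K); [apply (kp_emp HV _ K)|exact (Htr _ _ HZ Hz)]. }
      split; [|apply (in_sing HV); reflexivity].
      intros q Hq; apply (in_sing HV) in Hq. exists emp, z; split; [exact Hq|].
      split; [split; [apply (emp_om HV)|exact Hz]|left; auto].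
    - intros n Hn [z [Hz [g [Hg [HJ Hnz]]]]].
      destruct (Pex a n z Ha Hn Hz) as [z' [Hz' Hp]]. exists z'; split; [exact Hz'|].
      exists (cup g (sing (pr (succ n) z'))). split.
      { apply (kp_cup HV _ K); [exact Hg|]. apply (kp_sing HV _ K), (kp_pr HV _ K).
        - apply (kp_succ HV _ K); exact (Htr _ _ Hom Hn).
        - exact (Htr _ _ HZ Hz'). }
      split; [|apply (in_cup HV); right; apply (in_sing HV); reflexivity].
      intros q Hq; apply (in_cup HV) in Hq; destruct Hq as [Hq|Hq].
      + destruct (HJ q Hq) as (k & y & -> & Hky & H). exists k, y; split; [reflexivity|].
        split; [exact Hky|]. destruct H as [H|(k' & Hk' & -> & y' & Hy' & Hg' & H)]; [auto|].
        right; exists k'; split; [exact Hk'|split; [reflexivity|]].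
        exists y'; repeat split; auto. apply (in_cup HV); auto.
      + apply (in_sing HV) in Hq. exists (succ n), z'; split; [exact Hq|].
        split; [split; [apply (succ_om HV), Hn|exact Hz']|]. right; exists n.
        repeat split; auto. exists z; repeat split; auto. apply (in_cup HV); auto. }
  assert (R0 : forall a z, R a emp z -> I a z).
  { intros a z (g & _ & HJ & Hg). destruct (HJ _ Hg) as (k & y & Hky & _ & H).
    apply (pr_inj HV) in Hky; destruct Hky as [<- <-].
    destruct H as [[_ H]|(k' & _ & H & _)]; [exact H|].
    destruct (succ_neq_emp HV k'); auto. }
  assert (RS : forall a n z', n ∈ om -> R a (succ n) z' ->
    exists z, z ∈ Z /\ R a n z /\ P a n z z').
  { intros a n z' Hn (g & Hgd & HJ & Hg). destruct (HJ _ Hg) as (k & y & Hky & _ & H).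
    apply (pr_inj HV) in Hky; destruct Hky as [<- <-].
    destruct H as [[H _]|(k' & Hk' & H & z & Hz & Hg' & H')].
    - destruct (succ_neq_emp HV n); exact H.
    - apply (succ_inj HV) in H; auto; subst k'. exists z; repeat split; auto.
      exists g; auto. }
  assert (Run : forall a, a ∈ B -> forall n, n ∈ om ->
    forall z, z ∈ Z -> forall z', z' ∈ Z -> R a n z -> R a n z' -> z = z').
  { intros a Ha. apply (om_ind HV (fun n => forall z, z ∈ Z -> forall z', z' ∈ Z ->
      R a n z -> R a n z' -> z = z')); [d0| |].
    - intros z Hz z' Hz' H H'. exact (Iun a z z' Ha Hz Hz' (R0 a z H) (R0 a z' H')).
    - intros n Hn IH y Hy y' Hy' H H'.
      destruct (RS a n y Hn H) as (z & Hz & HRz & Hzy).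
      destruct (RS a n y' Hn H') as (z' & Hz' & HRz' & Hzy').
      rewrite <- (IH z Hz z' Hz' HRz HRz') in Hzy'.
      exact (Pun a n z y y' Ha Hn Hz Hy Hy' Hzy Hzy'). }
  set (Q := fun q => exists a n z, q = tri a n z /\ ((a ∈ B /\ n ∈ om) /\ z ∈ Z /\ R a n z)).
  assert (HQ : D0 all_sets (fun r => Q (r 0))) by (unfold Q; d0).
  assert (Hf : forall a n z, tri a n z ∈ comp d Q <-> (a ∈ B /\ n ∈ om) /\ z ∈ Z /\ R a n z).
  { intros a n z; rewrite (in_comp HV) by exact HQ. split.
    - intros (_ & a' & n' & z' & H & H'). apply (tri_inj HV) in H.
      destruct H as (-> & -> & ->); exact H'.
    - intros H. split; [|exists a, n, z; auto]. apply (kp_tri HV _ K).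
      + exact (Htr _ _ HB (proj1 (proj1 H))).
      + exact (Htr _ _ Hom (proj2 (proj1 H))).
      + exact (Htr _ _ HZ (proj1 (proj2 H))). }
  exists (comp d Q). split; split; try split.
  - intros q Hq; apply (in_comp HV) in Hq; [|exact HQ].
    destruct Hq as (_ & a & n & z & -> & H1 & H2 & _). exists a, n, z; auto.
  - intros a Ha n Hn. destruct (Rex a Ha n Hn) as [z [Hz H]].
    exists z; split; [exact Hz|]. apply Hf; auto.
  - intros a Ha n Hn z Hz z' Hz' H H'. apply Hf in H, H'.
    apply (Run a Ha n Hn); tauto.
  - intros a Ha z Hz H; apply Hf in H. apply R0; tauto.
  - intros a Ha n Hn m Hm z Hz z' Hz' -> H H'. apply Hf in H, H'.
    destruct (RS a n z' Hn (proj2 (proj2 H'))) as (y & Hy & HRy & Hp).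
    replace z with y; [exact Hp|]. apply (Run a Ha n Hn); tauto.
Qed.

End Recursion.

(** * Arithmetic and pairing *)

Section Arithmetic.
Context {V : structure} (HV : model V ST.KPlr_M).
Notation all_sets := (fun _ : dom V => True).
Notation M := (stable V).
Let Hemp : emp ∈ om := emp_om HV.
Let Hsucc : forall n, n ∈ om -> succ n ∈ om := succ_om HV.

(** [om] is the only set with a certain Delta_0 property free of parameters, so the witness found in
    [M] must be [om]. *)
Lemma om_stable : om ∈ M.
Proof.
  destruct (stability HV (fun w => (forall n, n ∈ w -> in_omega n) /\
    ((exists e, e ∈ w /\ e = emp) /\
     (forall n, n ∈ w -> exists m, m ∈ w /\ m = succ n)))) as [w [Hw [H1 [[e [He ->]] H2]]]].
  - apply D0_and; [|d0]. apply D0_all; [dfun_tac|]. apply (D0_in_omega HV); dfun_tac.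
  - exists om; split; [intros n Hn; apply (in_om HV); exact Hn|]. split.
    + exists emp; split; [apply (emp_om HV)|reflexivity].
    + intros n Hn; exists (succ n); split; [apply (succ_om HV), Hn|reflexivity].
  - replace om with w; [exact Hw|]. apply (ext HV); intros n; split.
    + intros Hn; apply (in_om HV), H1, Hn.
    + apply (om_ind HV (fun n => n ∈ w)); [d0|exact He|].
      intros m _ Hm; destruct (H2 m Hm) as [m' [Hm' ->]]; exact Hm'.
Qed.

Lemma om_elt_stable n : n ∈ om -> n ∈ M.
Proof. apply (stable_tran HV), om_stable. Qed.

Definition omsq_spec (w : dom V) : Prop :=
  (forall q, q ∈ w -> exists m n, q = pr m n /\ (m ∈ om /\ n ∈ om)) /\
  (forall m, m ∈ om -> forall n, n ∈ om -> pr m n ∈ w).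

(** Witnesses are chosen inside [M] because the graphs of arithmetic will be parameters of the
    Sigma_1 statement to which stability is applied. *)
Definition select (P : dom V -> Prop) : dom V :=
  epsilon (inhabits M) (fun x => x ∈ M /\ P x).

Lemma select_spec (P : dom V -> Prop) :
  D0 (elt M) (fun r => P (r 0)) -> (exists x, P x) -> select P ∈ M /\ P (select P).
Proof. 
  intros HP H.
  exact (epsilon_spec (inhabits M) (fun x => x ∈ M /\ P x) (stability HV P HP H)).
Qed.

Definition omsq : dom V := select omsq_spec.

Lemma omsq_ok : omsq ∈ M /\ omsq_spec omsq.
Proof.
  pose proof om_stable as HomM. apply select_spec; [unfold omsq_spec; d0|].
  destruct (limit HV om) as [d [Hd Hom]].
  exists (comp d (fun q => exists m n, q = pr m n /\ (m ∈ om /\ n ∈ om))). split.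
  - intros q Hq; apply (in_comp HV) in Hq; [tauto|d0].
  - intros m Hm n Hn. apply (in_comp HV); [d0|]. split; [|eauto].
    apply (kp_pr HV _ (kp_adm HV d Hd)); apply (adm_tran HV d _ om); assumption.
Qed.

Definition add_graph (f : dom V) : Prop :=
  is_fun om om f /\ satisfies_rec (fun a z => z = a) (fun a n z z' => z' = succ z) om om f.

Definition ad : dom V := select add_graph.

Lemma ad_ok : ad ∈ M /\ add_graph ad.
Proof.
  pose proof om_stable as HomM. pose proof (om_elt_stable _ (emp_om HV)) as HempM.
  apply select_spec; [unfold add_graph, is_fun, satisfies_rec; d0|].
  apply (recursion HV); try d0.
  - eauto.
  - intros; subst; reflexivity.
  - intros a n z _ _ Hz; exists (succ z); split; [apply (succ_om HV), Hz|reflexivity].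
  - intros; subst; reflexivity.
Qed.

Definition mul_graph (f : dom V) : Prop :=
  is_fun om om f /\
  satisfies_rec (fun a z => z = emp) (fun a n z z' => tri z a z' ∈ ad) om om f.

Definition mu : dom V := select mul_graph.

Lemma mu_ok : mu ∈ M /\ mul_graph mu.
Proof.
  pose proof om_stable as HomM. pose proof (om_elt_stable _ (emp_om HV)) as HempM.
  destruct ad_ok as [HadM [[_ [Htot Hfun]] _]].
  apply select_spec; [unfold mul_graph, is_fun, satisfies_rec; d0|].
  apply (recursion HV); try d0.
  - intros _ _; exists emp; split; [apply (emp_om HV)|reflexivity].
  - intros; subst; reflexivity.
  - intros a n z Ha _ Hz. apply Htot; assumption.
  - intros a n z y y' Ha Hn Hz Hy Hy'. apply Hfun; assumption.
Qed.

(** The step of Cantor's enumeration: from the end [(a, 0)] of a diagonal to the start [(0, a + 1)]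
    of the next one, otherwise one place along the diagonal. *)
Definition next (z z' : dom V) : Prop :=
  exists a b, z = pr a b /\
    ((b = emp /\ exists a', a' ∈ om /\ (a' = succ a /\ z' = pr emp a')) \/
     (exists b', b' ∈ om /\ (b = succ b' /\
        exists a', a' ∈ om /\ (a' = succ a /\ z' = pr a' b')))).

(* The graph of the enumeration of pairs [(0,0), (0,1), (1,0), (0,2), (1,1), (2,0), ...]. *)
Definition pairing_graph (f : dom V) : Prop :=
  is_fun (succ emp) omsq f /\
  satisfies_rec (fun a z => z = pr emp emp) (fun a n z z' => next z z') (succ emp) omsq f.

Definition pg : dom V := select pairing_graph.

Lemma pg_ok : pg ∈ M /\ pairing_graph pg.
Proof.
  pose proof om_stable as HomM. pose proof (om_elt_stable _ (emp_om HV)) as HempM.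
  pose proof (om_elt_stable _ (succ_om HV _ (emp_om HV))) as H1M.
  destruct omsq_ok as [HsqM [Hsq1 Hsq2]].
  apply select_spec; [unfold pairing_graph, is_fun, satisfies_rec, next; d0|].
  apply (recursion HV); try (unfold next; d0).
  - intros _ _; exists (pr emp emp); split; [apply Hsq2; apply (emp_om HV)|reflexivity].
  - intros; subst; reflexivity.
  - intros _ n z _ _ Hz. destruct (Hsq1 z Hz) as (a & b & -> & Ha & Hb).
    destruct (om_cases HV b Hb) as [->|[b' [Hb' ->]]].
    + exists (pr emp (succ a)).
      split; [apply Hsq2; [apply (emp_om HV)|apply (succ_om HV), Ha]|].
      exists a, emp; split; [reflexivity|left; split; [reflexivity|]].
      exists (succ a); auto using Hsucc.
    + exists (pr (succ a) b'). split; [apply Hsq2; [apply (succ_om HV), Ha|exact Hb']|].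
      exists a, (succ b'); split; [reflexivity|right; exists b'; repeat split; auto].
      exists (succ a); auto using Hsucc.
  - intros _ n z y y' _ _ Hz _ _ (a & b & -> & H) (a' & b' & E & H').
    destruct (Hsq1 _ Hz) as (a0 & b0 & E0 & Ha0 & Hb0).
    apply (pr_inj HV) in E; destruct E as [<- <-].
    apply (pr_inj HV) in E0; destruct E0 as [<- <-].
    destruct H as [[-> (c & _ & -> & ->)]|(k & Hk & -> & c & _ & -> & ->)];
      destruct H' as [[E (c' & _ & -> & ->)]|(k' & Hk' & E & c' & _ & -> & ->)].
    + reflexivity.
    + symmetry in E; destruct (succ_neq_emp HV _ E).
    + destruct (succ_neq_emp HV _ E).
    + apply (succ_inj HV) in E; [|assumption..]. congruence.
Qed.

(* The value of a binary function given by its graph [f], and [0] where it is undefined. *)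
Definition ap (f a n : dom V) : dom V :=
  epsilon (inhabits M) (fun z => z ∈ om /\
    (tri a n z ∈ f \/ ((forall y, y ∈ om -> ~ tri a n y ∈ f) /\ z = emp))).

Lemma ap_eq f B a n z : is_fun B om f ->
  z = ap f a n <-> z ∈ om /\
    (tri a n z ∈ f \/ ((forall y, y ∈ om -> ~ tri a n y ∈ f) /\ z = emp)).
Proof.
  intros (Hf1 & _ & Hf3). set (Q := fun z => z ∈ om /\
    (tri a n z ∈ f \/ ((forall y, y ∈ om -> ~ tri a n y ∈ f) /\ z = emp))).
  assert (Hex : exists z, Q z).
  { destruct (classic (exists y, y ∈ om /\ tri a n y ∈ f)) as [[y [Hy H]]|Hno].
    - exists y; split; auto.
    - exists emp; split; [apply (emp_om HV)|right].
      split; [intros y Hy H; apply Hno; eauto|reflexivity]. }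
  pose proof (epsilon_spec (inhabits M) Q Hex) as Hap.
  change (z = epsilon (inhabits M) Q <-> Q z). split; [intros ->; exact Hap|].
  intros [Hz H]. destruct Hap as [Hz' H'].
  destruct H as [H|[H ->]], H' as [H'|[H' ->]].
  - destruct (Hf1 _ H) as (a1 & n1 & z1 & E & [Ha Hn] & _).
    apply (tri_inj HV) in E; destruct E as (-> & -> & ->).
    apply (Hf3 a1 Ha n1 Hn); assumption.
  - destruct (H' z Hz H).
  - destruct (H _ Hz' H').
  - reflexivity.
Qed.

Lemma ap_om f B a n : is_fun B om f -> ap f a n ∈ om.
Proof. intros Hf; apply (proj1 (ap_eq f B a n _ Hf) eq_refl). Qed.

Lemma ap_unique f B a n z : is_fun B om f -> z ∈ om -> tri a n z ∈ f -> ap f a n = z.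
Proof. intros Hf Hz H; symmetry; apply (ap_eq f B a n z Hf); auto. Qed.

Lemma ap_in f B a n : is_fun B om f -> a ∈ B -> n ∈ om -> tri a n (ap f a n) ∈ f.
Proof.
  intros Hf Ha Hn; pose proof Hf as (_ & Htot & _).
  destruct (Htot a Ha n Hn) as [z [Hz H]].
  rewrite (ap_unique f B a n z Hf Hz H); exact H.
Qed.

Lemma dfun_ap C f B t u : is_fun B om f -> C f -> C om -> C emp ->
  dfun C t -> dfun C u -> dfun C (fun r => ap f (t r) (u r)).
Proof.
  intros Hf HCf HCom HCe Ht Hu. apply (dfun_graph C _ (fun _ => om)); [dfun_tac| |].
  - intros r; apply (ap_om f B _ _ Hf).
  - apply (D0_app3 C (fun z a n => z = ap f a n) (fun r => r 0)
      (fun r => t (fun n => r (S n))) (fun r => u (fun n => r (S n)))).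
    + eapply D0_ext; [intros r; apply (ap_eq f B _ _ _ Hf)|]. d0.
    + dfun_tac.
    + exact (dfun_reindex C t S Ht).
    + exact (dfun_reindex C u S Hu).
Qed.

Definition add (a b : dom V) : dom V := ap ad a b.
Definition mul (a b : dom V) : dom V := ap mu a b.

Lemma add_om a b : add a b ∈ om.
Proof. apply (ap_om ad om), ad_ok. Qed.

Lemma mul_om a b : mul a b ∈ om.
Proof. apply (ap_om mu om), mu_ok. Qed.

Lemma add_0 a : a ∈ om -> add a emp = a.
Proof.
  intros Ha; destruct ad_ok as [_ [Hf [H0 _]]].
  apply (H0 a Ha _ (add_om _ _)), (ap_in ad om); auto using Hemp.
Qed.

Lemma add_S a b : a ∈ om -> b ∈ om -> add a (succ b) = succ (add a b).
Proof.
  intros Ha Hb; destruct ad_ok as [_ [Hf [_ HS]]].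
  apply (HS a Ha b Hb (succ b) (succ_om HV b Hb) _ (add_om _ _) _ (add_om _ _));
    [reflexivity| |]; apply (ap_in ad om); auto using Hsucc.
Qed.

Lemma mul_0 a : a ∈ om -> mul a emp = emp.
Proof.
  intros Ha; destruct mu_ok as [_ [Hf [H0 _]]].
  apply (H0 a Ha _ (mul_om _ _)), (ap_in mu om); auto using Hemp.
Qed.

Lemma mul_S a b : a ∈ om -> b ∈ om -> mul a (succ b) = add (mul a b) a.
Proof.
  intros Ha Hb; destruct mu_ok as [_ [Hf [_ HS]]]. symmetry.
  apply (ap_unique ad om); [apply ad_ok|apply mul_om|].
  apply (HS a Ha b Hb (succ b) (succ_om HV b Hb) _ (mul_om _ _) _ (mul_om _ _));
    [reflexivity| |]; apply (ap_in mu om); auto using Hsucc.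
Qed.

Lemma add_0_l b : b ∈ om -> add emp b = b.
Proof.
  pose proof (emp_om HV) as H0.
  apply (om_ind HV (fun b => add emp b = b)).
  - apply D0_eq; [|dfun_tac]. apply (dfun_ap _ ad om); try exact I; try dfun_tac.
    apply ad_ok.
  - apply add_0, H0.
  - intros n Hn IH; rewrite add_S, IH; auto.
Qed.

Lemma add_S_l a b : a ∈ om -> b ∈ om -> add (succ a) b = succ (add a b).
Proof.
  intros Ha. apply (om_ind HV (fun b => add (succ a) b = succ (add a b))).
  - refine (D0_subst2 _ (fun r => r 0 = succ (r 1)) (fun r => add (succ a) (r 0))
      (fun r => add a (r 0)) _ _ _); [| |d0];
      apply (dfun_ap _ ad om); try exact I; try dfun_tac; apply ad_ok.
  - rewrite !add_0; auto using Hsucc.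
  - intros n Hn IH; rewrite !add_S, IH; auto using Hsucc.
Qed.

(** The recursion for [pg] has no real parameter; [emp] is the only element of the dummy parameter
    set [succ emp]. *)
Definition enumerates (n a b : dom V) : Prop := tri emp n (pr a b) ∈ pg.

Lemma enum_total n : n ∈ om -> exists a b, a ∈ om /\ b ∈ om /\ enumerates n a b.
Proof.
  intros Hn; destruct pg_ok as [_ [[_ [Htot _]] _]].
  destruct (Htot emp (proj2 (in_succ HV _ _) (or_intror eq_refl)) n Hn) as [z [Hz H]].
  destruct omsq_ok as [_ [Hsq _]]. destruct (Hsq z Hz) as (a & b & -> & Ha & Hb).
  exists a, b; auto.
Qed.

Lemma enum_om n a b : enumerates n a b -> n ∈ om /\ a ∈ om /\ b ∈ om.
Proof.
  intros H; destruct pg_ok as [_ [[Hf _] _]]. destruct omsq_ok as [_ [Hsq _]].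
  destruct (Hf _ H) as (e & n' & z & E & [_ Hn] & Hz).
  apply (tri_inj HV) in E; destruct E as (_ & -> & <-).
  destruct (Hsq _ Hz) as (a' & b' & E & Ha & Hb).
  apply (pr_inj HV) in E; destruct E as [-> ->]; auto.
Qed.

Lemma enum_functional n a b a' b' :
  enumerates n a b -> enumerates n a' b' -> a = a' /\ b = b'.
Proof.
  intros H H'. destruct (enum_om _ _ _ H) as (Hn & Ha & Hb).
  destruct (enum_om _ _ _ H') as (_ & Ha' & Hb').
  destruct pg_ok as [_ [[_ [_ Hfun]] _]]. destruct omsq_ok as [_ [_ Hsq]].
  apply (pr_inj HV).
  apply (Hfun emp (proj2 (in_succ HV _ _) (or_intror eq_refl)) n Hn); auto.
Qed.

Lemma enum_0 : enumerates emp emp emp.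
Proof.
  pose proof (proj2 (in_succ HV emp _) (or_intror eq_refl)) as H1.
  destruct pg_ok as [_ [[_ [Htot _]] [H0 _]]].
  destruct (Htot emp H1 emp (emp_om HV)) as [z [Hz H]].
  pose proof (H0 emp H1 z Hz H) as ->. exact H.
Qed.

Lemma enum_next n a b : enumerates n a b ->
  exists z, next (pr a b) z /\ tri emp (succ n) z ∈ pg.
Proof.
  intros H. destruct (enum_om _ _ _ H) as (Hn & Ha & Hb).
  pose proof (proj2 (in_succ HV emp _) (or_intror eq_refl)) as H1.
  destruct omsq_ok as [_ [_ Hsq]].
  destruct pg_ok as [_ [[_ [Htot _]] [_ HS]]].
  destruct (Htot emp H1 (succ n) (succ_om HV n Hn)) as [z [Hz Hz']].
  exists z; split; [|exact Hz'].
  exact (HS emp H1 n Hn (succ n) (succ_om HV n Hn) _ (Hsq a Ha b Hb) z Hz eq_refl H Hz').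
Qed.

Definition enumerated (a b : dom V) : Prop := exists n, n ∈ om /\ enumerates n a b.

Lemma enumerated_turn a : enumerated a emp -> enumerated emp (succ a).
Proof.
  intros (n & Hn & H). destruct (enum_next _ _ _ H) as (z & (a' & b' & E & Hz) & H').
  apply (pr_inj HV) in E; destruct E as [<- <-].
  destruct Hz as [[_ (a' & _ & -> & ->)]|(b' & _ & E & _)].
  - exists (succ n); split; [apply (succ_om HV), Hn|exact H'].
  - symmetry in E; destruct (succ_neq_emp HV _ E).
Qed.

Lemma enumerated_step a b : enumerated a (succ b) -> enumerated (succ a) b.
Proof.
  intros (n & Hn & H). destruct (enum_next _ _ _ H) as (z & (a' & b' & E & Hz) & H').
  destruct (enum_om _ _ _ H) as (_ & Ha & Hb).
  apply (pr_inj HV) in E; destruct E as [<- <-].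
  destruct Hz as [[E _]|(b' & Hb' & E & a' & _ & -> & ->)].
  - destruct (succ_neq_emp HV _ E).
  - exists (succ n); split; [apply (succ_om HV), Hn|].
    replace b with b'; [exact H'|]. symmetry; apply (succ_inj HV); auto.
    apply (om_trans HV _ _ Hb), (in_succ HV); auto.
Qed.

Lemma D0_enumerates C t u v : C pg -> C emp -> C omsq ->
  dfun C t -> dfun C u -> dfun C v -> D0 C (fun r => enumerates (t r) (u r) (v r)).
Proof.
  intros Hpg He Hsq Ht Hu Hv. apply (D0_app3 C enumerates t u v); auto.
  apply (D0_ext _ _ (fun r => exists q, q ∈ omsq /\ (q = pr (r 1) (r 2) /\
    tri emp (r 0) q ∈ pg))); [|d0].
  intros r; split; [|intros (q & _ & -> & H); exact H].
  intros H; exists (pr (r 1) (r 2)); split; [|auto].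
  destruct omsq_ok as [_ [_ Hs]]. apply enum_om in H; apply Hs; tauto.
Qed.

(** From [(0, b + a)] it takes [a] steps along the diagonal to reach [(a, b)]. The induction passes
    from [b] to [succ b], so [b] has to be generalized. *)
Lemma diagonal a : a ∈ om -> forall b, b ∈ om ->
  enumerated emp (add b a) -> enumerated a b.
Proof.
  apply (om_ind HV (fun a => forall b, b ∈ om ->
    enumerated emp (add b a) -> enumerated a b)).
  - apply D0_all; [dfun_tac|cbv beta]. apply D0_imp.
    + apply D0_ex; [dfun_tac|]. apply D0_enumerates; try exact I; try dfun_tac.
      apply (dfun_ap _ ad om); try exact I; try dfun_tac. apply ad_ok.
    + apply D0_ex; [dfun_tac|]. apply D0_enumerates; try exact I; try dfun_tac.
  - intros b Hb; rewrite add_0 by exact Hb; auto.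
  - intros a' Ha IH b Hb H. apply enumerated_step, IH; [apply (succ_om HV), Hb|].
    rewrite add_S_l, <- add_S; auto.
Qed.

Lemma enum_surjective a b : a ∈ om -> b ∈ om -> enumerated a b.
Proof.
  intros Ha Hb. apply diagonal; auto.
  (* Every diagonal is started: the first by [enum_0], each further one by the turn at the end
     [(s, 0)] of its predecessor, which [diagonal] reaches. *)
  assert (H : forall s, s ∈ om -> enumerated emp s).
  { apply (om_ind HV (fun s => enumerated emp s)).
    - apply D0_ex; [dfun_tac|]. apply D0_enumerates; try exact I; try dfun_tac.
    - exists emp; split; [apply (emp_om HV)|apply enum_0].
    - intros s Hs H. apply enumerated_turn, diagonal; auto using Hemp.
      rewrite add_0_l; auto. }
  apply H, add_om.
Qed.

End Arithmetic.

(** * Trees of finite sequences *)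

Section Trees.
Context {V : structure} (HV : model V ST.KPlr_M).
Notation all_sets := (fun _ : dom V => True).
Let Hemp : emp ∈ om := emp_om HV.
Let Hsucc : forall n, n ∈ om -> succ n ∈ om := succ_om HV.

Lemma D0_mono (C C' : dom V -> Prop) P :
  (forall x, C x -> C' x) -> (exists c, C c) -> D0 C P -> D0 C' P.
Proof.
  intros HCC Hc HP _; destruct (HP Hc) as (A & pi & H1 & H2 & H3 & H4).
  exists A, pi; auto.
Qed.

Notation rel6 := (dom V -> dom V -> dom V -> dom V -> dom V -> dom V -> Prop).

(* The nodes of the tree are the functions [s] from some [n] to omega, as sets of pairs. *)
Definition obeys (K : rel6) (s : dom V) : Prop :=
  forall p1, p1 ∈ om -> forall y1, y1 ∈ om -> forall p2, p2 ∈ om -> forall y2, y2 ∈ om ->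
  forall p3, p3 ∈ om -> forall y3, y3 ∈ om ->
  pr p1 y1 ∈ s -> pr p2 y2 ∈ s -> pr p3 y3 ∈ s -> K p1 y1 p2 y2 p3 y3.

Definition child (n m s : dom V) : dom V := cup s (sing (pr n m)).

(* Ranks may be multivalued, so that a union of rankings is a ranking and no choice is
   needed when the rankings of the children of a node are collected. *)
Definition ranks (K : rel6) (f : dom V) : Prop :=
  forall q, q ∈ f -> forall n s v, q = tri n s v -> obeys K s ->
  forall m, m ∈ om -> exists q', q' ∈ f /\
    exists n' s' v', q' = tri n' s' v' /\ ((n' = succ n /\ s' = child n m s) /\ v' ∈ v).

Definition ranked (K : rel6) (f n s : dom V) : Prop :=
  ranks K f /\ exists q, q ∈ f /\ exists n' s' v, q = tri n' s' v /\ (n' = n /\ s' = s).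

Definition wf (K : rel6) (d : dom V) : Prop :=
  exists f, f ∈ d /\ ranked K f emp emp.

Lemma in_child n m s x : x ∈ child n m s <-> x ∈ s \/ x = pr n m.
Proof. unfold child; rewrite (in_cup HV), (in_sing HV); reflexivity. Qed.

Lemma D0_is_child C t n m s : dfun C t -> dfun C n -> dfun C m -> dfun C s ->
  D0 C (fun r => t r = child (n r) (m r) (s r)).
Proof.
  intros Ht Hn Hm Hs. apply (D0_app4 C (fun t n m s => t = child n m s) t n m s); auto.
  apply (D0_ext _ _ (fun r => ((forall x, x ∈ r 0 -> x ∈ r 3 \/ x = pr (r 1) (r 2)) /\
    forall x, x ∈ r 3 -> x ∈ r 0) /\ pr (r 1) (r 2) ∈ r 0)); [|d0].
  intros r; split.
  - intros ->; split; [split|]; intros; apply in_child; auto.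
  - intros [[H1 H2] H3]; apply (ext HV); intros x; rewrite in_child.
    split; [apply H1|]. intros [H| ->]; auto.
Qed.

Section DefinableConstraint.
Context (C : dom V -> Prop) (Hom : C om) (K : (nat -> dom V) -> rel6).
Context (HK : D0 C (fun r => K (fun n => r (6 + n)) (r 0) (r 1) (r 2) (r 3) (r 4) (r 5))).

(** The constraint may depend on an environment of its own; [q] relocates that environment, so that
    the lemma can be used under binders. *)
Lemma D0_obeys q t : dfun C t -> D0 C (fun r => obeys (K (fun n => r (q n))) (t r)).
Proof.
  intros Ht.
  apply (D0_subst C (fun r => obeys (K (fun n => r (S (q n)))) (r 0)) t Ht).
  unfold obeys. do 6 (apply D0_all; [dfun_tac|]). do 3 (apply D0_imp; [d0|]).
  (* The last bound variable [y3] is at 0 and the first one [p1] at 5, hence the reversed order;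
     position 6 holds the set [t], so the environment starts at 7. *)
  exact (D0_reindex C _ (5 .: 4 .: 3 .: 2 .: 1 .: 0 .: fun n => 7 + q n) HK).
Qed.

Lemma D0_ranks q t : dfun C t -> D0 C (fun r => ranks (K (fun n => r (q n))) (t r)).
Proof.
  intros Ht.
  apply (D0_subst C (fun r => ranks (K (fun n => r (S (q n)))) (r 0)) t Ht).
  unfold ranks. apply D0_all; [dfun_tac|]. apply (D0_all_tri HV); [dfun_tac|].
  apply D0_imp; [apply (D0_obeys (fun n => 5 + q n)); dfun_tac|].
  apply D0_all; [dfun_tac|]. apply D0_ex; [dfun_tac|]. apply (D0_ex_tri HV); [dfun_tac|].
  apply D0_and; [apply D0_and; [d0|]|d0]. apply D0_is_child; dfun_tac.
Qed.

Lemma D0_ranked q t n s : dfun C t -> dfun C n -> dfun C s ->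
  D0 C (fun r => ranked (K (fun n => r (q n))) (t r) (n r) (s r)).
Proof.
  intros Ht Hn Hs. apply D0_and; [apply D0_ranks, Ht|].
  apply (D0_app3 C (fun t n s => exists q, q ∈ t /\ exists n' s' v, q = tri n' s' v /\
    (n' = n /\ s' = s)) t n s); auto. d0.
Qed.

End DefinableConstraint.

Lemma ranked_iff K f n s : ranked K f n s <-> ranks K f /\ exists v, tri n s v ∈ f.
Proof.
  unfold ranked; split; intros [Hr H]; split; auto.
  - destruct H as (q & Hq & n' & s' & v & -> & -> & ->); eauto.
  - destruct H as [v Hv]. exists (tri n s v); split; [exact Hv|].
    exists n, s, v; auto.
Qed.

Lemma ranks_child K f n s v m : ranks K f -> tri n s v ∈ f -> obeys K s -> m ∈ om ->
  exists v', v' ∈ v /\ tri (succ n) (child n m s) v' ∈ f.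
Proof.
  intros Hr Hv Hs Hm.
  destruct (Hr _ Hv n s v eq_refl Hs m Hm) as (q & Hq & n' & s' & v' & -> & [-> ->] & Hv').
  eauto.
Qed.

Definition is_seq (F : dom V) : Prop :=
  (forall n, n ∈ om -> exists m, m ∈ om /\ pr n m ∈ F) /\
  (forall n, n ∈ om -> forall m, m ∈ om -> forall m', m' ∈ om ->
     pr n m ∈ F -> pr n m' ∈ F -> m = m').

(** Ranks descend along [F]. Foundation yields a minimal rank among the nodes contained in [F], but
    prolonging such a node by the next value of [F] leads to a rank that is an element of it. *)
Theorem wf_no_path K d F : wf K d -> is_seq F -> obeys K F -> False.
Proof.
  intros (f & _ & Hf) [Htot _] HF. apply ranked_iff in Hf; destruct Hf as [Hr [v0 H0]].
  destruct (foundation HV (fun v => exists q, q ∈ f /\ exists n s v', q = tri n s v' /\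
    ((n ∈ om /\ forall x, x ∈ s -> x ∈ F) /\ v' = v))) as [v [Hv Hmin]]; [d0| |].
  - exists v0, (tri emp emp v0); split; [exact H0|].
    exists emp, emp, v0; repeat split; auto. intros x Hx; destruct (in_emp HV x Hx).
  - destruct Hv as (q & Hq & n & s & v' & -> & [Hn Hs] & ->).
    destruct (Htot n Hn) as [m [Hm Hnm]].
    destruct (ranks_child K f n s v m Hr Hq) as [v' [Hv' Hq']]; auto.
    { intros p1 H1 y1 H2 p2 H3 y2 H4 p3 H5 y3 H6 H7 H8 H9; apply HF; auto. }
    apply (Hmin v' Hv'). exists (tri (succ n) (child n m s) v'); split; [exact Hq'|].
    exists (succ n), (child n m s), v'; repeat split; auto.
    intros x Hx; apply in_child in Hx; destruct Hx as [Hx| ->]; auto.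
Qed.

(** * The leftmost path through unranked nodes *)

Section Paths.
Context (d : dom V) (Hd : adm V d) (Hom : om ∈ d) (K : rel6).
Context (HK : D0 (elt d) (fun r => K (r 0) (r 1) (r 2) (r 3) (r 4) (r 5))).

Let HKall : D0 all_sets (fun r => K (r 0) (r 1) (r 2) (r 3) (r 4) (r 5)).
Proof. apply (D0_mono (elt d)); auto. exact (adm_inh HV d Hd). Qed.

Let Kd : kp (elt d) := kp_adm HV d Hd.

Let Htr : forall x y, y ∈ d -> x ∈ y -> x ∈ d.
Proof. intros x y; apply (kp_tran _ Kd). Qed.

Definition wf_node (n s : dom V) : Prop := exists f, f ∈ d /\ ranked K f n s.

Lemma in_bigcup_intro (a x y : dom V) : y ∈ a -> x ∈ y -> x ∈ bigcup a.
Proof. intros Hy Hx; apply (in_bigcup HV); eauto. Qed.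

(** The chain [v ∈ upair s v ∈ pr s v ∈ upair n (pr s v) ∈ tri n s v ∈ U] explains the four
    unions. *)
Lemma tri_third (U n s v : dom V) :
  tri n s v ∈ U -> v ∈ bigcup (bigcup (bigcup (bigcup U))).
Proof.
  intros H. apply (in_bigcup_intro _ _ (upair s v)); [|apply (in_upair HV); auto].
  apply (in_bigcup_intro _ _ (pr s v)); [|apply (in_upair HV); auto].
  apply (in_bigcup_intro _ _ (upair n (pr s v))); [|apply (in_upair HV); auto].
  apply (in_bigcup_intro _ _ (tri n s v)); [exact H|apply (in_upair HV); auto].
Qed.

Lemma wf_node_step n s : n ∈ om -> s ∈ d ->
  (obeys K s -> forall m, m ∈ om -> wf_node (succ n) (child n m s)) -> wf_node n s.
Proof.
  intros Hn Hs Hwf. assert (Hnd : n ∈ d) by exact (Htr _ _ Hom Hn).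
  destruct (classic (obeys K s)) as [HKs|HKs].
  - specialize (Hwf HKs).
    destruct (adm_collection HV d (fun m y => exists n', n' ∈ om /\ (n' = succ n /\
      (ranks K y /\ exists q, q ∈ y /\ exists n'' s' v, q = tri n'' s' v /\
        (n'' = n' /\ s' = child n m s)))) om) as [b [Hb Hcoll]]; auto.
    + apply D0_ex; [dfun_tac|]. apply D0_and; [d0|]. apply D0_and.
      * apply (D0_ranks (elt d) Hom (fun _ => K) HK (fun n => n)); dfun_tac.
      * apply D0_ex; [dfun_tac|]. apply (D0_ex_tri HV); [dfun_tac|]. apply D0_and; [d0|].
        apply D0_is_child; dfun_tac.
    + intros m Hm. destruct (Hwf m Hm) as (f & Hf & Hr & q & Hq & n' & s' & v & -> & -> & ->).
      exists f; split; [exact Hf|]. exists (succ n); repeat split; auto.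
      exists (tri (succ n) (child n m s) v); split; [exact Hq|].
      exists (succ n), (child n m s), v; auto.
    + assert (Hranks : forall C, C om -> D0 C (fun r => K (r 0) (r 1) (r 2) (r 3) (r 4) (r 5)) ->
        D0 C (fun r => ranks K (r 0))).
      { intros C HC HKC; apply (D0_ranks C HC (fun _ => K) HKC (fun n => n)); dfun_tac. }
      (* Collection may put sets into [b] that are not rankings; they are discarded before taking
         the union. *)
      set (U := bigcup (comp b (ranks K))).
      assert (HU : U ∈ d) by (apply (kp_bigcup HV _ Kd), (kp_comp HV _ Kd); auto).
      (* [w] has every rank used in [U] as an element, so it can be the rank of a node whose
         children are all ranked by [U]. *)
      set (w := bigcup (bigcup (bigcup (bigcup U)))).
      assert (Hw : w ∈ d) by (do 4 apply (kp_bigcup HV _ Kd); exact HU).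
      assert (HinU : forall y, y ∈ b -> ranks K y -> forall q, q ∈ y -> q ∈ U).
      { intros y Hy Hr q Hq; apply (in_bigcup HV). exists y; split; [|exact Hq].
        apply (in_comp HV); auto. }
      exists (cup U (sing (tri n s w))). split.
      { apply (kp_cup HV _ Kd); [exact HU|]. apply (kp_sing HV _ Kd), (kp_tri HV _ Kd); auto. }
      apply ranked_iff; split; [|exists w; apply (in_cup HV); right;
        apply (in_sing HV); reflexivity].
      intros q Hq n1 s1 v1 -> Hs1 m Hm. apply (in_cup HV) in Hq; destruct Hq as [Hq|Hq].
      * apply (in_bigcup HV) in Hq; destruct Hq as [y [Hy Hq]].
        apply (in_comp HV) in Hy; [|auto]. destruct Hy as [Hy Hr].
        destruct (Hr _ Hq n1 s1 v1 eq_refl Hs1 m Hm) as [q' [Hq' H]].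
        exists q'; split; [|exact H]. apply (in_cup HV); left; eauto.
      * apply (in_sing HV), (tri_inj HV) in Hq; destruct Hq as (-> & -> & ->).
        destruct (Hcoll m Hm) as (y & Hy & n' & _ & -> & Hr & q & Hq & H).
        assert (HqU : q ∈ U) by eauto.
        exists q; split; [apply (in_cup HV); left; exact HqU|].
        destruct H as (n'' & s' & v & -> & -> & ->).
        exists (succ n), (child n m s), v; repeat split; auto.
        exact (tri_third _ _ _ _ HqU).
  (* A node that violates the constraint owes nothing to its children, so a ranking with a single
     triple suffices. *)
  - exists (sing (tri n s emp)). split.
    { apply (kp_sing HV _ Kd), (kp_tri HV _ Kd); auto. apply (kp_emp HV _ Kd). }
    apply ranked_iff; split; [|exists emp; apply (in_sing HV); reflexivity].
    intros q Hq n1 s1 v1 -> Hs1. apply (in_sing HV), (tri_inj HV) in Hq.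
    destruct Hq as (-> & -> & ->); contradiction.
Qed.

Lemma not_wf_node_step n s : n ∈ om -> s ∈ d -> ~ wf_node n s ->
  obeys K s /\ exists m, m ∈ om /\ ~ wf_node (succ n) (child n m s).
Proof.
  intros Hn Hs H. split.
  - apply NNPP; intros Hno; apply H, wf_node_step; auto; contradiction.
  - apply NNPP; intros Hno; apply H, wf_node_step; auto. intros _ m Hm.
    apply NNPP; eauto.
Qed.

Let HwfD0 : D0 all_sets (fun r => wf_node (r 0) (r 1)).
Proof.
  unfold wf_node; apply D0_ex; [dfun_tac|].
  apply (D0_ranked all_sets I (fun _ => K) HKall (fun n => n)); dfun_tac.
Qed.

(** [wf_node] only quantifies over [d], so separation in the universe gathers the unranked nodes
    into a set, as [recursion] requires of its range. *)
Let Z : dom V := comp d (fun q => exists n s, q = pr n s /\ (n ∈ om /\ (s ∈ d /\ ~ wf_node n s))).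

Let in_Z n s : pr n s ∈ Z <-> n ∈ om /\ (s ∈ d /\ ~ wf_node n s).
Proof.
  unfold Z; rewrite (in_comp HV) by d0. split.
  - intros (_ & n' & s' & H & H'). apply (pr_inj HV) in H; destruct H as [-> ->]; exact H'.
  - intros H; split; [|eauto]. destruct H as (Hn & Hs & _).
    apply (kp_pr HV _ Kd); eauto.
Qed.

(** Taking the least [m] makes the step single-valued, as [recursion] demands. *)
Let leftmost (a k z z' : dom V) : Prop :=
  exists n s, z = pr n s /\ exists m, m ∈ om /\
    ((exists n' s', z' = pr n' s' /\ (n' = succ n /\ s' = child n m s)) /\
     forall k, k ∈ m -> ~ exists q, q ∈ Z /\ exists n' s', q = pr n' s' /\
       (n' = succ n /\ s' = child n k s)).

Let node (f n s : dom V) : Prop := tri emp n (pr n s) ∈ f.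

Let path_ex : ~ wf_node emp emp -> exists f,
  node f emp emp /\
  (forall n s, node f n s -> n ∈ om /\ s ∈ d /\ ~ wf_node n s) /\
  (forall n s, node f n s -> exists m, m ∈ om /\ node f (succ n) (child n m s)) /\
  (forall n s s', node f n s -> node f n s' -> s = s').
Proof.
  intros H0.
  assert (HeZ : pr emp emp ∈ Z) by (apply in_Z; repeat split; auto; apply (kp_emp HV _ Kd)).
  destruct (recursion HV (fun _ z => z = pr emp emp) leftmost (succ emp) Z)
    as [f [[Hf1 [Htot Hfun]] [Hf0 HfS]]].
  - d0.
  - unfold leftmost. apply (D0_ex_pr HV); [dfun_tac|]. apply D0_ex; [dfun_tac|].
    apply D0_and.
    + apply (D0_ex_pr HV); [dfun_tac|]. apply D0_and; [d0|]. apply D0_is_child; dfun_tac.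
    + apply D0_all; [dfun_tac|]. apply D0_not. apply D0_ex; [dfun_tac|].
      apply (D0_ex_pr HV); [dfun_tac|]. apply D0_and; [d0|]. apply D0_is_child; dfun_tac.
  - intros _ _; exists (pr emp emp); auto.
  - intros; subst; reflexivity.
  - intros a k z _ _ Hz. pose proof Hz as Hz'.
    apply (in_comp HV) in Hz; [|d0]. destruct Hz as (_ & n & s & -> & Hn & Hs & Hns).
    destruct (not_wf_node_step n s Hn Hs Hns) as [_ [m [Hm Hw]]].
    assert (Hcd : forall j, j ∈ om -> child n j s ∈ d).
    { intros j Hj; apply (kp_cup HV _ Kd); [exact Hs|].
      apply (kp_sing HV _ Kd), (kp_pr HV _ Kd); eauto. }
    destruct (om_least HV (fun m => exists q, q ∈ Z /\ exists n' s', q = pr n' s' /\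
       (n' = succ n /\ s' = child n m s)) m) as (m0 & Hm0 & (q & Hq & n' & s' & -> & -> & ->) & Hmin).
    + apply D0_ex; [dfun_tac|]. apply (D0_ex_pr HV); [dfun_tac|].
      apply D0_and; [d0|]. apply D0_is_child; dfun_tac.
    + exact Hm.
    + exists (pr (succ n) (child n m s)); split; [apply in_Z; auto|].
      exists (succ n), (child n m s); auto.
    + exists (pr (succ n) (child n m0 s)); split; [exact Hq|].
      exists n, s; split; [reflexivity|]. exists m0; repeat split; auto.
      exists (succ n), (child n m0 s); auto.
  - intros a k z y y' _ _ _ Hy Hy' (n & s & -> & m & Hm & (n1 & s1 & -> & -> & ->) & Hmin)
      (n' & s' & E & m' & Hm' & (n2 & s2 & -> & -> & ->) & Hmin').
    apply (pr_inj HV) in E; destruct E as [<- <-].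
    destruct (om_trichotomy HV m m' Hm Hm') as [H|[->|H]].
    + destruct (Hmin' m H). exists (pr (succ n) (child n m s)); split; [exact Hy|].
      exists (succ n), (child n m s); auto.
    + reflexivity.
    + destruct (Hmin m' H). exists (pr (succ n) (child n m' s)); split; [exact Hy'|].
      exists (succ n), (child n m' s); auto.
  - pose proof (proj2 (in_succ HV emp _) (or_intror eq_refl)) as H1.
    assert (HnodeZ : forall n s, node f n s -> n ∈ om /\ s ∈ d /\ ~ wf_node n s).
    { intros n s Hns. destruct (Hf1 _ Hns) as (a & n' & z & E & _ & Hz).
      apply (tri_inj HV) in E; destruct E as (_ & _ & <-). apply in_Z in Hz; exact Hz. }
    exists f; repeat split; try (intros; eapply HnodeZ; eassumption).
    + destruct (Htot emp H1 emp Hemp) as [z [Hz H]].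
      rewrite (Hf0 emp H1 z Hz H) in H; exact H.
    + intros n s Hns. destruct (HnodeZ n s Hns) as [Hn Hs].
      destruct (Htot emp H1 (succ n) (Hsucc n Hn)) as [z [Hz H]].
      assert (HZ : pr n s ∈ Z) by (apply in_Z; auto).
      destruct (HfS emp H1 n Hn (succ n) (Hsucc n Hn) _ HZ z Hz eq_refl Hns H)
        as (n' & s' & E & m & Hm & (n1 & s1 & -> & -> & ->) & _).
      apply (pr_inj HV) in E; destruct E as [<- <-]. exists m; auto.
    + intros n s s' Hs Hs'. destruct (HnodeZ n s Hs) as [Hn Hs0].
      apply (pr_inj HV n s n s'). destruct (HnodeZ n s' Hs') as [_ Hs0'].
      apply (Hfun emp H1 n Hn); auto; apply in_Z; auto.
Qed.

Theorem path_of_not_wf : ~ wf K d -> exists F, is_seq F /\ obeys K F.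
Proof.
  intros H0. destruct (path_ex H0) as (f & Hf0 & Hf1 & HfS & Hfun).
  assert (HnD0 : D0 all_sets (fun r => node f (r 0) (r 1))).
  { unfold node. apply (D0_ext _ _ (fun r => exists q, q ∈ f /\ exists e n z, q = tri e n z /\
      ((e = emp /\ n = r 0) /\ exists n' s', z = pr n' s' /\ (n' = r 0 /\ s' = r 1)))).
    - intros r; split.
      + intros H; exists (tri emp (r 0) (pr (r 0) (r 1))); split; [exact H|].
        exists emp, (r 0), (pr (r 0) (r 1)); repeat split; auto. exists (r 0), (r 1); auto.
      + intros (q & Hq & e & n & z & -> & [-> ->] & n' & s' & -> & -> & ->); exact Hq.
    - d0. }
  (* The induction hypothesis says that the node at level [n] is a function from [n] to [om]
     extending all nodes at lower levels. Nodes are quantified inside [d] to keep it Delta_0. *)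
  assert (Hnode : forall n, n ∈ om -> exists s, s ∈ d /\ (node f n s /\
    ((forall q, q ∈ s -> exists k m, q = pr k m /\ (k ∈ n /\ m ∈ om)) /\
     (forall k, k ∈ om -> forall m, m ∈ om -> forall m', m' ∈ om ->
        pr k m ∈ s -> pr k m' ∈ s -> m = m')) /\
     (forall k, k ∈ n -> exists t, t ∈ d /\ (node f k t /\
       ((forall q, q ∈ t -> q ∈ s) /\ exists m, m ∈ om /\ pr k m ∈ s))))).
  { apply (om_ind HV (fun n => exists s, s ∈ d /\ (node f n s /\
    ((forall q, q ∈ s -> exists k m, q = pr k m /\ (k ∈ n /\ m ∈ om)) /\
     (forall k, k ∈ om -> forall m, m ∈ om -> forall m', m' ∈ om ->
        pr k m ∈ s -> pr k m' ∈ s -> m = m')) /\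
     (forall k, k ∈ n -> exists t, t ∈ d /\ (node f k t /\
       ((forall q, q ∈ t -> q ∈ s) /\ exists m, m ∈ om /\ pr k m ∈ s)))))); [d0| |].
    - exists emp; split; [apply (kp_emp HV _ Kd)|]. split; [exact Hf0|].
      repeat split; intros x Hx; try (destruct (in_emp HV x Hx)).
      intros m _ m' _ Hp; destruct (in_emp HV _ Hp).
    - intros n Hn (s & Hs & Hns & [Hs1 Hs2] & Hs3).
      destruct (HfS n s Hns) as [m [Hm Hc]]. exists (child n m s).
      assert (Hnot : forall y, ~ pr n y ∈ s).
      { intros y Hy; destruct (Hs1 _ Hy) as (k & y' & E & Hk & _).
        apply (pr_inj HV) in E; destruct E as [<- _]; exact (mem_irrefl HV n Hk). }
      split; [apply (Hf1 _ _ Hc)|]. split; [exact Hc|]. split; [split|].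
      + intros q Hq; apply in_child in Hq; destruct Hq as [Hq| ->].
        * destruct (Hs1 q Hq) as (k & y & -> & Hk & Hy). exists k, y; repeat split; auto.
          apply (in_succ HV); auto.
        * exists n, m; repeat split; auto. apply (in_succ HV); auto.
      + intros k Hk y Hy y' Hy' H H'. apply in_child in H, H'.
        destruct H as [H|H], H' as [H'|H'].
        * apply (Hs2 k); auto.
        * apply (pr_inj HV) in H'; destruct H' as [-> _]; destruct (Hnot _ H).
        * apply (pr_inj HV) in H; destruct H as [-> _]; destruct (Hnot _ H').
        * apply (pr_inj HV) in H, H'; destruct H, H'; congruence.
      + intros k Hk; apply (in_succ HV) in Hk; destruct Hk as [Hk| ->].
        * destruct (Hs3 k Hk) as (t & Ht & Hkt & Hts & y & Hy & Hky).
          exists t; repeat split; auto; [intros; apply in_child; auto|].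
          exists y; split; [exact Hy|]. apply in_child; auto.
        * exists s; repeat split; auto; [intros; apply in_child; auto|].
          exists m; split; [exact Hm|]. apply in_child; auto. }
  set (F := comp d (fun q => exists n, n ∈ om /\ exists s, s ∈ d /\ (node f n s /\ q ∈ s))).
  assert (HF : forall q, q ∈ F <-> exists n s, node f n s /\ q ∈ s).
  { intros q; unfold F; rewrite (in_comp HV) by d0. split.
    - intros (_ & n & _ & s & _ & H); eauto.
    - intros (n & s & H & Hq). destruct (Hf1 n s H) as (Hn & Hs & _).
      split; [eauto|]. exists n; split; [exact Hn|]. exists s; auto. }
  (* A pair of [F] belongs to all later nodes, so any three pairs occur together in one node. There
     functionality and the constraint can be checked. *)
  assert (Hstage : forall q, q ∈ F -> exists n, n ∈ om /\
    forall n' s', n' ∈ om -> n ∈ n' -> node f n' s' -> q ∈ s').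
  { intros q Hq; apply HF in Hq; destruct Hq as (n & s & Hns & Hq).
    exists n; split; [apply (Hf1 n s Hns)|]. intros n' s' Hn' Hnn' Hs'.
    destruct (Hnode n' Hn') as (s1 & _ & Hs1 & _ & H3).
    rewrite (Hfun _ _ _ Hs' Hs1). destruct (H3 n Hnn') as (t & _ & Ht & Hts & _).
    rewrite (Hfun _ _ _ Hns Ht) in Hq; auto. }
  exists F; split; [split|].
  - intros n Hn. destruct (Hnode (succ n) (Hsucc n Hn)) as (s & _ & Hs & _ & H3).
    destruct (H3 n) as (t & _ & _ & _ & m & Hm & H); [apply (in_succ HV); auto|].
    exists m; split; [exact Hm|]. apply HF; eauto.
  - intros n Hn m Hm m' Hm' H H'.
    destruct (Hstage _ H) as [k [Hk Hk']], (Hstage _ H') as [l [Hl Hl']].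
    destruct (om_bound2 HV k l Hk Hl) as (j & Hj & Hkj & Hlj).
    destruct (Hnode j Hj) as (s & _ & Hs & [_ H2] & _).
    apply (H2 n Hn m Hm m' Hm'); eauto.
  - intros p1 Hp1 y1 Hy1 p2 Hp2 y2 Hy2 p3 Hp3 y3 Hy3 H1 H2 H3.
    destruct (Hstage _ H1) as [k1 [Hk1 Hk1']], (Hstage _ H2) as [k2 [Hk2 Hk2']],
      (Hstage _ H3) as [k3 [Hk3 Hk3']].
    destruct (om_bound2 HV k1 k2 Hk1 Hk2) as (j & Hj & Hj1 & Hj2).
    destruct (om_bound2 HV j k3 Hj Hk3) as (i & Hi & Hij & Hi3).
    destruct (Hnode i Hi) as (s & Hsd & Hs & _).
    destruct (Hf1 i s Hs) as (_ & _ & Hnw).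
    destruct (not_wf_node_step i s Hi Hsd Hnw) as [Hob _].
    pose proof (om_elem_trans HV) as Helt. apply Hob; eauto.
Qed.

End Paths.

End Trees.

(** * Arithmetical truth *)

Section Coding.
Context {V : structure} (HV : model V ST.KPlr_M).
Notation all_sets := (fun _ : dom V => True).
Let Hemp : emp ∈ om := emp_om HV.
Let Hsucc : forall n, n ∈ om -> succ n ∈ om := succ_om HV.

(* The value is [0] if [n] is not in omega. *)
Definition pick (R : dom V -> dom V -> Prop) (n : dom V) : dom V :=
  epsilon (inhabits (stable V)) (fun z => z ∈ om /\ (R n z \/ (~ n ∈ om /\ z = emp))).

Lemma pick_eq (R : dom V -> dom V -> Prop) n z :
  (n ∈ om -> exists z, z ∈ om /\ R n z) -> (forall z z', R n z -> R n z' -> z = z') ->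
  (forall z, R n z -> n ∈ om) ->
  z = pick R n <-> z ∈ om /\ (R n z \/ (~ n ∈ om /\ z = emp)).
Proof.
  intros Htot Hfun Hdom.
  set (Q := fun z => z ∈ om /\ (R n z \/ (~ n ∈ om /\ z = emp))).
  assert (Hex : exists z, Q z).
  { destruct (classic (n ∈ om)) as [Hn|Hn].
    - destruct (Htot Hn) as (a & Ha & H). exists a; split; auto.
    - exists emp; split; auto. }
  pose proof (epsilon_spec (inhabits (stable V)) Q Hex) as Hq.
  change (z = epsilon (inhabits (stable V)) Q <-> Q z). split; [intros ->; exact Hq|].
  intros [Hz H]; destruct Hq as [_ H'].
  destruct H as [H|[H ->]], H' as [H'|[H' ->]]; auto.
  - destruct (H' (Hdom _ H)).
  - destruct (H (Hdom _ H')).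
Qed.

Definition hd : dom V -> dom V := pick (fun n z => exists b, b ∈ om /\ enumerates n z b).

Definition tl : dom V -> dom V := pick (fun n z => exists b, b ∈ om /\ enumerates n b z).

Lemma hd_eq n z : z = hd n <-> z ∈ om /\
  ((exists b, b ∈ om /\ enumerates n z b) \/ (~ n ∈ om /\ z = emp)).
Proof.
  apply (pick_eq (fun n z => exists b, b ∈ om /\ enumerates n z b)).
  - intros Hn; destruct (enum_total HV n Hn) as (a & b & Ha & Hb & H); eauto.
  - intros y y' [b [_ H]] [b' [_ H']]; apply (enum_functional HV _ _ _ _ _ H H').
  - intros y [b [_ H]]; apply (enum_om HV _ _ _ H).
Qed.

Lemma tl_eq n z : z = tl n <-> z ∈ om /\
  ((exists b, b ∈ om /\ enumerates n b z) \/ (~ n ∈ om /\ z = emp)).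
Proof.
  apply (pick_eq (fun n z => exists b, b ∈ om /\ enumerates n b z)).
  - intros Hn; destruct (enum_total HV n Hn) as (a & b & Ha & Hb & H); eauto.
  - intros y y' [b [_ H]] [b' [_ H']]; apply (enum_functional HV _ _ _ _ _ H H').
  - intros y [b [_ H]]; apply (enum_om HV _ _ _ H).
Qed.

Lemma hd_om n : hd n ∈ om.
Proof. apply (proj1 (hd_eq n _) eq_refl). Qed.

Lemma tl_om n : tl n ∈ om.
Proof. apply (proj1 (tl_eq n _) eq_refl). Qed.

Lemma cons_ex a b : a ∈ om -> b ∈ om -> exists c, c ∈ om /\ hd c = a /\ tl c = b.
Proof.
  intros Ha Hb. destruct (enum_surjective HV a b Ha Hb) as (n & Hn & H).
  exists n; repeat split; auto; symmetry; [apply hd_eq|apply tl_eq]; eauto.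
Qed.

(** One number codes an assignment to all number variables by iterated pairing. The index [j] is
    standard, so the projections are iterated in the metatheory; [dec_ex] prescribes finitely many
    places. *)
Fixpoint dec (c : dom V) (j : nat) : dom V :=
  match j with 0 => hd c | S j => dec (tl c) j end.

Lemma dec_om c j : dec c j ∈ om.
Proof. revert c; induction j as [|j IH]; intros c; [apply hd_om|apply IH]. Qed.

Lemma dec_cons c : dec c = hd c .: dec (tl c).
Proof. apply functional_extensionality; intros [|j]; reflexivity. Qed.

Lemma dec_ex k : forall e, (forall j, e j ∈ om) ->
  exists c, c ∈ om /\ forall j, j < k -> dec c j = e j.
Proof.
  induction k as [|k IH]; intros e He.
  - exists emp; split; [exact Hemp|lia].
  - destruct (IH (fun j => e (S j)) (fun j => He (S j))) as (c & Hc & H).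
    destruct (cons_ex (e 0) c (He 0) Hc) as (c' & Hc' & H1 & H2).
    exists c'; split; [exact Hc'|]. intros [|j] Hj; simpl; [exact H1|].
    rewrite H2; apply H; lia.
Qed.

Fixpoint num (i : nat) : dom V := match i with 0 => emp | S i => succ (num i) end.

Lemma num_om i : num i ∈ om.
Proof. induction i; simpl; auto. Qed.

Lemma num_inj i : forall j, num i = num j -> i = j.
Proof.
  induction i as [|i IH]; intros [|j] H; simpl in H; auto.
  - destruct (succ_neq_emp HV (num j)); auto.
  - destruct (succ_neq_emp HV (num i)); auto.
  - f_equal; apply IH, (succ_inj HV); auto using num_om.
Qed.

Fixpoint tval (e : nat -> dom V) (t : SOA.term) : dom V :=
  match t with
  | SOA.nvar n => e n
  | SOA.zero => emp
  | SOA.one => succ emp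
  | SOA.add t u => add (tval e t) (tval e u)
  | SOA.mul t u => mul (tval e t) (tval e u)
  end.

Definition sub_om (X : dom V) : Prop := forall x, x ∈ X -> x ∈ om.

(** Truth is defined in the metatheory by recursion on formulas. Inside the model each arithmetical
    formula gets its own Delta_0 definition by [D0_ssat], which is enough for the schemata. *)
Fixpoint ssat (e g : nat -> dom V) (A : SOA.form) : Prop :=
  match A with
  | SOA.Eq t u => tval e t = tval e u
  | SOA.Lt t u => tval e t ∈ tval e u
  | SOA.In t X => tval e t ∈ g X
  | SOA.Bot => False
  | SOA.Imp A B => ssat e g A -> ssat e g B
  | SOA.All1 A => forall n, n ∈ om -> ssat (n .: e) g A
  | SOA.All2 A => forall X, sub_om X -> ssat e (X .: g) A
  end.

Lemma tval_om e t : (forall n, e n ∈ om) -> tval e t ∈ om.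
Proof.
  intros He; induction t; simpl; auto; [apply (add_om HV)|apply (mul_om HV)].
Qed.

Lemma tval_ext_bounded k e e' t : SOA.tbounded k t ->
  (forall n, n < k -> e n = e' n) -> tval e t = tval e' t.
Proof.
  induction t; simpl; intros Hb He; auto; destruct Hb; rewrite IHt1, IHt2; auto.
Qed.

Lemma ssat_ext_bounded A : forall k l e e' g g',
  SOA.bounded1 k A -> SOA.bounded2 l A ->
  (forall n, n < k -> e n = e' n) -> (forall n, n < l -> g n = g' n) ->
  ssat e g A <-> ssat e' g' A.
Proof.
  induction A as [t u|t u|t X| |A IHA B IHB|A IHA|A IHA];
    intros k l e e' g g' H1 H2 He Hg; simpl in *.
  1,2: rewrite (tval_ext_bounded k e e' t), (tval_ext_bounded k e e' u); tauto.
  - rewrite (tval_ext_bounded k e e' t), Hg; tauto.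
  - tauto.
  - rewrite (IHA k l e e' g g'), (IHB k l e e' g g'); tauto.
  - assert (H : forall n, ssat (n .: e) g A <-> ssat (n .: e') g' A).
    { intros n; apply (IHA (S k) l); auto.
      intros [|m] Hm; simpl; [reflexivity|apply He; lia]. }
    setoid_rewrite H; reflexivity.
  - assert (H : forall X, ssat e (X .: g) A <-> ssat e' (X .: g') A).
    { intros X; apply (IHA k (S l)); auto.
      intros [|m] Hm; simpl; [reflexivity|apply Hg; lia]. }
    setoid_rewrite H; reflexivity.
Qed.

(** The parameters needed to define arithmetic and pairing; the universe, [M] and suitable
    admissible sets contain them. *)
Record has_arith (C : dom V -> Prop) : Prop := {
  ha_om : C om; ha_ad : C ad; ha_mu : C mu; ha_pg : C pg; ha_sq : C omsq;
  ha_n : forall n, n ∈ om -> C n }.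

Section DefinableSatisfaction.
Context (C : dom V -> Prop) (HC : has_arith C).
Let HCom : C om := ha_om C HC.
Let HCn : forall n, n ∈ om -> C n := ha_n C HC.
Let HCemp : C emp := HCn _ Hemp.

Lemma dfun_hd t : dfun C t -> dfun C (fun r => hd (t r)).
Proof.
  intros Ht. apply (dfun_graph C _ (fun _ => om)); [dfun_tac|intros; apply hd_om|].
  apply (D0_app2 C (fun z n => z = hd n) (fun r => r 0) (fun r => t (fun n => r (S n)))).
  - eapply D0_ext; [intros r; apply hd_eq|]. apply D0_and; [d0|]. apply D0_or; [|d0].
    apply D0_ex; [dfun_tac|]. apply (D0_enumerates HV); try apply HC; dfun_tac.
  - dfun_tac.
  - exact (dfun_reindex C t S Ht).
Qed.

Lemma dfun_tl t : dfun C t -> dfun C (fun r => tl (t r)).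
Proof.
  intros Ht. apply (dfun_graph C _ (fun _ => om)); [dfun_tac|intros; apply tl_om|].
  apply (D0_app2 C (fun z n => z = tl n) (fun r => r 0) (fun r => t (fun n => r (S n)))).
  - eapply D0_ext; [intros r; apply tl_eq|]. apply D0_and; [d0|]. apply D0_or; [|d0].
    apply D0_ex; [dfun_tac|]. apply (D0_enumerates HV); try apply HC; dfun_tac.
  - dfun_tac.
  - exact (dfun_reindex C t S Ht).
Qed.

Lemma dfun_dec t j : dfun C t -> dfun C (fun r => dec (t r) j).
Proof.
  revert t; induction j as [|j IH]; intros t Ht; simpl; [apply dfun_hd, Ht|].
  apply (IH (fun r => tl (t r))), dfun_tl, Ht.
Qed.

Lemma dfun_tval (e : (nat -> dom V) -> nat -> dom V) t :
  (forall j, dfun C (fun r => e r j)) -> dfun C (fun r => tval (e r) t).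
Proof.
  intros He; induction t; simpl; auto.
  - apply dfun_const, HCn, Hemp.
  - apply dfun_const, HCn; auto.
  - apply (dfun_ap HV _ ad om); auto; [apply (ad_ok HV)|apply HC].
  - apply (dfun_ap HV _ mu om); auto; [apply (mu_ok HV)|apply HC].
Qed.

Lemma D0_ssat A : SOA.arithmetical A -> forall e g : (nat -> dom V) -> nat -> dom V,
  (forall j, dfun C (fun r => e r j)) -> (forall j, dfun C (fun r => g r j)) ->
  D0 C (fun r => ssat (e r) (g r) A).
Proof.
  induction A as [t u|t u|t X| |A IHA B IHB|A IHA|A IHA]; simpl; intros HA e g He Hg.
  - apply D0_eq; apply dfun_tval; exact He.
  - apply D0_mem; apply dfun_tval; exact He.
  - apply D0_mem; [apply dfun_tval; exact He|apply Hg].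
  - apply D0_const.
  - apply D0_imp; [apply IHA|apply IHB]; tauto.
  - apply (D0_all C (fun n r => ssat (n .: e r) (g r) A)); [dfun_tac|].
    apply (IHA HA (fun r => r 0 .: e (fun n => r (S n))) (fun r => g (fun n => r (S n)))).
    + intros [|j]; simpl; [dfun_tac|]. exact (dfun_reindex C _ S (He j)).
    + intros j; exact (dfun_reindex C _ S (Hg j)).
  - destruct HA.
Qed.

End DefinableSatisfaction.

End Coding.

(** * Comprehension *)

Ltac dfun_user ::= first
  [ simple apply dfun_hd; [eassumption | eassumption | dfun_tac]
  | simple apply dfun_tl; [eassumption | eassumption | dfun_tac] ].

Section Comprehension.
Context {V : structure} (HV : model V ST.KPlr_M).
Notation all_sets := (fun _ : dom V => True).
Notation M := (stable V).
Let Hemp : emp ∈ om := emp_om HV.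
Let Hsucc : forall n, n ∈ om -> succ n ∈ om := succ_om HV.

Definition xvar : SOA.form := SOA.In (SOA.nvar 0) 0.

Fixpoint subforms (A : SOA.form) : list SOA.form :=
  A :: match A with
       | SOA.Imp B C => subforms B ++ subforms C
       | SOA.All1 B => subforms B
       | _ => nil
       end.

Definition closed_list (L : list SOA.form) : Prop :=
  (forall B C, In (SOA.Imp B C) L -> In B L /\ In C L) /\
  (forall B, In (SOA.All1 B) L -> In B L).

Lemma subforms_self A : In A (subforms A).
Proof. destruct A; left; reflexivity. Qed.

Lemma closed_subforms A : closed_list (subforms A).
Proof.
  induction A as [t u|t u|t X| |A IHA B IHB|A IHA|A IHA]; simpl;
    try (split; [intros B' C' [H|[]]; discriminate|intros B' [H|[]]; discriminate]).
  - destruct IHA as [IHA1 IHA2], IHB as [IHB1 IHB2]. split.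
    + intros B' C' [H|H]; simpl; rewrite !in_app_iff.
      * injection H as -> ->. auto using subforms_self.
      * apply in_app_iff in H; destruct H as [H|H]; [apply IHA1 in H|apply IHB1 in H]; tauto.
    + intros B' [H|H]; simpl; rewrite !in_app_iff; [discriminate|].
      apply in_app_iff in H; destruct H as [H|H]; auto.
  - destruct IHA as [IHA1 IHA2]. split.
    + intros B' C' [H|H]; [discriminate|]. apply IHA1 in H; simpl; tauto.
    + intros B' [H|H]; simpl; [injection H as ->; auto using subforms_self|auto].
Qed.

Lemma arithmetical_subforms A : SOA.arithmetical A ->
  forall B, In B (subforms A) -> SOA.arithmetical B.
Proof.
  induction A as [t u|t u|t X| |A IHA B IHB|A IHA|A IHA]; simpl; intros HA C [<-|H];
    simpl; auto; try contradiction.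
  apply in_app_iff in H; destruct H; [apply IHA|apply IHB]; tauto.
Qed.

(** [xvar] need not be a subformula of [A]; at index 0 it makes the sequence record the set that
    interprets set variable 0. *)
Definition table (A : SOA.form) : list SOA.form := xvar :: subforms A.

Lemma closed_table A : closed_list (table A).
Proof.
  destruct (closed_subforms A) as [H1 H2]. split.
  - intros B C [H|H]; [discriminate|]. apply H1 in H; simpl; tauto.
  - intros B [H|H]; [discriminate|]. apply H2 in H; simpl; tauto.
Qed.

Notation entry A i := (nth i (table A) SOA.Bot).

Lemma arithmetical_entry A i : SOA.arithmetical A -> SOA.arithmetical (entry A i).
Proof.
  intros HA. destruct (nth_in_or_default i (table A) SOA.Bot) as [[<-|H]| ->].
  - exact I.
  - apply (arithmetical_subforms A HA _ H).
  - exact I.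
Qed.

(* A sequence [F] assigns the value [y = F(p)] to the code [p] of a pair [(i, c)], where
   [i] is the index of a subformula [B] of [A] and [c] codes an assignment to its number
   variables.  Value [0] means that [B] holds; value [w + 1] that it fails and, if [B]
   starts with a universal quantifier, that it fails at [w].  [rule] lists the local
   constraints; the set variable 0 is read off from the values of [xvar]. *)
Definition rule (g : nat -> dom V) (B1 B2 B3 : SOA.form) (c1 y1 c2 y2 c3 y3 : dom V) : Prop :=
  match B1 with
  | SOA.Imp B C => B2 = B -> B3 = C -> c2 = c1 -> c3 = c1 ->
      (y1 = emp <-> (y2 = emp -> y3 = emp))
  | SOA.All1 B => B2 = B -> tl c2 = c1 ->
      (y1 = emp -> y2 = emp) /\ (y1 = succ (hd c2) -> ~ y2 = emp)
  | SOA.In t 0 => B2 = xvar -> hd c2 = tval (dec c1) t -> (y1 = emp <-> y2 = emp)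
  | SOA.All2 _ => True
  | _ => y1 = emp <-> ssat (dec c1) (emp .: g) B1
  end.

(** The first clause demands that [A] be true at [x .: dec ce], the second that the local rules
    hold. Three positions are compared because an implication depends on its two parts. Indices are
    standard, so the conjunctions are finite. *)
Definition constraint (A : SOA.form) (x ce : dom V) (g : nat -> dom V)
    (p1 y1 p2 y2 p3 y3 : dom V) : Prop :=
  (forall i, i < length (table A) -> entry A i = A ->
     hd p1 = num i -> hd (tl p1) = x -> tl (tl p1) = ce -> y1 = emp) /\
  (forall i, i < length (table A) -> forall j, j < length (table A) ->
   forall k, k < length (table A) -> hd p1 = num i -> hd p2 = num j -> hd p3 = num k ->
     rule g (entry A i) (entry A j) (entry A k) (tl p1) y1 (tl p2) y2 (tl p3) y3).

Lemma D0_constraint C (HC : has_arith C) A (x ce : (nat -> dom V) -> dom V)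
    (g : (nat -> dom V) -> nat -> dom V) :
  SOA.arithmetical A -> dfun C x -> dfun C ce -> (forall j, dfun C (fun r => g r j)) ->
  D0 C (fun r => constraint A (x r) (ce r) (g r) (r 0) (r 1) (r 2) (r 3) (r 4) (r 5)).
Proof.
  intros HA Hx Hce Hg.
  assert (HCn : forall n, n ∈ om -> C n) by apply HC.
  assert (HCe : C emp) by (apply HCn, Hemp).
  assert (HCnum : forall i, C (num i)) by (intros i; apply HCn, (num_om HV)).
  assert (HCom : C om) by apply HC.
  assert (Hdec : forall k j, dfun C (fun r => dec (tl (r k)) j)).
  { intros k j. apply (dfun_dec HV C HC (fun r => tl (r k))). dfun_tac. }
  apply D0_and.
  - apply D0_forall_nat; intros i _. d0.
  - apply D0_forall_nat; intros i _. apply D0_forall_nat; intros j _.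
    apply D0_forall_nat; intros k _. do 3 (apply D0_imp; [d0|]).
    pose proof (arithmetical_entry A i HA) as HB.
    destruct (entry A i) as [t u|t u|t [|X]| |B B'|B|B]; cbn [rule];
      try (apply D0_iff; [d0|]; apply (D0_ssat HV C HC); auto;
           intros [|j']; simpl; [dfun_tac|apply Hg]).
    + apply D0_imp; [d0|]. apply D0_imp; [|d0].
      apply D0_eq; [dfun_tac|apply (dfun_tval HV C HC); auto].
    + d0.
    + d0.
    + d0.
Qed.

Lemma has_arith_all : has_arith all_sets.
Proof. split; auto. Qed.

Lemma has_arith_stable : has_arith (elt M).
Proof.
  split; [apply (om_stable HV)|apply (ad_ok HV)|apply (mu_ok HV)|apply (pg_ok HV)
    |apply (omsq_ok HV)|apply (om_elt_stable HV)].
Qed.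

(** The intended values of a sequence. Several [y] may qualify, and every [y] does if [hd p] is not
    the index of an entry, so a later choice of the least one is needed. *)
Definition truth_value (A : SOA.form) (g : nat -> dom V) (p y : dom V) : Prop :=
  forall i, i < length (table A) -> hd p = num i ->
    (y = emp <-> ssat (dec (tl p)) g (entry A i)) /\
    match entry A i with
    | SOA.All1 B => forall w, w ∈ om -> y = succ w -> ~ ssat (w .: dec (tl p)) g B
    | _ => True
    end.

Lemma D0_truth_value A g : SOA.arithmetical A ->
  D0 all_sets (fun r => truth_value A g (r 0) (r 1)).
Proof.
  intros HA; pose proof has_arith_all as HC.
  assert (Hdec : forall k j, dfun all_sets (fun r => dec (tl (r k)) j)).
  { intros k j. apply (dfun_dec HV _ HC (fun r => tl (r k))). dfun_tac. }
  apply D0_forall_nat; intros i _. apply D0_imp; [d0|].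
  pose proof (arithmetical_entry A i HA) as HB.
  apply D0_and; [apply D0_iff; [d0|]; apply (D0_ssat HV _ HC); auto; intros; dfun_tac|].
  destruct (entry A i) as [t u|t u|t X| |B B'|B|B]; try apply D0_const.
  apply D0_all; [dfun_tac|]. apply D0_imp; [d0|]. apply D0_not.
  apply (D0_ssat HV _ HC B HB (fun r => r 0 .: dec (tl (r 1))) (fun _ => g)).
  - intros [|j]; simpl; [dfun_tac|apply Hdec].
  - intros; dfun_tac.
Qed.

Lemma truth_value_ex A g p : SOA.arithmetical A ->
  exists y, y ∈ om /\ truth_value A g p y.
Proof.
  intros HA.
  destruct (classic (exists i, i < length (table A) /\ hd p = num i)) as [[i [Hi Hp]]|Hno].
  - assert (H : exists y, y ∈ om /\ (y = emp <-> ssat (dec (tl p)) g (entry A i)) /\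
      match entry A i with
      | SOA.All1 B => forall w, w ∈ om -> y = succ w -> ~ ssat (w .: dec (tl p)) g B
      | _ => True
      end).
    { destruct (classic (ssat (dec (tl p)) g (entry A i))) as [H|H].
      - exists emp; split; [exact Hemp|]. split; [tauto|].
        destruct (entry A i); auto. intros w _ Hw; symmetry in Hw.
        destruct (succ_neq_emp HV _ Hw).
      - assert (H' : exists w, w ∈ om /\ match entry A i with
          | SOA.All1 B => ~ ssat (w .: dec (tl p)) g B | _ => True end).
        { destruct (entry A i); try (exists emp; auto; fail). apply NNPP; intros Hn.
          apply H; intros w Hw; apply NNPP; intros Hnw; apply Hn; eauto. }
        destruct H' as [w [Hw H']]. exists (succ w); split; [auto|]. split.
        + split; [intros E; destruct (succ_neq_emp HV _ E)|tauto].
        + destruct (entry A i); auto. intros w' Hw' E.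
          apply (succ_inj HV) in E; subst; auto. }
    destruct H as (y & Hy & H). exists y; split; [exact Hy|].
    intros j Hj Hpj. rewrite Hp in Hpj. apply (num_inj HV) in Hpj; subst j; exact H.
  - exists emp; split; [exact Hemp|]. intros i Hi Hp; destruct Hno; eauto.
Qed.

(* Least values make the choice of the sequence definable. *)
Lemma truth_sequence A g : SOA.arithmetical A ->
  exists F, is_seq F /\ forall p y, pr p y ∈ F -> truth_value A g p y.
Proof.
  intros HA. destruct (limit HV om) as [d [Hd Hom]].
  pose proof (D0_truth_value A g HA) as HT.
  set (Q := fun p y => (p ∈ om /\ y ∈ om) /\ (truth_value A g p y /\
    forall y', y' ∈ y -> ~ truth_value A g p y')).
  set (F := comp d (fun q => exists p y, q = pr p y /\ Q p y)).
  assert (HF : forall p y, pr p y ∈ F <-> Q p y).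
  { intros p y; unfold F; rewrite (in_comp HV) by (unfold Q; d0). split.
    - intros (_ & p' & y' & E & H). apply (pr_inj HV) in E; destruct E as [-> ->]; exact H.
    - intros H; split; [|eauto]. destruct H as [[Hp Hy] _].
      apply (kp_pr HV _ (kp_adm HV d Hd)); apply (adm_tran HV d _ om); assumption. }
  exists F; split; [split|].
  - intros p Hp. destruct (truth_value_ex A g p HA) as (y & Hy & H).
    destruct (om_least HV (truth_value A g p) y) as (m & Hm & Hv & Hmin); auto.
    { d0. }
    exists m; split; [exact Hm|]. apply HF; split; auto.
  - intros p Hp y Hy y' Hy' H H'. apply HF in H, H'.
    destruct H as (_ & Hv & Hmin), H' as (_ & Hv' & Hmin').
    destruct (om_trichotomy HV y y' Hy Hy') as [H|[H|H]]; [|exact H|].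
    + destruct (Hmin' _ H Hv).
    + destruct (Hmin _ H Hv').
  - intros p y H; apply HF in H; apply H.
Qed.

Lemma truth_sequence_obeys A x ce X g F : SOA.arithmetical A ->
  ssat (x .: dec ce) (X .: g) A ->
  (forall p y, pr p y ∈ F -> truth_value A (X .: g) p y) ->
  obeys (constraint A x ce g) F.
Proof.
  intros HA Hsat HF p1 _ y1 _ p2 _ y2 _ p3 _ y3 _ H1 H2 H3.
  apply HF in H1, H2, H3. split.
  - intros i Hi HiA Hp Hx Hce. destruct (H1 i Hi Hp) as [H _].
    rewrite HiA, dec_cons, Hx, Hce in H. tauto.
  - intros i Hi j Hj k Hk Hpi Hpj Hpk.
    destruct (H1 i Hi Hpi) as [H1a H1b], (H2 j Hj Hpj) as [H2a _],
      (H3 k Hk Hpk) as [H3a _].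
    destruct (entry A i) as [t u|t u|t [|Y]| |B B'|B|B]; simpl in *; auto.
    + intros HB Hhd; rewrite HB in H2a; simpl in H2a. rewrite Hhd in H2a. tauto.
    + intros HB HB' Hc2 Hc3. rewrite HB, Hc2 in H2a. rewrite HB', Hc3 in H3a. tauto.
    + intros HB Hc2. rewrite HB, dec_cons, Hc2 in H2a. split.
      * intros Hy1. apply H2a, H1a; [exact Hy1|apply (hd_om HV)].
      * intros Hy1 Hy2. apply (H1b _ (hd_om HV _) Hy1), H2a, Hy2.
Qed.

(** * Recovering a set from a sequence that obeys the constraint *)

Section FromSequence.
Context (A : SOA.form) (x ce : dom V) (g : nat -> dom V) (F : dom V).
Context (HA : SOA.arithmetical A) (HF : is_seq F) (Hob : obeys (constraint A x ce g) F).

Lemma entry_ex B : In B (table A) -> exists i, i < length (table A) /\ entry A i = B.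
Proof. intros H; exact (In_nth _ _ SOA.Bot H). Qed.

Lemma position_ex i c : c ∈ om ->
  exists p y, p ∈ om /\ y ∈ om /\ hd p = num i /\ tl p = c /\ pr p y ∈ F.
Proof.
  intros Hc. destruct (cons_ex HV (num i) c (num_om HV i) Hc) as (p & Hp & H1 & H2).
  destruct (proj1 HF p Hp) as [y [Hy H]]. exists p, y; auto.
Qed.

Lemma sequence_rule i j k p1 y1 p2 y2 p3 y3 :
  i < length (table A) -> j < length (table A) -> k < length (table A) ->
  p1 ∈ om -> y1 ∈ om -> p2 ∈ om -> y2 ∈ om -> p3 ∈ om -> y3 ∈ om ->
  hd p1 = num i -> hd p2 = num j -> hd p3 = num k ->
  pr p1 y1 ∈ F -> pr p2 y2 ∈ F -> pr p3 y3 ∈ F ->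
  rule g (entry A i) (entry A j) (entry A k) (tl p1) y1 (tl p2) y2 (tl p3) y3.
Proof.
  intros Hi Hj Hk; intros.
  destruct (Hob p1 H y1 H0 p2 H1 y2 H2 p3 H3 y3 H4 H8 H9 H10) as [_ Hr]; auto.
Qed.

(** One position with value 0 is as good as all of them: [rule], applied to [xvar] itself, makes
    positions for [xvar] with the same first entry [n] agree on being 0. *)
Definition set_of_sequence : dom V :=
  comp om (fun n => exists p, p ∈ om /\ (hd p = num 0 /\ (hd (tl p) = n /\ pr p emp ∈ F))).

Lemma in_set_of_sequence n : n ∈ set_of_sequence <->
  n ∈ om /\ exists p, p ∈ om /\ (hd p = num 0 /\ (hd (tl p) = n /\ pr p emp ∈ F)).
Proof.
  unfold set_of_sequence; apply (in_comp HV). pose proof has_arith_all as HC. d0.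
Qed.

(** Induction on [B] in the metatheory. The table is closed under immediate subformulas, and [F] is
    total, so the positions to which a rule refers always exist. *)
Lemma sequence_truth B : forall i, i < length (table A) -> entry A i = B ->
  forall p, p ∈ om -> hd p = num i -> forall y, y ∈ om -> pr p y ∈ F ->
  (y = emp <-> ssat (dec (tl p)) (set_of_sequence .: g) B).
Proof.
  assert (Hx : 0 < length (table A)) by (simpl; lia).
  assert (Hin : forall i, i < length (table A) -> In (entry A i) (table A))
    by (intros; apply nth_In; assumption).
  induction B as [t u|t u|t X| |B IHB B' IHB'|B IHB|B IHB];
    intros i Hi HB p Hp Hpi y Hy HpF;
    pose proof (fun j k p2 y2 p3 y3 Hj Hk =>
      sequence_rule i j k p y p2 y2 p3 y3 Hi Hj Hk Hp Hy) as Hrule;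
    rewrite HB in Hrule.
  (* In atoms other than [t \in 0] set variable 0 does not occur, so the dummy [emp] in [rule] is
     never consulted; the second and third positions are dummies as well. *)
  - apply (Hrule i i p y p y); auto.
  - apply (Hrule i i p y p y); auto.
  - destruct X as [|X]; [|apply (Hrule i i p y p y); auto]. simpl.
    rewrite in_set_of_sequence.
    set (n := tval (dec (tl p)) t).
    assert (Hn : n ∈ om) by (apply (tval_om HV); intros; apply (dec_om HV)).
    assert (Hkey : forall p2 y2, p2 ∈ om -> y2 ∈ om -> hd p2 = num 0 -> hd (tl p2) = n ->
      pr p2 y2 ∈ F -> (y = emp <-> y2 = emp)).
    { intros p2 y2 Hp2 Hy2 H1 H2 H3. apply (Hrule 0 0 p2 y2 p2 y2); auto. }
    split.
    + intros ->. split; [exact Hn|].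
      destruct (cons_ex HV n emp Hn Hemp) as (c & Hc & Hc1 & _).
      destruct (position_ex 0 c Hc) as (p2 & y2 & Hp2 & Hy2 & H1 & H2 & H3).
      rewrite <- H2 in Hc1. exists p2; repeat split; auto.
      rewrite <- (proj1 (Hkey p2 y2 Hp2 Hy2 H1 Hc1 H3) eq_refl); exact H3.
    + intros (_ & p2 & Hp2 & H1 & H2 & H3). apply (Hkey p2 emp); auto.
  - apply (Hrule i i p y p y); auto.
  - pose proof (Hin i Hi) as Hb; rewrite HB in Hb.
    apply (proj1 (closed_table A)) in Hb; destruct Hb as [Hb Hb'].
    destruct (entry_ex _ Hb) as (j & Hj & Ej), (entry_ex _ Hb') as (k & Hk & Ek).
    destruct (position_ex j (tl p) (tl_om HV p)) as (p2 & y2 & Hp2 & Hy2 & H1 & H2 & H3).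
    destruct (position_ex k (tl p) (tl_om HV p)) as (p3 & y3 & Hp3 & Hy3 & H1' & H2' & H3').
    assert (Hr : y = emp <-> (y2 = emp -> y3 = emp))
      by (apply (Hrule j k p2 y2 p3 y3); auto).
    rewrite Hr, (IHB j Hj Ej p2 Hp2 H1 y2 Hy2 H3), (IHB' k Hk Ek p3 Hp3 H1' y3 Hy3 H3'),
      H2, H2'. reflexivity.
  - pose proof (Hin i Hi) as Hb; rewrite HB in Hb.
    apply (proj2 (closed_table A)) in Hb. destruct (entry_ex _ Hb) as (j & Hj & Ej).
    assert (Hr : forall w : dom V, w ∈ om -> exists y2 : dom V,
      ((y = emp -> y2 = emp) /\ (y = succ w -> ~ y2 = emp)) /\
      (y2 = emp <-> ssat (w .: dec (tl p)) (set_of_sequence .: g) B)).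
    { intros w Hw. destruct (cons_ex HV w (tl p) Hw (tl_om HV p)) as (c & Hc & Hc1 & Hc2).
      destruct (position_ex j c Hc) as (p2 & y2 & Hp2 & Hy2 & H1 & H2 & H3).
      exists y2; split.
      - rewrite <- Hc1, <- H2. apply (Hrule j j p2 y2 p2 y2); auto. rewrite H2; exact Hc2.
      - rewrite (IHB j Hj Ej p2 Hp2 H1 y2 Hy2 H3), H2, dec_cons, Hc1, Hc2. reflexivity. }
    split.
    + intros Hy0 w Hw. destruct (Hr w Hw) as (y2 & [H1 _] & H2). apply H2, H1, Hy0.
    (* A nonzero value is some [succ w], and the rule then makes [w] a counterexample, against
       [Hall]. *)
    + intros Hall. destruct (om_cases HV y Hy) as [E|[w [Hw E]]]; [exact E|].
      destruct (Hr w Hw) as (y2 & [_ H1] & H2). destruct (H1 E). apply H2, Hall, Hw.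
  - pose proof (arithmetical_entry A i HA) as H; rewrite HB in H; destruct H.
Qed.

Lemma sequence_root : x ∈ om -> ce ∈ om ->
  ssat (x .: dec ce) (set_of_sequence .: g) A.
Proof.
  intros Hx Hce. destruct (cons_ex HV x ce Hx Hce) as (c & Hc & Hc1 & Hc2).
  destruct (entry_ex A (or_intror (subforms_self A))) as (i & Hi & Ei).
  destruct (position_ex i c Hc) as (p & y & Hp & Hy & H1 & H2 & H3).
  pose proof (sequence_truth A i Hi Ei p Hp H1 y Hy H3) as H.
  rewrite H2, dec_cons, Hc1, Hc2 in H. apply H.
  destruct (Hob p Hp y Hy p Hp y Hy p Hp y Hy H3 H3 H3) as [Hroot _].
  apply (Hroot i Hi Ei H1); rewrite H2; assumption.
Qed.

End FromSequence.

(** The parameters have to lie in [d] for the direction from right to left: collection in [d]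
    applies to the constraint only if it is Delta_0 with parameters in [d]. *)
Theorem Sigma11_iff_not_wf A x ce g d : SOA.arithmetical A ->
  adm V d -> has_arith (elt d) -> x ∈ om -> ce ∈ om -> (forall j, g j ∈ d) ->
  (exists X, sub_om X /\ ssat (x .: dec ce) (X .: g) A) <->
  ~ wf (constraint A x ce g) d.
Proof.
  intros HA Hd HC Hx Hce Hg. split.
  - intros (X & _ & HX) Hwf.
    destruct (truth_sequence A (X .: g) HA) as (F & HF & HT).
    apply (wf_no_path HV _ _ F Hwf HF). eapply truth_sequence_obeys; eassumption.
  - intros Hwf. destruct (path_of_not_wf HV d Hd (ha_om _ HC) (constraint A x ce g))
      as (F & HF & Hob).
    + apply (D0_constraint (elt d) HC A (fun _ => x) (fun _ => ce) (fun _ => g)); auto.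
      * apply dfun_const, HC, Hx.
      * apply dfun_const, HC, Hce.
      * intros j; apply dfun_const, Hg.
    + exact Hwf.
    + exists (set_of_sequence F); split.
      * intros n Hn; apply in_set_of_sequence in Hn; apply Hn.
      * eapply sequence_root; eassumption.
Qed.

Lemma D0_wf C A (x ce t : (nat -> dom V) -> dom V) (g : (nat -> dom V) -> nat -> dom V) :
  has_arith C -> SOA.arithmetical A -> dfun C x -> dfun C ce -> dfun C t ->
  (forall j, dfun C (fun r => g r j)) ->
  D0 C (fun r => wf (constraint A (x r) (ce r) (g r)) (t r)).
Proof.
  intros HC HA Hx Hce Ht Hg. apply D0_ex; [exact Ht|].
  assert (HCe : C emp) by (apply HC, Hemp).
  apply (D0_ranked HV C (ha_om _ HC) (fun r => constraint A (x r) (ce r) (g r)));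
    try dfun_tac.
  apply (D0_constraint C HC A (fun r => x (fun n => r (6 + n)))
    (fun r => ce (fun n => r (6 + n))) (fun r => g (fun n => r (6 + n)))); auto.
  - exact (dfun_reindex C x _ Hx).
  - exact (dfun_reindex C ce _ Hce).
  - intros j; exact (dfun_reindex C _ _ (Hg j)).
Qed.

(** An admissible set is obtained around a single set. So finitely many sets are packed into nested
    pairs, whose components belong to [d] by transitivity. *)
Lemma adm_absorbs k (g : nat -> dom V) :
  exists x, forall d, adm V d -> x ∈ d -> forall j, j < k -> g j ∈ d.
Proof.
  induction k as [|k [x Hx]].
  - exists emp; lia.
  - exists (pr x (g k)); intros d Hd H j Hj.
    apply (adm_pr_inv HV) in H; [|exact Hd]. destruct H as [H1 H2].
    destruct (Nat.eq_dec j k) as [->|Hn]; [exact H2|]. apply (Hx d Hd H1); lia.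
Qed.

Lemma adm_with k (g : nat -> dom V) :
  exists d, adm V d /\ has_arith (elt d) /\ forall j, j < k -> g j ∈ d.
Proof.
  destruct (adm_absorbs (5 + k) (om .: ad .: mu .: pg .: omsq .: g)) as [x Hx].
  destruct (limit HV x) as [d [Hd Hxd]]. specialize (Hx d Hd Hxd).
  assert (Hom : om ∈ d) by (apply (Hx 0); lia).
  exists d; split; [exact Hd|]. split.
  - split; [exact Hom|apply (Hx 1)|apply (Hx 2)|apply (Hx 3)|apply (Hx 4)|]; try lia.
    intros n Hn; exact (adm_tran HV d n om Hd Hom Hn).
  - intros j Hj; apply (Hx (5 + j)); lia.
Qed.

Lemma tbounded1_mono k l t : k <= l -> SOA.tbounded k t -> SOA.tbounded l t.
Proof. induction t; simpl; intuition lia. Qed.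

Lemma bounded1_mono A : forall k l, k <= l -> SOA.bounded1 k A -> SOA.bounded1 l A.
Proof.
  induction A; simpl; intros k l Hkl H; try (intuition eauto using tbounded1_mono; fail).
  apply (IHA (S k)); [lia|exact H].
Qed.

Lemma bounded2_mono A : forall k l, k <= l -> SOA.bounded2 k A -> SOA.bounded2 l A.
Proof.
  induction A; simpl; intros k l Hkl H; try (intuition eauto; fail); try lia.
  apply (IHA (S k)); [lia|exact H].
Qed.

Lemma tbounded1_ex t : exists k, SOA.tbounded k t.
Proof.
  induction t as [n| | |t [k Hk] u [l Hl]|t [k Hk] u [l Hl]]; simpl;
    try (exists 0; exact I); [exists (S n); lia|..];
    exists (k + l); split; eapply tbounded1_mono; try eassumption; lia.
Qed.

Lemma bounded1_ex A : exists k, SOA.bounded1 k A.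
Proof.
  induction A as [t u|t u|t X| |A [k Hk] B [l Hl]|A [k Hk]|A [k Hk]]; simpl.
  1,2: destruct (tbounded1_ex t) as [k Hk], (tbounded1_ex u) as [l Hl];
    exists (k + l); split; eapply tbounded1_mono; try eassumption; lia.
  - apply tbounded1_ex.
  - exists 0; exact I.
  - exists (k + l); split; eapply bounded1_mono; try eassumption; lia.
  - exists k; eapply bounded1_mono; [|exact Hk]; lia.
  - exists k; exact Hk.
Qed.

Lemma bounded2_ex A : exists k, SOA.bounded2 k A.
Proof.
  induction A as [t u|t u|t X| |A [k Hk] B [l Hl]|A [k Hk]|A [k Hk]]; simpl;
    try (exists 0; exact I).
  - exists (S X); lia.
  - exists (k + l); split; eapply bounded2_mono; try eassumption; lia.
  - exists k; exact Hk.
  - exists k; eapply bounded2_mono; [|exact Hk]; lia.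
Qed.

Theorem Pi11_comprehension B (e g : nat -> dom V) : SOA.arithmetical B -> (forall n, e n ∈ om) ->
  exists Y, sub_om Y /\ forall x, x ∈ om ->
    (x ∈ Y <-> forall X, sub_om X -> ssat (x .: e) (X .: g) B).
Proof.
  intros HB He. destruct (bounded1_ex B) as [k Hk], (bounded2_ex B) as [l Hl].
  destruct (dec_ex HV k e He) as (ce & Hce & Hdec).
  destruct (adm_with l g) as (d & Hd & HC & Hg).
  (* Only the first [l] set variables occur in [B]. The others are reset to [emp], so that all of
     [g'] lies in [d]. *)
  set (g' := fun j => if j <? l then g j else emp).
  assert (Hg' : forall j, g' j ∈ d).
  { intros j; unfold g'. destruct (j <? l) eqn:E; [apply Hg, Nat.ltb_lt, E|].
    apply HC, Hemp. }
  set (A := SOA.Neg B). assert (HA : SOA.arithmetical A) by (simpl; auto).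
  set (Q := fun x => wf (constraint A x ce g') d).
  assert (HQ : D0 all_sets (fun r => Q (r 0))).
  { apply (D0_wf all_sets A (fun r => r 0) (fun _ => ce) (fun _ => d) (fun _ => g'));
      auto using has_arith_all; intros; dfun_tac. }
  exists (comp om Q). split; [intros x Hx; apply (in_comp HV) in Hx; tauto|].
  intros x Hx. rewrite (in_comp HV) by exact HQ.
  pose proof (Sigma11_iff_not_wf A x ce g' d HA Hd HC Hx Hce Hg') as HS.
  assert (Hext : forall X, ssat (x .: dec ce) (X .: g') B <-> ssat (x .: e) (X .: g) B).
  { intros X; apply (ssat_ext_bounded B (S k) (S l)).
    - eapply bounded1_mono; [|exact Hk]; lia.
    - eapply bounded2_mono; [|exact Hl]; lia.
    - intros [|n] Hn; simpl; [reflexivity|apply Hdec; lia].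
    - intros [|n] Hn; simpl; [reflexivity|]. unfold g'.
      replace (n <? l) with true; [reflexivity|]. symmetry; apply Nat.ltb_lt; lia. }
  split.
  - intros [_ HQx] X HX. apply NNPP; intros Hn. apply (proj1 HS); [|exact HQx].
    exists X; split; [exact HX|]. intros H; apply Hn, Hext, H.
  - intros H; split; [exact Hx|]. apply NNPP; intros Hn. apply HS in Hn.
    destruct Hn as (X & HX & Hs). apply Hs, Hext, H, HX.
Qed.

Theorem Sigma12_comprehension B (e g : nat -> dom V) : SOA.arithmetical B -> SOA.bounded2 2 B ->
  (forall n, e n ∈ om) ->
  exists Z, sub_om Z /\ forall x, x ∈ om ->
    (x ∈ Z <-> exists Y, sub_om Y /\
       forall X, sub_om X -> ssat (x .: e) (X .: Y .: g) B).
Proof.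
  intros HB Hl He. destruct (bounded1_ex B) as [k Hk].
  destruct (dec_ex HV k e He) as (ce & Hce & Hdec).
  set (A := SOA.Neg B). assert (HA : SOA.arithmetical A) by (simpl; auto).
  (* Only [X] and [Y] occur as set variables, so the constant environment [fun _ => Y] can replace
     [g], whose values need not belong to [M]. *)
  assert (Hext : forall x Y X, ssat (x .: dec ce) (X .: fun _ => Y) B <->
                               ssat (x .: e) (X .: Y .: g) B).
  { intros x Y X; apply (ssat_ext_bounded B (S k) 2); auto.
    - eapply bounded1_mono; [|exact Hk]; lia.
    - intros [|n] Hn; simpl; [reflexivity|apply Hdec; lia].
    - intros [|[|n]] Hn; simpl; [reflexivity..|lia]. }
  assert (HS : forall x d Y, x ∈ om -> adm V d -> has_arith (elt d) -> Y ∈ d ->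
    wf (constraint A x ce (fun _ => Y)) d <->
    forall X, sub_om X -> ssat (x .: e) (X .: Y .: g) B).
  { intros x d Y Hx Hd HC HY.
    pose proof (Sigma11_iff_not_wf A x ce (fun _ => Y) d HA Hd HC Hx Hce (fun _ => HY)) as H.
    split.
    - intros Hwf X HX. apply NNPP; intros Hn. apply (proj1 H); [|exact Hwf].
      exists X; split; [exact HX|]. intros Hs; apply Hn, Hext, Hs.
    - intros Hs; apply NNPP; intros Hn. apply H in Hn.
      destruct Hn as (X & HX & Hn). apply Hn, Hext, Hs, HX. }
  (* The arithmetical constants are required of [d] one by one, which makes the condition Delta_0
     and ensures [has_arith (elt d)]. *)
  set (P := fun x d => adm V d /\ ((om ∈ d /\ (ad ∈ d /\ (mu ∈ d /\ (pg ∈ d /\ omsq ∈ d)))) /\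
    exists Y, Y ∈ d /\ ((forall n, n ∈ Y -> n ∈ om) /\
      wf (constraint A x ce (fun _ => Y)) d))).
  assert (HP : forall C, has_arith C -> D0 C (fun r => P (r 0) (r 1))).
  { intros C HC. destruct HC as [H1 H2 H3 H4 H5 H6] eqn:E. clear E.
    apply D0_and; [d0|]. apply D0_and; [d0|].
    apply D0_ex; [dfun_tac|]. apply D0_and; [d0|].
    apply (D0_wf C A (fun r => r 1) (fun _ => ce) (fun r => r 2) (fun r _ => r 0));
      auto; intros; dfun_tac. }
  assert (HPwit : forall x d, x ∈ om -> P x d -> exists Y, sub_om Y /\
    forall X, sub_om X -> ssat (x .: e) (X .: Y .: g) B).
  { intros x d Hx (Hd & (H1 & H2 & H3 & H4 & H5) & Y & HY & HYom & Hwf).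
    exists Y; split; [exact HYom|]. apply (HS x d Y); auto. split; auto.
    intros n Hn; exact (adm_tran HV d n om Hd H1 Hn). }
  assert (HPM : D0 all_sets (fun r => exists d, d ∈ M /\ P (r 0) d)).
  { pose proof (HP all_sets has_arith_all) as HPa. d0. }
  exists (comp om (fun x => exists d, d ∈ M /\ P x d)).
  split; [intros x Hx; apply (in_comp HV) in Hx; tauto|].
  intros x Hx. rewrite (in_comp HV) by exact HPM. split.
  - intros (_ & d & _ & H). exact (HPwit x d Hx H).
  - intros (Y & HY & H). split; [exact Hx|].
    (* All parameters are in [M]: [x] and [ce] are numbers, and the constants of arithmetic were
       selected there. *)
    apply (stability HV (P x)).
    + pose proof (HP _ has_arith_stable) as HPs.
      assert (HxM : x ∈ M) by exact (om_elt_stable HV x Hx). d0.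
    + destruct (adm_with 1 (fun _ => Y)) as (d & Hd & HC & HYd).
      specialize (HYd 0 Nat.lt_0_1). exists d.
      split; [exact Hd|]. split; [destruct HC; auto|].
      exists Y; split; [exact HYd|]. split; [exact HY|]. apply HS; auto.
Qed.

End Comprehension.

(** * Soundness and interpretation *)

Section ArithmeticSoundness.
Context {V : structure} (HV : model V ST.KPlr_M).
Notation all_sets := (fun _ : dom V => True).
Let Hemp : emp ∈ om := emp_om HV.
Let Hsucc : forall n, n ∈ om -> succ n ∈ om := succ_om HV.
Lemma add_one (a : dom V) : a ∈ om -> add a (succ emp) = succ a.
Proof. intros Ha; rewrite (add_S HV), (add_0 HV); auto. Qed.

Import SOA.

Lemma tval_tsubst (e : nat -> dom V) s t :
  tval e (tsubst s t) = tval (fun n => tval e (s n)) t.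
Proof. induction t; simpl; congruence. Qed.

Lemma tval_tup (x : dom V) e s :
  (fun n => tval (x .: e) (tup s n)) = x .: (fun n => tval e (s n)).
Proof.
  apply functional_extensionality; intros [|n]; simpl; [reflexivity|].
  unfold tshift; rewrite tval_tsubst; reflexivity.
Qed.

Lemma scons_sup (X : dom V) g r :
  (fun n => (X .: g) (sup r n)) = X .: (fun n => g (r n)).
Proof. apply functional_extensionality; intros [|n]; reflexivity. Qed.

Lemma ssat_subst A : forall (e g : nat -> dom V) s r,
  ssat e g (subst s r A) <-> ssat (fun n => tval e (s n)) (fun X => g (r X)) A.
Proof.
  induction A as [t u|t u|t X| |A IHA B IHB|A IHA|A IHA]; intros e g s r; simpl;
    rewrite ?tval_tsubst, ?IHA, ?IHB; try tauto.
  - apply forall_iff; intros n. rewrite IHA, tval_tup; reflexivity.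
  - apply forall_iff; intros X. rewrite IHA, scons_sup; reflexivity.
Qed.

Lemma ssat_inst1 (e g : nat -> dom V) A t :
  ssat e g (inst1 A t) <-> ssat (tval e t .: e) g A.
Proof.
  unfold inst1, subst1; rewrite ssat_subst, (scons_comp (tval e)); reflexivity.
Qed.

Lemma ssat_inst2 (e g : nat -> dom V) A X : ssat e g (inst2 A X) <-> ssat e (g X .: g) A.
Proof. unfold inst2, subst2; rewrite ssat_subst, (scons_comp g); reflexivity. Qed.

Lemma ssat_and (e g : nat -> dom V) A B : ssat e g (And A B) <-> ssat e g A /\ ssat e g B.
Proof. simpl; tauto. Qed.

Lemma ssat_iff (e g : nat -> dom V) A B : ssat e g (Iff A B) <-> (ssat e g A <-> ssat e g B).
Proof. simpl; tauto. Qed.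

Lemma ssat_or (e g : nat -> dom V) A B : ssat e g (Or A B) <-> ssat e g A \/ ssat e g B.
Proof. simpl; tauto. Qed.

Lemma ssat_ex2 (e g : nat -> dom V) A :
  ssat e g (Ex2 A) <-> exists X, sub_om X /\ ssat e (X .: g) A.
Proof.
  simpl; split.
  - intros H; apply NNPP; intros Hn; apply H; intros X HX HA; apply Hn; eauto.
  - intros [X [HX HA]] H; exact (H X HX HA).
Qed.

Lemma ssat_sound (T : form -> Prop) :
  (forall A, T A -> forall e g : nat -> dom V,
     (forall n, e n ∈ om) -> (forall n, sub_om (g n)) -> ssat e g A) ->
  forall A, prv T A -> forall e g : nat -> dom V,
     (forall n, e n ∈ om) -> (forall n, sub_om (g n)) -> ssat e g A.
Proof.
  intros HT A HA; induction HA; intros e g He Hg; cbn [ssat Neg].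
  - apply HT; assumption.
  - auto.
  - auto.
  - apply NNPP.
  - rewrite ssat_inst1; intros HA; apply HA, (tval_om HV), He.
  - rewrite ssat_inst2; intros HA; apply HA, Hg.
  - auto.
  - auto.
  - intros HA n Hn. unfold shift1, subst1; rewrite ssat_subst; exact HA.
  - intros HA X HX. unfold shift2, subst2; rewrite ssat_subst; exact HA.
  - reflexivity.
  - rewrite !ssat_inst1; intros ->; auto.
  - exact (IHHA1 e g He Hg (IHHA2 e g He Hg)).
  - intros n Hn; apply IHHA; [intros [|m]; simpl; auto|exact Hg].
  - intros X HX; apply IHHA; [exact He|intros [|m]; simpl; auto].
Qed.

Lemma basic_valid A : basic A -> forall e g : nat -> dom V, (forall n, e n ∈ om) -> ssat e g A.
Proof.
  intros HA e g He; destruct HA; rewrite ?ssat_iff, ?ssat_or; simpl;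
    rewrite ?add_one by auto.
  - apply (succ_neq_emp HV).
  - apply (succ_inj HV); auto.
  - apply (add_0 HV); auto.
  - rewrite add_one by apply (add_om HV). apply (add_S HV); auto.
  - apply (mul_0 HV); auto.
  - apply (mul_S HV); auto.
  - apply (in_emp HV).
  - apply (in_succ HV).
Qed.

Lemma induction_valid (e g : nat -> dom V) : ssat e g induction_axiom.
Proof.
  unfold induction_axiom; cbn [ssat]; intros X HX; rewrite ssat_and.
  intros [H0 HS]. cbn [ssat tval scons] in *. apply (om_ind HV (fun n => n ∈ X)).
  - d0.
  - exact H0.
  - intros n Hn HnX. rewrite <- add_one by exact Hn. apply HS; assumption.
Qed.

Lemma comprehension_valid (e g : nat -> dom V) A :
  (exists Y, sub_om Y /\ forall x, x ∈ om -> (x ∈ Y <-> ssat (x .: e) g A)) ->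
  ssat e g (comprehension A).
Proof.
  intros (Y & HY & H). unfold comprehension; rewrite ssat_ex2. exists Y; split; [exact HY|].
  intros x Hx; rewrite ssat_iff. unfold shift2, subst2; rewrite ssat_subst.
  exact (H x Hx).
Qed.

Theorem second_order_sound A : prv Sigma12m_CA_Pi11_CA0 A ->
  forall e g : nat -> dom V, (forall n, e n ∈ om) -> (forall n, sub_om (g n)) -> ssat e g A.
Proof.
  apply ssat_sound. clear A. intros A HA e g He Hg.
  destruct HA as [A [A' HA| |A' [B HB]]|A [B HB] Hb].
  - apply basic_valid; assumption.
  - apply induction_valid.
  - apply comprehension_valid. exact (Pi11_comprehension HV B e g HB He).
  - apply comprehension_valid. setoid_rewrite ssat_ex2.
    apply (Sigma12_comprehension HV B e g HB); [|exact He]. simpl in Hb; tauto.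
Qed.

End ArithmeticSoundness.

(** * Evaluation of the translated formulas *)

Section Interpretation.
Context {V : structure} (HV : model V ST.KPlr_M).
Notation all_sets := (fun _ : dom V => True).
Let Hemp : emp ∈ om := emp_om HV.
Let Hsucc : forall n, n ∈ om -> succ n ∈ om := succ_om HV.
Import ST.
Local Open Scope st_scope.

Lemma sat_and (rho : nat -> dom V) A B : sat V rho (A &&& B) <-> sat V rho A /\ sat V rho B.
Proof. simpl; tauto. Qed.

Lemma sat_or (rho : nat -> dom V) A B : sat V rho (A ||| B) <-> sat V rho A \/ sat V rho B.
Proof. simpl; tauto. Qed.

Lemma sat_imp (rho : nat -> dom V) A B : sat V rho (A --> B) <-> (sat V rho A -> sat V rho B).
Proof. reflexivity. Qed.

Lemma sat_all (rho : nat -> dom V) A : sat V rho (All A) <-> forall x, sat V (x .: rho) A.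
Proof. reflexivity. Qed.

Lemma sat_ex (rho : nat -> dom V) A : sat V rho (Ex A) <-> exists x, sat V (x .: rho) A.
Proof.
  simpl; split.
  - intros H; apply NNPP; intros Hn; apply H; intros x HA; apply Hn; eauto.
  - intros [x HA] H; exact (H x HA).
Qed.

Lemma exists_iff {X : Type} (P Q : X -> Prop) :
  (forall x, P x <-> Q x) -> (exists x, P x) <-> (exists x, Q x).
Proof. intros H; split; intros [x Hx]; exists x; apply H, Hx. Qed.

Lemma sat_allin (rho : nat -> dom V) t A :
  sat V rho (AllIn t A) <-> forall x, x ∈ teval V rho t -> sat V (x .: rho) A.
Proof.
  unfold AllIn; rewrite sat_all; apply forall_iff; intros x.
  rewrite sat_imp; cbn [sat]; rewrite teval_lift; reflexivity.
Qed.

Lemma sat_exin (rho : nat -> dom V) t A :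
  sat V rho (ExIn t A) <-> exists x, x ∈ teval V rho t /\ sat V (x .: rho) A.
Proof.
  unfold ExIn; rewrite sat_ex; apply exists_iff; intros x.
  rewrite sat_and; cbn [sat]; rewrite teval_lift; reflexivity.
Qed.

Lemma teval_lift2 (x y : dom V) rho t :
  teval V (x .: y .: rho) (lift 2 t) = teval V rho t.
Proof. destruct t; reflexivity. Qed.

Lemma teval_lift3 (x y z : dom V) rho t :
  teval V (x .: y .: z .: rho) (lift 3 t) = teval V rho t.
Proof. destruct t; reflexivity. Qed.

Lemma sat_sub (rho : nat -> dom V) t u : sat V rho (Sub t u) <->
  forall x, x ∈ teval V rho t -> x ∈ teval V rho u.
Proof.
  unfold Sub; rewrite sat_allin; apply forall_iff; intros x.
  cbn [sat]; rewrite teval_lift; reflexivity.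
Qed.

Lemma sat_empty (rho : nat -> dom V) t : sat V rho (Empty t) <-> teval V rho t = emp.
Proof. unfold Empty; rewrite sat_allin, (emp_eq HV); reflexivity. Qed.

Lemma sat_tran (rho : nat -> dom V) t : sat V rho (Tran t) <-> trans (teval V rho t).
Proof.
  unfold Tran, trans; rewrite sat_allin; apply forall_iff; intros x.
  rewrite sat_sub, teval_lift; reflexivity.
Qed.

Lemma sat_IsSucc (rho : nat -> dom V) s t :
  sat V rho (IsSucc s t) <-> teval V rho s = succ (teval V rho t).
Proof.
  unfold IsSucc; rewrite !sat_and, sat_sub, sat_allin, (succ_eq HV).
  assert (H : forall x, sat V (x .: rho) (#0 \in lift 1 t ||| #0 == lift 1 t) <->
    x ∈ teval V rho t \/ x = teval V rho t)
    by (intros x; rewrite sat_or; cbn [sat]; rewrite !teval_lift; reflexivity).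
  setoid_rewrite H. cbn [sat]. tauto.
Qed.

Lemma sat_ZeroOrSucc (rho : nat -> dom V) t :
  sat V rho (ZeroOrSucc t) <-> zero_or_succ (teval V rho t).
Proof.
  unfold ZeroOrSucc, zero_or_succ; rewrite sat_or, sat_empty, sat_exin.
  apply or_iff_compat_l, exists_iff; intros x. rewrite sat_IsSucc, teval_lift; reflexivity.
Qed.

Lemma sat_InOmega (rho : nat -> dom V) t : sat V rho (InOmega t) <-> teval V rho t ∈ om.
Proof.
  rewrite (in_om HV). unfold InOmega, in_omega.
  rewrite !sat_and, sat_tran, sat_ZeroOrSucc, !sat_allin.
  assert (H1 : forall x, sat V (x .: rho) (Tran #0) <-> trans x)
    by (intros x; apply sat_tran).
  assert (H2 : forall x, sat V (x .: rho) (ZeroOrSucc #0) <-> zero_or_succ x)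
    by (intros x; apply sat_ZeroOrSucc).
  setoid_rewrite H1; setoid_rewrite H2; reflexivity.
Qed.

Lemma sat_SubOmega (rho : nat -> dom V) t : sat V rho (SubOmega t) <-> sub_om (teval V rho t).
Proof.
  unfold SubOmega, sub_om; rewrite sat_allin; apply forall_iff; intros x.
  rewrite sat_InOmega; reflexivity.
Qed.

Lemma sat_IsUPair (rho : nat -> dom V) p a b : sat V rho (IsUPair p a b) <->
  teval V rho p = upair (teval V rho a) (teval V rho b).
Proof.
  unfold IsUPair; rewrite !sat_and, sat_allin, (upair_eq HV).
  assert (H : forall x, sat V (x .: rho) (#0 == lift 1 a ||| #0 == lift 1 b) <->
    x = teval V rho a \/ x = teval V rho b)
    by (intros x; rewrite sat_or; cbn [sat]; rewrite !teval_lift; reflexivity).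
  setoid_rewrite H. cbn [sat]. tauto.
Qed.

Lemma sat_IsPair (rho : nat -> dom V) p a b : sat V rho (IsPair p a b) <->
  teval V rho p = pr (teval V rho a) (teval V rho b).
Proof.
  unfold IsPair, pr; rewrite !sat_and, !sat_exin, sat_allin, (upair_eq HV).
  set (a' := teval V rho a); set (b' := teval V rho b).
  assert (H1 : forall x, sat V (x .: rho) (IsUPair #0 (lift 1 a) (lift 1 a)) <-> x = sing a')
    by (intros x; rewrite sat_IsUPair, !teval_lift; reflexivity).
  assert (H2 : forall x, sat V (x .: rho) (IsUPair #0 (lift 1 a) (lift 1 b)) <-> x = upair a' b')
    by (intros x; rewrite sat_IsUPair, !teval_lift; reflexivity).
  setoid_rewrite sat_or. setoid_rewrite H1. setoid_rewrite H2.
  split.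
  - intros ((x & Hx & ->) & (y & Hy & ->) & H); auto.
  - intros ((Hx & Hy) & H); repeat split; eauto.
Qed.

Lemma sat_App (rho : nat -> dom V) f x y : sat V rho (App f x y) <->
  pr (teval V rho x) (teval V rho y) ∈ teval V rho f.
Proof.
  unfold App; rewrite sat_exin. split.
  - intros (p & Hp & H). rewrite sat_IsPair, !teval_lift in H. simpl in H; subst; exact Hp.
  - intros H; eexists; split; [exact H|]. rewrite sat_IsPair, !teval_lift; reflexivity.
Qed.

Lemma sat_Functional (rho : nat -> dom V) f : sat V rho (Functional f) <->
  forall x y y', pr x y ∈ teval V rho f -> pr x y' ∈ teval V rho f -> y = y'.
Proof.
  unfold Functional. rewrite sat_all; apply forall_iff; intros x.
  rewrite sat_all; apply forall_iff; intros y. rewrite sat_all; apply forall_iff; intros y'.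
  rewrite sat_imp, sat_and, !sat_App, teval_lift3. simpl; tauto.
Qed.

(* [IsAdd] and [IsMul] quantify over arbitrary sets [f], not only over functions on omega. *)
Lemma recursion_graph (G a a0 b c : dom V) (step : dom V -> dom V -> Prop)
    (next : dom V -> dom V) :
  is_fun om om G -> a ∈ om -> b ∈ om ->
  (forall v v', v ∈ om -> step v v' <-> v' = next v) ->
  ap G a emp = a0 -> (forall n, n ∈ om -> ap G a (succ n) = next (ap G a n)) ->
  (exists f, (forall x y y', pr x y ∈ f -> pr x y' ∈ f -> y = y') /\
     pr emp a0 ∈ f /\
     (forall i, i ∈ b -> forall v, pr i v ∈ f ->
        exists i' v', i' = succ i /\ step v v' /\ pr i' v' ∈ f) /\
     pr b c ∈ f) <-> c = ap G a b.
Proof.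
  intros HG Ha Hb Hstep H0 HS.
  assert (Hom : forall n, ap G a n ∈ om) by (intros n; apply (ap_om HV G om a n HG)).
  split.
  - intros (f & Hf & Hf0 & HfS & Hc). apply (Hf b); [exact Hc|].
    assert (H : forall i, i ∈ om -> i ∈ b \/ i = b -> pr i (ap G a i) ∈ f).
    { apply (om_ind HV (fun i => i ∈ b \/ i = b -> pr i (ap G a i) ∈ f)).
      - apply D0_imp; [d0|]. apply (D0_in_pr HV); try dfun_tac.
        apply (dfun_ap HV _ G om); auto; dfun_tac.
      - intros _; rewrite H0; exact Hf0.
      - intros n Hn IH Hle.
        assert (Hnb : n ∈ b).
        { destruct Hle as [Hle|<-]; [|apply (in_succ HV); auto].
          apply (om_elem_trans HV b (succ n)); auto. apply (in_succ HV); auto. }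
        destruct (HfS n Hnb _ (IH (or_introl Hnb))) as (i' & v' & -> & Hs & H).
        apply Hstep in Hs; [|apply Hom]. rewrite HS, <- Hs; auto. }
    apply H; auto.
  - intros ->. destruct (limit HV om) as [d [Hd Hod]].
    (* The section of [G] at [a], as a set of pairs. *)
    set (f := comp d (fun q => exists n y, q = pr n y /\ tri a n y ∈ G)).
    assert (Hf : forall n y, pr n y ∈ f <-> n ∈ om /\ y = ap G a n).
    { intros n y; unfold f; rewrite (in_comp HV) by d0. split.
      - intros (_ & n' & y' & E & H). apply (pr_inj HV) in E; destruct E as [<- <-].
        destruct (proj1 HG _ H) as (a1 & n1 & y1 & E & [_ Hn] & Hy).
        apply (tri_inj HV) in E; destruct E as (_ & -> & ->). split; [exact Hn|].
        symmetry; apply (ap_unique HV G om); assumption.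
      - intros [Hn ->]. split.
        + apply (kp_pr HV _ (kp_adm HV d Hd)); apply (adm_tran HV d _ om); auto.
        + exists n, (ap G a n); split; [reflexivity|apply (ap_in HV G om); auto]. }
    exists f. repeat split.
    + intros x y y' H H'; apply Hf in H, H'; destruct H, H'; congruence.
    + apply Hf; auto.
    + intros i Hi v Hv. apply Hf in Hv; destruct Hv as [Hio ->].
      exists (succ i), (next (ap G a i)). repeat split; [apply Hstep; auto|].
      apply Hf; split; [auto|]. symmetry; apply HS, Hio.
    + apply Hf; auto.
Qed.

Lemma sat_recursion_step (rho : nat -> dom V) (f i v : dom V) (A : form) :
  sat V (v .: i .: f .: rho) (Ex (Ex (IsSucc #1 #3 &&& (A &&& App #4 #1 #0)))) <->
  exists i' v', i' = succ i /\ sat V (v' .: i' .: v .: i .: f .: rho) A /\ pr i' v' ∈ f.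
Proof.
  rewrite sat_ex; apply exists_iff; intros i'. rewrite sat_ex; apply exists_iff; intros v'.
  rewrite !sat_and, sat_IsSucc, sat_App; reflexivity.
Qed.

(** [IsAdd] and [IsMul] are both of this shape, with initial condition [A0] and step [A]. *)
Lemma sat_recursion (rho : nat -> dom V) (A0 A : form) (b c : term) :
  sat V rho (Ex (Functional #0 &&& (Ex (Empty #0 &&& A0) &&&
    (AllIn (lift 1 b) (All (App #2 #1 #0 -->
       Ex (Ex (IsSucc #1 #3 &&& (A &&& App #4 #1 #0))))) &&&
     App #0 (lift 1 b) (lift 1 c))))) <->
  exists f, (forall x y y', pr x y ∈ f -> pr x y' ∈ f -> y = y') /\
     sat V (emp .: f .: rho) A0 /\
     (forall i, i ∈ teval V rho b -> forall v, pr i v ∈ f ->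
        exists i' v', i' = succ i /\
          sat V (v' .: i' .: v .: i .: f .: rho) A /\ pr i' v' ∈ f) /\
     pr (teval V rho b) (teval V rho c) ∈ f.
Proof.
  rewrite sat_ex; apply exists_iff; intros f.
  rewrite !sat_and, sat_Functional, sat_ex, sat_allin, sat_App, !teval_lift.
  apply and_iff_compat_l.
  assert (H0 : (exists x, sat V (x .: f .: rho) (Empty #0 &&& A0)) <->
    sat V (emp .: f .: rho) A0).
  { split.
    - intros [x Hx]; rewrite sat_and, sat_empty in Hx. destruct Hx as [Hx H].
      simpl in Hx; subst; exact H.
    - intros H; exists emp; rewrite sat_and, sat_empty; split; [reflexivity|exact H]. }
  rewrite H0. apply and_iff_compat_l, and_iff_compat_r.
  apply forall_iff; intros i. apply imp_iff_compat_l.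
  rewrite sat_all; apply forall_iff; intros v.
  rewrite sat_imp, sat_App, sat_recursion_step; reflexivity.
Qed.

(** No argument is assumed to be in [om]: the step of [IsMul] is evaluated at arbitrary values, and
    this form carries it from one environment to another. *)
Lemma sat_IsAdd_ex (rho : nat -> dom V) a b c : sat V rho (IsAdd a b c) <->
  exists f, (forall x y y', pr x y ∈ f -> pr x y' ∈ f -> y = y') /\
     pr emp (teval V rho a) ∈ f /\
     (forall i, i ∈ teval V rho b -> forall v, pr i v ∈ f ->
        exists i' v', i' = succ i /\ v' = succ v /\ pr i' v' ∈ f) /\
     pr (teval V rho b) (teval V rho c) ∈ f.
Proof.
  unfold IsAdd; rewrite sat_recursion.
  apply exists_iff; intros f. apply and_iff_compat_l.
  rewrite sat_App, teval_lift2. apply and_iff_compat_l, and_iff_compat_r.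
  apply forall_iff; intros i. apply imp_iff_compat_l, forall_iff; intros v.
  apply imp_iff_compat_l, exists_iff; intros i'. apply exists_iff; intros v'.
  rewrite sat_IsSucc; reflexivity.
Qed.

Lemma sat_IsAdd (rho : nat -> dom V) a b c :
  teval V rho a ∈ om -> teval V rho b ∈ om ->
  sat V rho (IsAdd a b c) <-> teval V rho c = add (teval V rho a) (teval V rho b).
Proof.
  intros Ha Hb. rewrite sat_IsAdd_ex.
  apply (recursion_graph ad _ _ _ _ (fun v v' => v' = succ v) succ); auto.
  - apply (ad_ok HV).
  - reflexivity.
  - apply (add_0 HV), Ha.
  - intros n Hn; apply (add_S HV); assumption.
Qed.

Lemma sat_IsMul (rho : nat -> dom V) a b c :
  teval V rho a ∈ om -> teval V rho b ∈ om ->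
  sat V rho (IsMul a b c) <-> teval V rho c = mul (teval V rho a) (teval V rho b).
Proof.
  intros Ha Hb. unfold IsMul; rewrite sat_recursion.
  set (step := fun v v' : dom V => sat V (v' .: v .: rho) (IsAdd #1 (lift 2 a) #0)).
  rewrite <- (recursion_graph mu (teval V rho a) emp (teval V rho b)
    (teval V rho c) step (fun v => add v (teval V rho a))); auto.
  - apply exists_iff; intros f. apply and_iff_compat_l.
    rewrite sat_App. apply and_iff_compat_l, and_iff_compat_r.
    apply forall_iff; intros i. apply imp_iff_compat_l, forall_iff; intros v.
    apply imp_iff_compat_l, exists_iff; intros i'. apply exists_iff; intros v'.
    apply and_iff_compat_l, and_iff_compat_r. unfold step.
    rewrite !sat_IsAdd_ex. destruct a; reflexivity.
  - apply (mu_ok HV).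
  - intros v v' Hv; unfold step. rewrite sat_IsAdd; rewrite ?teval_lift2; simpl; tauto.
  - apply (mul_0 HV), Ha.
  - intros n Hn; apply (mul_S HV); assumption.
Qed.

Lemma sat_ExOmega (rho : nat -> dom V) A : sat V rho (ExOmega A) <->
  exists x, x ∈ om /\ sat V (x .: rho) A.
Proof.
  unfold ExOmega; rewrite sat_ex; apply exists_iff; intros x.
  rewrite sat_and, sat_InOmega; reflexivity.
Qed.

Lemma sat_ExOmega2 (rho : nat -> dom V) A B C a b :
  a ∈ om -> b ∈ om ->
  (forall x y, sat V (y .: x .: rho) A <-> x = a) ->
  (forall x y, sat V (y .: x .: rho) B <-> y = b) ->
  sat V rho (ExOmega (ExOmega (A &&& (B &&& C)))) <-> sat V (b .: a .: rho) C.
Proof.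
  intros Ha Hb HA HB. rewrite sat_ExOmega; setoid_rewrite sat_ExOmega. split.
  - intros (x & Hx & y & Hy & H). rewrite !sat_and, HA, HB in H.
    destruct H as (-> & -> & H); exact H.
  - intros H; exists a; split; [exact Ha|]. exists b; split; [exact Hb|].
    rewrite !sat_and, HA, HB; auto.
Qed.

Lemma sat_value t : forall k (rho s : nat -> dom V) e z,
  SOA.tbounded k t -> (forall n, n < k -> rho (e n) = s n) -> (forall n, s n ∈ om) ->
  sat V rho (value e t z) <-> teval V rho z = tval s t.
Proof.
  induction t as [n| | |t IHt u IHu|t IHt u IHu]; intros k rho s e z Hb He Hs;
    cbn [value tval]; simpl in Hb.
  - cbn [sat]. simpl; rewrite He by exact Hb; reflexivity.
  - apply sat_empty.
  - rewrite sat_ex. split.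
    + intros [x Hx]. rewrite sat_and, sat_empty, sat_IsSucc, teval_lift in Hx.
      destruct Hx as [Hx ->]; simpl in *; congruence.
    + intros H; exists emp. rewrite sat_and, sat_empty, sat_IsSucc, teval_lift; auto.
  - rewrite (sat_ExOmega2 rho _ _ _ (tval s t) (tval s u)); try (apply (tval_om HV), Hs).
    + rewrite sat_IsAdd, teval_lift2; try apply (tval_om HV), Hs. reflexivity.
    + intros x y. apply (IHt k (y .: x .: rho)); [tauto|exact He|exact Hs].
    + intros x y. apply (IHu k (y .: x .: rho)); [tauto|exact He|exact Hs].
  - rewrite (sat_ExOmega2 rho _ _ _ (tval s t) (tval s u)); try (apply (tval_om HV), Hs).
    + rewrite sat_IsMul, teval_lift2; try apply (tval_om HV), Hs. reflexivity.
    + intros x y. apply (IHt k (y .: x .: rho)); [tauto|exact He|exact Hs].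
    + intros x y. apply (IHu k (y .: x .: rho)); [tauto|exact He|exact Hs].
Qed.

Lemma sat_ExOmega1 (rho : nat -> dom V) A B a :
  a ∈ om -> (forall x, sat V (x .: rho) A <-> x = a) ->
  sat V rho (ExOmega (A &&& B)) <-> sat V (a .: rho) B.
Proof.
  intros Ha HA. rewrite sat_ExOmega. split.
  - intros (x & Hx & H). rewrite sat_and, HA in H. destruct H as (-> & H); exact H.
  - intros H; exists a; split; [exact Ha|]. rewrite sat_and, HA; auto.
Qed.

(** The environments have to match on free variables only, so for a sentence nothing is asked of
    [rho]. *)
Lemma sat_interp A : forall k l (rho s h : nat -> dom V) e g,
  SOA.bounded1 k A -> SOA.bounded2 l A ->
  (forall n, n < k -> rho (e n) = s n) -> (forall n, n < l -> rho (g n) = h n) ->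
  (forall n, s n ∈ om) ->
  sat V rho (interp e g A) <-> ssat s h A.
Proof.
  induction A as [t u|t u|t X| |A IHA B IHB|A IHA|A IHA];
    intros k l rho s h e g H1 H2 He Hg Hs; cbn [interp]; simpl in H1, H2.
  - rewrite (sat_ExOmega1 rho _ _ (tval s t)).
    + rewrite (sat_value u k (tval s t .: rho) s); [|tauto|exact He|exact Hs]. reflexivity.
    + apply (tval_om HV), Hs.
    + intros x; apply (sat_value t k (x .: rho) s); [tauto|exact He|exact Hs].
  - rewrite (sat_ExOmega2 rho _ _ _ (tval s t) (tval s u)); try (apply (tval_om HV), Hs).
    + reflexivity.
    + intros x y. apply (sat_value t k (y .: x .: rho)); [tauto|exact He|exact Hs].
    + intros x y. apply (sat_value u k (y .: x .: rho)); [tauto|exact He|exact Hs].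
  - rewrite (sat_ExOmega1 rho _ _ (tval s t)).
    + cbn [sat]. simpl. rewrite Hg by exact H2. reflexivity.
    + apply (tval_om HV), Hs.
    + intros x; apply (sat_value t k (x .: rho) s); [tauto|exact He|exact Hs].
  - reflexivity.
  - rewrite sat_imp. rewrite (IHA k l rho s h), (IHB k l rho s h); tauto.
  - unfold AllOmega; rewrite sat_all; apply forall_iff; intros x.
    rewrite sat_imp, sat_InOmega.
    assert (Hx : x ∈ om -> sat V (x .: rho) (interp (0 .: fun n => S (e n))
      (fun X => S (g X)) A) <-> ssat (x .: s) h A).
    { intros Hx; apply (IHA (S k) l); auto.
      - intros [|n] Hn; simpl; [reflexivity|apply He; lia].
      - intros [|n]; simpl; auto. }
    simpl; tauto.
  - rewrite sat_all; apply forall_iff; intros X. rewrite sat_imp, sat_SubOmega.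
    apply imp_iff_compat_l. apply (IHA k (S l)); auto.
    intros [|n] Hn; simpl; [reflexivity|apply Hg; lia].
Qed.

End Interpretation.

Theorem lemma1p5 (A : SOA.form) (hA : SOA.sentence A)
    (hprv : SOA.prv SOA.Sigma12m_CA_Pi11_CA0 A) :
  ST.prv ST.KPlr_M (ST.to_set A).
Proof.
  apply completeness. intros V HV rho. destruct hA as [h1 h2].
  (* [emp] is at once a number and a subset of omega, hence a legitimate dummy value for both
     sorts. *)
  apply (sat_interp HV A 0 0 rho (fun _ => emp) (fun _ => emp)); auto; try lia.
  - intros _; apply (emp_om HV).
  - apply (second_order_sound HV A hprv).
    + intros _; apply (emp_om HV).
    + intros _ x Hx; destruct (in_emp HV x Hx).
Qed.
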